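(* Let $n\geq 2$ be an integer and let $P\colon\mathbb{C}^n\to\mathbb{R}$ be a non-constant, homogeneous, plurisubharmonic polynomial without pluriharmonic terms. Assume that there exists a holomorphic function $G\colon\mathbb{C}^n\to\mathbb{C}$, nonsingular on a non-empty open set $U\subseteq\mathbb{C}^n$, such that $P$ is pluriharmonic along every level set of $G|_U$. Then there exist a homogeneous, subharmonic polynomial $s\colon\mathbb{C}\to\mathbb{R}$ without harmonic terms and a homogeneous holomorphic polynomial $h\colon\mathbb{C}^n\to\mathbb{C}$, such that $P=s\circ h$ on $\mathbb{C}^n$.
   Context: A polynomial $\mathbb{C}^n\to\mathbb{R}$ means a real-valued polynomial in the coordinates and their complex conjugates, written $\sum a_{\alpha,\beta}z^\alpha\overline{z}^\beta$; homogeneous means $\mathbb{R}$-homogeneous (all terms have the same total degree $|\alpha|+|\beta|$). ''Without pluriharmonic terms'' (for $n=1$: ''without harmonic terms'') means that no purely holomorphic or purely anti-holomorphic terms appear, i.e. $a_{\alpha,\beta}\neq 0$ implies $|\alpha|>0$ and $|\beta|>0$. $G$ is nonsingular on $U$ if its complex differential is nonzero at every point of $U$; then each level set of $G|_U$ is a complex submanifold of $U$ of dimension $n-1$, and $P$ being pluriharmonic along it means that the restriction of $P$ to this submanifold is pluriharmonic. *)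

(* Defs.v *)
From HB Require Import structures.
From mathcomp Require Import all_boot all_order all_algebra.
From mathcomp Require Import complex.
From mathcomp Require Import all_classical all_reals all_analysis.
(* The notations of mpoly clash with those of mathcomp-analysis, so only its
   coercions and structures are imported and its names are used qualified. *)
From mathcomp Require mpoly.
From mathcomp Require Import (canonicals, coercions) mpoly.

Set Implicit Arguments.
Unset Strict Implicit.
Unset Printing Implicit Defensive.

Import Order.TTheory GRing.Theory Num.Theory.
Import numFieldNormedType.Exports.

Local Open Scope classical_set_scope.
Local Open Scope complex_scope.
Local Open Scope ring_scope.

(* R[i] seen through its numFieldType structure, which gives access to the
   normed-module structure that mathcomp-analysis puts on every numFieldType;
   differentiability over this field is complex differentiability.  The
   ascription (R[i] : numFieldType) denotes the same type, but it leaves casts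
   and reverse coercions in the terms. *)
Notation CC R :=
  (Num.NumField.sort (ComplexField.complex_complex__canonical__Num_NumField R)).

(* the predicate displayed d.-homog by mpoly: every monomial has total degree d *)
Notation homog_deg d := (@mpoly.ishomog1 _ _ d mpoly.mdeg).

Section Polynomials.
Variables (R : realType) (m : nat).

(* (z_1, ..., z_m, conj z_1, ..., conj z_m) *)
Definition with_conj (z : 'rV[CC R]_m) : 'I_(m + m) -> CC R :=
  row_mx z (map_mx (@conjc R) z) 0.

(* A polynomial in z and conj z is a polynomial p in m + m variables: the
   coefficient a_{alpha,beta} is that of the monomial whose exponents on the
   first m variables are alpha and on the last m variables are beta. *)
Definition represents (p : mpoly.mpoly (m + m) (CC R)) (f : 'rV[CC R]_m -> R) :=
  forall z, (f z)%:C = mpoly.meval (with_conj z) p.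

Definition no_pluriharmonic_terms (p : mpoly.mpoly (m + m) (CC R)) :=
  forall mu : mpoly.multinom (m + m), mpoly.mcoeff mu p != 0 ->
    (0 < \sum_(i < m) mu (lshift m i))%N /\ (0 < \sum_(i < m) mu (rshift m i))%N.

Definition homogeneous_poly_without_pluriharmonic_terms
    (f : 'rV[CC R]_m -> R) :=
  exists (d : nat) (p : mpoly.mpoly (m + m) (CC R)),
    [/\ represents p f, p \is homog_deg d & no_pluriharmonic_terms p].

End Polynomials.

Section Subharmonicity.
Variable R : realType.

Definition upper_semicontinuous (X : topologicalType) (f : X -> R) :=
  forall x (a : R), f x < a -> \forall y \near x, f y < a.

(* The integral is extended-real valued, so no integrability is presupposed. *)
Definition subharmonic (u : CC R -> R) :=
  upper_semicontinuous u /\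
  forall (a : CC R) (r : R), 0 < r ->
    ((2 * pi * u a)%:E <=
     \int[@lebesgue_measure R]_(t in `[0%R, (2 * pi)%R])
        (u (a + r%:C * (cos t +i* sin t)))%:E)%E.

Definition plurisubharmonic (m : nat) (f : 'rV[CC R]_m -> R) :=
  upper_semicontinuous f /\
  forall a b : 'rV[CC R]_m, subharmonic (fun w : CC R => f (a + w *: b)).

End Subharmonicity.

Section Pluriharmonicity.
Variables (R : realType) (m : nat).
Implicit Types (u v z : 'rV[CC R]_m) (f : 'rV[CC R]_m -> R).

(* derivatives along the real line through z in direction u *)
Definition real_line f z u : R -> R := fun t => f (z + t%:C *: u).
Definition rderivable f z u := derivable (real_line f z u) 0 1.
Definition rderive u f z : R := derive1 (real_line f z u) 0.

(* For open D, these are the usual classes C^1(D) and C^2(D) with respect to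
   the underlying real structure. *)
Definition C1_on (D : set 'rV[CC R]_m) f :=
  forall u z, D z -> rderivable f z u /\ {for z, continuous (rderive u f)}.

Definition C2_on (D : set 'rV[CC R]_m) f :=
  C1_on D f /\ forall u, C1_on D (rderive u f).

(* the Laplacian at w = 0 of w |-> f (z + w *: v) *)
Definition line_laplacian f z v : R :=
  rderive v (rderive v f) z + rderive ((0 +i* 1 : CC R) *: v) (rderive ((0 +i* 1 : CC R) *: v) f) z.

(* C^2 and harmonic along every complex line *)
Definition pluriharmonic_on (D : set 'rV[CC R]_m) f :=
  C2_on D f /\ forall z v, D z -> line_laplacian f z v = 0.

End Pluriharmonicity.

Section LevelSets.
Variables (R : realType) (n : nat).

Definition nonsingular_on (U : set 'rV[CC R]_n) (G : 'rV[CC R]_n -> CC R) :=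
  forall z, U z -> exists v, 'd G z v != 0.

(* phi is a holomorphic parametrization, defined on the open set V of C^(n-1),
   of a piece of the level set {z in U | G z = c}. When G is nonsingular on U,
   this level set is an (n-1)-dimensional complex manifold, so injective
   holomorphic immersions into it are biholomorphic onto open subsets of it:
   the parametrizations are exactly the inverses of its holomorphic charts. *)
Definition level_set_parametrization (U : set 'rV[CC R]_n)
    (G : 'rV[CC R]_n -> CC R) (c : CC R)
    (V : set 'rV[CC R]_(n.-1)) (phi : 'rV[CC R]_(n.-1) -> 'rV[CC R]_n) :=
  [/\ open V,
      forall x, V x -> differentiable phi x /\ injective ('d phi x),
      {in V &, injective phi} &
      forall x, V x -> U (phi x) /\ G (phi x) = c].

Definition pluriharmonic_along_level_sets (U : set 'rV[CC R]_n)
    (G : 'rV[CC R]_n -> CC R) (P : 'rV[CC R]_n -> R) :=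
  forall (c : CC R) (V : set 'rV[CC R]_(n.-1))
         (phi : 'rV[CC R]_(n.-1) -> 'rV[CC R]_n),
    level_set_parametrization U G c V phi -> pluriharmonic_on V (P \o phi).

End LevelSets.

(* Main.v *)
Require Import Defs.
From HB Require Import structures.
From mathcomp Require Import all_boot all_order all_algebra.
From mathcomp Require Import ring lra.
From mathcomp Require Import complex.
From mathcomp Require Import all_classical all_reals all_analysis.
From mathcomp Require mpoly.
From mathcomp Require Import (canonicals, coercions) mpoly.

Set Implicit Arguments.
Unset Strict Implicit.
Unset Printing Implicit Defensive.

Import Order.TTheory GRing.Theory Num.Theory.
Import numFieldNormedType.Exports.

Local Open Scope classical_set_scope.
Local Open Scope complex_scope.
Local Open Scope ring_scope.

(** Write P(z) = p(z, conj z) and Q_j(z, w) for the derivative of p(z, w) in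
    the j-th variable of its first group.

    Local step.  By Baire's theorem ([differentiable_lipschitz_ball]) the
    function G is Lipschitz on some ball of U; Cauchy's formula then makes its
    derivatives Lipschitz and holomorphic ([holo_D]), so that the simplified
    Newton iteration gives charts of the level sets ([level_set_chart]).
    Comparing the Laplacian of P in such a chart with the second-order expansion
    of P along the curve shows that the Levi form of P vanishes on the tangent
    spaces of the level sets ([levi_tangent]).  As P is plurisubharmonic, its
    Levi form is positive semidefinite, so these tangent spaces lie in its
    kernel ([levi_isotropic]): every row of the Levi matrix is proportional to
    the gradient of G ([levi_rank]).

    Polarization.  The relation between the rows has holomorphic coefficients, so
    it may be differentiated in the conjugate variables
    ([gradient_relation_mderiv]); by Taylor's formula in these variables it
    holds with conj z replaced by an independent w, and, since p has no
    pluriharmonic terms, it passes from the derivatives of the Q_j to the Q_j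
    themselves.  Hence Q_i(z, w) Q_j(z, w') = Q_j(z, w) Q_i(z, w') on a ball, and
    therefore everywhere ([parallel_left_gradients]).

    Algebra.  The relation says that the homogeneous polynomials in z obtained
    from p(z, w) by fixing w and the degree in w (the slices) have pairwise
    parallel gradients.  By Euler's relation suitable powers of two of them are
    proportional ([parallel_gradient_powers]), and Euclid's algorithm on the
    degrees produces one homogeneous h of which they all are powers up to
    constants ([common_root]).  Hermitian symmetry turns this into
    P = s o h, where s(w) is a sum of terms c w^k (conj w)^l
    ([hermitian_structure]).

    Subharmonicity of s.  On lines through the origin P(t z) = s(t^e h(z)), which
    gives s a nonnegative mixed second derivative ([power_levi_ge0]); the mean
    value inequality follows because the means of s over circles are polynomials
    in the squared radius ([subharmonic_power_sum]). *)

(* The variable of index i, as a polynomial. *)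
Local Notation mX i := (mpoly.mpolyX _ (mpoly.mnm1 i)).

(** * Polynomials in several variables *)

Lemma mpoly_gen_ind (n : nat) (K : nzRingType) (Q : mpoly.mpoly n K -> Prop) :
  (forall c, Q (mpoly.mpolyC n c)) -> (forall i, Q (mX i)) ->
  (forall p q, Q p -> Q q -> Q (p + q)) ->
  (forall p q, Q p -> Q q -> Q (p * q)) -> forall p, Q p.
Proof.
move=> QC QX QD QM p.
have Q1 : Q 1 by have := QC 1; rewrite mpoly.mpolyC1.
have Q0 : Q 0 by have := QC 0; rewrite mpoly.mpolyC0.
rewrite [p]mpoly.mpolyE; apply: (big_ind Q) => // m _.
rewrite -mpoly.mul_mpolyC; apply: (QM) => //.
rewrite mpoly.mpolyXE_id; apply: (big_ind Q) => // i _.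
by elim: (m i) => [|k IH]; rewrite ?expr0 // exprS; apply: QM.
Qed.

Lemma mderivXU (n : nat) (K : nzRingType) (i j : 'I_n) :
  mpoly.mderiv i (mX j : mpoly.mpoly n K) = (i == j)%:R.
Proof.
rewrite mpoly.mderivX mpoly.mnm1E eq_sym; case: eqVneq => [->|_]; last by rewrite scale0r.
rewrite scale1r -mpoly.mpolyX0; congr mpoly.mpolyX.
apply/mpoly.mnmP => l; by rewrite mpoly.mnmBE mpoly.mnm0E subnn.
Qed.

(** Substitution in a polynomial, followed by a derivation that kills the
    constants, obeys the chain rule. *)
Lemma mpoly_chain_rule (n : nat) (K A : comNzRingType) (f : {rmorphism K -> A})
    (h : 'I_n -> A) (delta : A -> A) :
  {morph delta : x y / x + y} ->
  (forall x y, delta (x * y) = delta x * y + x * delta y) ->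
  (forall c, delta (f c) = 0) ->
  forall p, delta (mpoly.mmap f h p) =
    \sum_(i < n) mpoly.mmap f h (mpoly.mderiv i p) * delta (h i).
Proof.
move=> dD Leib dC; elim/mpoly_gen_ind => [c|j|p q IHp IHq|p q IHp IHq].
- rewrite mpoly.mmapC dC big1 // => i _.
  by rewrite mpoly.mderivC mpoly.mmap0 mul0r.
- rewrite mpoly.mmapX mpoly.mmap1U (bigD1 j) //= mderivXU eqxx rmorph1 mul1r.
  rewrite big1 ?addr0 // => i.
  by rewrite mderivXU => /negbTE ->; rewrite rmorph0 mul0r.
- rewrite rmorphD dD IHp IHq -big_split; apply: eq_bigr => i _ /=.
  by rewrite mpoly.mderivD rmorphD mulrDl.
- rewrite rmorphM Leib IHp IHq mulr_suml mulr_sumr -big_split.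
  apply: eq_bigr => i _ /=; rewrite mpoly.mderivM rmorphD !rmorphM mulrDl.
  by rewrite -!mulrA [_ * mpoly.mmap f h q]mulrC.
Qed.

Lemma poly_inj_eq0 (K : idomainType) (q : {poly K}) (u : nat -> K) :
  injective u -> (forall k, q.[u k] = 0) -> q = 0.
Proof.
move=> u_inj q0; apply: (@roots_geq_poly_eq0 _ _ [seq u k | k <- iota 0 (size q)]).
- by apply/allP => x /mapP[k _ ->]; apply/eqP/q0.
- by rewrite map_inj_uniq // iota_uniq.
- by rewrite size_map size_iota.
Qed.

Lemma natr_inj (K : numDomainType) : injective (fun k : nat => k%:R : K).
Proof. exact: (mulrIn (oner_neq0 K)). Qed.

(** Uniqueness of the digits in base N. *)
Lemma base_expansion_inj (N n : nat) (u v : 'I_n -> nat) :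
  (forall i, u i < N)%N -> (forall i, v i < N)%N ->
  (\sum_(i < n) u i * N ^ i = \sum_(i < n) v i * N ^ i)%N -> u =1 v.
Proof.
elim: n u v => [|n IH] u v uN vN; first by move=> _ [].
rewrite !big_ord_recl /= !muln1.
have shift w : (\sum_(i < n) w (lift ord0 i) * N ^ bump 0 i
   = N * \sum_(i < n) w (lift ord0 i) * N ^ i)%N.
  by rewrite big_distrr /=; apply: eq_bigr => i _; rewrite expnS mulnCA.
rewrite !shift => E.
have N0 : (0 < N)%N by apply: leq_ltn_trans (uN ord0).
have E0 : u ord0 = v ord0.
  have := congr1 (modn^~ N) E; rewrite ![(N * _)%N]mulnC.
  by rewrite ![(_ + _ * N)%N]addnC !modnMDl !modn_small.
move: E; rewrite E0 => /addnI /eqP; rewrite eqn_pmul2l // => /eqP E i.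
have [j ->|->] := unliftP ord0 i; last by [].
exact: (IH (fun j => u (lift ord0 j)) (fun j => v (lift ord0 j))).
Qed.

(** The substitution of powers of one indeterminate with rapidly growing
    exponents separates the monomials. *)
Lemma mpoly_nat_eq0 (n : nat) (K : numFieldType) (f : mpoly.mpoly n K) :
  (forall x : 'I_n -> nat, mpoly.meval (fun i => (x i)%:R) f = 0) -> f = 0.
Proof.
move=> f0.
pose N := (mpoly.mmeasure mpoly.mdeg f).+1.
pose phi := mpoly.mmap (@polyC K) (fun i : 'I_n => 'X^(N ^ i)).
have phi0 : phi f = 0.
  apply: (poly_inj_eq0 (@natr_inj K)) => k.
  rewrite -[RHS](f0 (fun i : 'I_n => (k ^ (N ^ i))%N)).
  rewrite /phi /mpoly.mmap mpoly.mevalE.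
  rewrite horner_sum; apply: eq_bigr => m _.
  rewrite hornerM hornerC; congr (_ * _).
  rewrite /mpoly.mmap1 horner_prod; apply: eq_bigr => i _.
  by rewrite !hornerE natrX.
apply/mpoly.mpolyP => m; rewrite mpoly.mcoeff0; apply/eqP.
case: (boolP (m \in mpoly.msupp f)) => [mf|]; last by rewrite -mpoly.mcoeff_eq0.
have expN m' : m' \in mpoly.msupp f -> forall i : 'I_n, (m' i < N)%N.
  move=> m'f i; rewrite /N ltnS; apply: leq_trans (ltnW (mpoly.msize_mdeg_lt m'f)).
  by rewrite mpoly.mdegE (bigD1 i) //= leq_addr.
have E m' : mpoly.mmap1 (fun i : 'I_n => 'X^(N ^ i)) m' =
   'X^(\sum_(i < n) m' i * N ^ i) :> {poly K}.
  rewrite /mpoly.mmap1 -prodrXr; apply: eq_bigr => i _.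
  by rewrite -exprM mulnC.
move/(congr1 (fun q : {poly K} => q`_(\sum_(i < n) m i * N ^ i))): phi0.
rewrite coef0 /phi /mpoly.mmap coef_sum (bigD1_seq m mf (mpoly.msupp_uniq f)) /=.
rewrite E coefCM coefXn eqxx mulr1 big1_seq ?addr0 => [->//|m' /andP[m'm m'f]].
rewrite E coefCM coefXn; case: eqP => [e|_]; last by rewrite mulr0.
case/eqP: m'm; apply/mpoly.mnmP => i; apply: esym.
by apply: (base_expansion_inj (expN _ mf) (expN _ m'f)).
Qed.

Lemma mpoly_eval_eq0 (n : nat) (K : numFieldType) (f : mpoly.mpoly n K) :
  (forall x : 'I_n -> K, mpoly.meval x f = 0) -> f = 0.
Proof. by move=> f0; apply: mpoly_nat_eq0. Qed.

(** * Restriction to lines and parallel gradients *)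

Lemma mpoly_neq0P (n : nat) (K : numFieldType) (f : mpoly.mpoly n K) :
  f != 0 -> exists x : 'I_n -> K, mpoly.meval x f != 0.
Proof.
move=> f0; apply: contrapT => nE; case/eqP: f0; apply: mpoly_eval_eq0 => x.
by apply/eqP/negPn/negP => fx; apply: nE; exists x.
Qed.

Lemma size_coefM_top (A : nzRingType) (p q : {poly A}) a b :
  (size p <= a.+1)%N -> (size q <= b.+1)%N ->
  (size (p * q)%R <= (a + b).+1)%N /\ (p * q)`_(a + b)%N = p`_a * q`_b.
Proof.
move=> sp sq; split.
  apply: leq_trans (size_polyMleq _ _) _.
  by rewrite -subn1 leq_subLR add1n -addSn (leq_trans (leq_add sp sq)) // addSn addnS.
rewrite coefM (bigD1 (inord a)) //= inordK ?ltnS ?leq_addr //.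
rewrite addKn big1 ?addr0 // => i.
rewrite -val_eqE /= inordK ?ltnS ?leq_addr // => ia.
case: (ltngtP i a) ia => // [ia|ai] _.
- rewrite [q`__]nth_default ?mulr0 //; apply: leq_trans sq _.
  by rewrite ltn_subRL ltn_add2r.
- by rewrite nth_default ?mul0r //; apply: leq_trans sp _.
Qed.

(** The restriction f(x + t v) of a polynomial to a parametrized line, as a
    polynomial in t; the coefficients of f are mapped to the ring of x and v. *)
Definition mline (n : nat) (K A : comNzRingType) (phi : {rmorphism K -> A})
    (x v : 'I_n -> A) : mpoly.mpoly n K -> {poly A} :=
  mpoly.mmap (@polyC A \o phi) (fun i => (x i)%:P + (v i)%:P * 'X).

Section Line.
Variables (n : nat) (K A : comNzRingType) (phi : {rmorphism K -> A}).
Variables (x v : 'I_n -> A).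
Implicit Types f g : mpoly.mpoly n K.

Lemma mlineX i : mline phi x v (mX i) = (x i)%:P + (v i)%:P * 'X.
Proof. by rewrite [LHS]mpoly.mmapX mpoly.mmap1U. Qed.

Lemma mlineC c : mline phi x v (mpoly.mpolyC n c) = (phi c)%:P.
Proof. exact: mpoly.mmapC. Qed.

Lemma mlineD : {morph mline phi x v : f g / f + g}.
Proof. exact: rmorphD. Qed.

Lemma mlineM : {morph mline phi x v : f g / f * g}.
Proof. exact: rmorphM. Qed.

Lemma mline_exp k : {morph mline phi x v : f / f ^+ k}.
Proof. exact: rmorphXn. Qed.

Lemma horner_mline f t :
  (mline phi x v f).[t] = mpoly.mmap phi (fun i => x i + t * v i) f.
Proof.
rewrite /mline /mpoly.mmap horner_sum; apply: eq_bigr => m _.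
rewrite hornerM hornerC; congr (_ * _).
rewrite /mpoly.mmap1 horner_prod; apply: eq_bigr => i _.
by rewrite horner_exp hornerD hornerM !hornerC hornerX mulrC.
Qed.

Lemma horner_mline0 f : (mline phi x v f).[0] = mpoly.mmap phi x f.
Proof.
rewrite horner_mline /mpoly.mmap; apply: eq_bigr => m _; congr (_ * _).
by apply: mpoly.mmap1_eq => i; rewrite mul0r addr0.
Qed.

Lemma deriv_mline f :
  (mline phi x v f)^`() = \sum_(i < n) v i *: mline phi x v (mpoly.mderiv i f).
Proof.
rewrite (@mpoly_chain_rule n K {poly A} (@polyC A \o phi) _ (@deriv A)).
- apply: eq_bigr => i _; rewrite derivD derivM !derivC derivX mul0r mulr1 !add0r.
  by rewrite mulrC mul_polyC.
- exact: derivD.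
- exact: derivM.
- by move=> c; apply: derivC.
Qed.

(** For the total degree a, the coefficient of t^a in f(x + t v) is f(v). *)
Let top f a := (size (mline phi x v f) <= a.+1)%N /\
  (mline phi x v f)`_a = mpoly.mmap phi v f.

Let topM f a g b : top f a -> top g b -> top (f * g) (a + b)%N.
Proof.
move=> [sf cf] [sg cg]; have [s c] := size_coefM_top sf sg.
by split; rewrite mlineM // c cf cg rmorphM.
Qed.

Let top1 : top 1 0.
Proof.
split; rewrite -mpoly.mpolyC1 mlineC ?size_polyC_leq1 //.
by rewrite coefC eqxx mpoly.mmapC.
Qed.

Let topX i : top (mX i) 1.
Proof.
split; rewrite mlineX.
  apply: leq_trans (size_polyD _ _) _; rewrite geq_max.
  rewrite (leq_trans (size_polyC_leq1 _)) //=.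
  by rewrite mul_polyC (leq_trans (size_scale_leq _ _)) // size_polyX.
by rewrite coefD coefC coefMX coefC /= add0r mpoly.mmapX mpoly.mmap1U.
Qed.

Let topXm m : top (mpoly.mpolyX K m) (mpoly.mdeg m).
Proof.
rewrite mpoly.mpolyXE_id mpoly.mdegE.
apply: (big_ind2 top) => [|f a g b|i _]; [exact: top1|exact: topM|].
elim: (m i) => [|k IH]; first by rewrite expr0; exact: top1.
by rewrite exprS -add1n; apply: topM.
Qed.

Lemma mline_homog a f : f \is @mpoly.ishomog1 n K a mpoly.mdeg ->
  (size (mline phi x v f) <= a.+1)%N /\
  (mline phi x v f)`_a = mpoly.mmap phi v f.
Proof.
move=> /mpoly.dhomogP fa; have sumtop s (F : mpoly.multinom n -> mpoly.mpoly n K) :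
    {in s, forall m, top (F m) a} -> top (\sum_(m <- s) F m) a.
  elim: s => [|m s IH] sF.
    rewrite big_nil /top -mpoly.mpolyC0 mlineC mpoly.mmapC.
    have p0 : phi 0 = 0 by exact: rmorph0.
    split; first by rewrite (leq_trans (size_polyC_leq1 _)).
    by rewrite coefC; case: ifP => // _; apply: esym.
  have [sg cg] := sF m (mem_head _ _).
  have [|sh ch] := IH; first by move=> m' m's; apply: sF; rewrite inE m's orbT.
  rewrite big_cons; split; rewrite mlineD.
    by apply: leq_trans (size_polyD _ _) _; rewrite geq_max sg.
  by rewrite coefD cg ch rmorphD.
rewrite -/(top f a) [f]mpoly.mpolyE; apply: sumtop => m mf.
rewrite -(fa m mf) -mpoly.mul_mpolyC.
have [s c] := topXm m; split; rewrite mlineM mlineC.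
  by rewrite mul_polyC (leq_trans (size_scale_leq _ _)).
by rewrite coefCM c rmorphM /= mpoly.mmapC.
Qed.

End Line.

Lemma map_mline (n : nat) (K A B : comNzRingType) (phi : {rmorphism K -> A})
    (psi : {rmorphism A -> B}) (x v : 'I_n -> A) f :
  map_poly psi (mline phi x v f) = mline (psi \o phi) (psi \o x) (psi \o v) f.
Proof.
elim/mpoly_gen_ind: f => [c|i|f g IHf IHg|f g IHf IHg].
- by rewrite !mlineC map_polyC.
- by rewrite !mlineX rmorphD rmorphM /= !map_polyC map_polyX.
- by rewrite !mlineD rmorphD /= IHf IHg.
- by rewrite !mlineM rmorphM /= IHf IHg.
Qed.

Lemma horner_mline_id (n : nat) (K : comNzRingType) (x v : 'I_n -> K) f t :
  (mline idfun x v f).[t] = mpoly.meval (fun i => x i + t * v i) f.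
Proof. exact: horner_mline. Qed.

Lemma horner_mline_id0 (n : nat) (K : comNzRingType) (x v : 'I_n -> K) f :
  (mline idfun x v f).[0] = mpoly.meval x f.
Proof. exact: horner_mline0. Qed.

(** Polynomials with vanishing Wronskian are proportional; a zero at the origin
    makes the constant zero. *)
Lemma poly_wronskian_eq0 (K : numDomainType) (h k : {poly K}) :
  h`_0 != 0 -> k`_0 = 0 -> h * k^`() = k * h^`() -> k = 0.
Proof.
move=> h0 k0 E; apply/polyP => i; rewrite coef0.
elim/ltn_ind: i => -[//|i] IH.
have := congr1 (fun p : {poly K} => p`_i) E; rewrite !coefM.
rewrite (@big1 _ _ _ _ _ _ (fun j : 'I_i.+1 => k`_j * _)); last first.
  by move=> j _; rewrite IH ?mul0r // ltnS ltnW.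
rewrite big_ord_recl subn0 big1 ?addr0 => [|j _]; last first.
  by rewrite coef_deriv IH ?mul0rn ?mulr0 // ltnS /= /bump leq0n add1n subnSK // leq_subr.
rewrite coef_deriv => /eqP; rewrite mulf_eq0 (negbTE h0) /=.
by rewrite mulrn_eq0 /= => /eqP.
Qed.

Section Proportional.
Variables (n : nat) (K : numFieldType).
Implicit Types f g : mpoly.mpoly n K.

(** Two polynomials whose logarithmic derivatives agree are proportional. *)
Lemma mderiv_cross_proportional f g : g != 0 ->
  (forall j, g * mpoly.mderiv j f = f * mpoly.mderiv j g) ->
  exists c, f = c *: g.
Proof.
move=> /mpoly_neq0P[q gq] E; exists (mpoly.meval q f / mpoly.meval q g).
set c := _ / _; apply/eqP; rewrite -subr_eq0; set k := f - _.
have kq : mpoly.meval q k = 0.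
  by rewrite /k mpoly.mevalB mpoly.mevalZ /c divfK // subrr.
have Ek j : g * mpoly.mderiv j k = k * mpoly.mderiv j g.
  by rewrite /k mpoly.mderivB mpoly.mderivZ mulrBr mulrBl E -scalerAr -scalerAl.
apply/eqP/mpoly_eval_eq0 => x.
pose v i := x i - q i.
have L0 : mline idfun q v k = 0.
  apply: (@poly_wronskian_eq0 _ (mline idfun q v g)).
  - by rewrite -horner_coef0 horner_mline_id0.
  - by rewrite -horner_coef0 horner_mline_id0.
  - rewrite !deriv_mline !mulr_sumr; apply: eq_bigr => i _.
    by rewrite -!scalerAr -!mlineM Ek.
have := horner_mline_id q v k 1; rewrite L0 horner0 => ->.
by apply: mpoly.meval_eq => i; rewrite mul1r /v addrC subrK.
Qed.

(** Euler's relation. *)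
Lemma euler_homog a f : f \is @mpoly.ishomog1 n K a mpoly.mdeg ->
  \sum_(i < n) mX i * mpoly.mderiv i f = a%:R *: f.
Proof.
move=> /mpoly.dhomogP fa.
rewrite [in RHS](mpoly.mpolyE f) scaler_sumr.
under eq_bigr => i _ do
  rewrite {1}(mpoly.mpolyE f) raddf_sum /= mulr_sumr.
rewrite exchange_big /=; apply: eq_big_seq => m mf.
have -> : a = (\sum_(i < n) m i)%N by rewrite -mpoly.mdegE; apply: esym; apply: (fa m mf).
rewrite natr_sum scaler_suml; apply: eq_bigr => i _.
rewrite mpoly.mderivZ mpoly.mderivX -!scalerAr scalerA mulrC -scalerA.
case: (posnP (m i)) => [->|mi]; first by rewrite !scale0r.
congr (_ *: (_ *: _)); rewrite -mpoly.mpolyXD; congr mpoly.mpolyX.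
apply/mpoly.mnmP => j; rewrite mpoly.mnmDE mpoly.mnmBE mpoly.mnm1E.
by case: eqVneq => [<-|_]; rewrite ?subn0 // subnKC.
Qed.

Lemma mderiv_exp j f k :
  mpoly.mderiv j (f ^+ k.+1) = k.+1%:R *: (f ^+ k * mpoly.mderiv j f).
Proof.
elim: k => [|k IH]; first by rewrite expr1 expr0 mul1r scale1r.
rewrite exprS mpoly.mderivM IH -scalerAr mulrA -exprS mulrC.
by rewrite -[k.+2]addn1 natrD scalerDl scale1r addrC.
Qed.

(** Nonzero homogeneous polynomials with parallel gradients are powers of one
    another up to a constant: by Euler's relation their suitable powers have
    the same logarithmic derivatives. *)
Lemma parallel_gradient_powers a b f g :
  f \is @mpoly.ishomog1 n K a mpoly.mdeg -> f != 0 ->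
  g \is @mpoly.ishomog1 n K b mpoly.mdeg -> (0 < a)%N -> (0 < b)%N ->
  (forall i j, mpoly.mderiv i f * mpoly.mderiv j g =
               mpoly.mderiv j f * mpoly.mderiv i g) ->
  exists c, g ^+ a = c *: f ^+ b.
Proof.
case: a => // a; case: b => // b fa f0 gb _ _ E.
apply: mderiv_cross_proportional => [|j]; first by rewrite expf_neq0.
have Eu : a.+1%:R *: (f * mpoly.mderiv j g) = b.+1%:R *: (g * mpoly.mderiv j f).
  rewrite !scalerAl -(euler_homog fa) -(euler_homog gb) !mulr_suml.
  by apply: eq_bigr => i _; rewrite -!mulrA E [mpoly.mderiv j f * _]mulrC.
rewrite !mderiv_exp.
rewrite -!scalerAr !exprS.
transitivity (f ^+ b * g ^+ a * (a.+1%:R *: (f * mpoly.mderiv j g))).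
  by rewrite -scalerAr; congr (_ *: _); ring.
by rewrite Eu -scalerAr; congr (_ *: _); ring.
Qed.

End Proportional.

(** * Divisibility of homogeneous polynomials *)

Section Divisibility.
Variables (n : nat) (K : numFieldType).
Implicit Types f g : mpoly.mpoly n K.
Local Notation homog d := (@mpoly.ishomog1 n K d mpoly.mdeg).

(** In suitable coordinates f is monic in one variable, so that g can be
    divided by f; the remainder vanishes because it does so on every line in
    the direction of that variable. *)
Lemma homog_dvd_of_exp a f g u k : f \is homog a -> f != 0 -> (0 < k)%N ->
  f ^+ k * u = g ^+ k -> exists w, g = f * w.
Proof.
move=> fa f0 k0 E; have [q fq] := mpoly_neq0P f0.
pose A : comNzRingType := mpoly.mpoly n K.
pose phi : {rmorphism K -> A} := @mpoly.mpolyC n K.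
pose X i : A := mX i.
pose shift := mline phi X (phi \o q).
have shift0 h : (shift h).[0] = h.
  rewrite horner_mline0; elim/mpoly_gen_ind: h => [c|i|h l IHh IHl|h l IHh IHl].
  - exact: mpoly.mmapC.
  - by rewrite mpoly.mmapX mpoly.mmap1U.
  - by rewrite rmorphD /= IHh IHl.
  - by rewrite rmorphM /= IHh IHl.
have ev_shift (x : 'I_n -> K) h :
    map_poly (mpoly.meval x : A -> K) (shift h) = mline idfun x q h.
  rewrite /shift map_mline.
  elim/mpoly_gen_ind: h => [c|i|h l IHh IHl|h l IHh IHl].
  - by rewrite !mlineC /= mpoly.mevalC.
  - by rewrite !mlineX /= mpoly.mevalC mpoly.mevalXU.
  - by rewrite !mlineD IHh IHl.
  - by rewrite !mlineM IHh IHl.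
have [sf cf] := mline_homog phi X (phi \o q) fa.
have cq : mpoly.mmap phi (phi \o q) f = phi (mpoly.meval q f).
  elim/mpoly_gen_ind: (f) => [c|i|h l IHh IHl|h l IHh IHl].
  - by rewrite mpoly.mmapC mpoly.mevalC.
  - by rewrite mpoly.mmapX mpoly.mmap1U mpoly.mevalXU.
  - by rewrite rmorphD /= IHh IHl mpoly.mevalD rmorphD.
  - by rewrite rmorphM /= IHh IHl mpoly.mevalM rmorphM.
rewrite cq in cf.
(* The top coefficient of f(x + t q) in t is the constant f(q), so that F is
   monic in t and g(x + t q) can be divided by it. *)
pose c : A := phi (mpoly.meval q f)^-1.
pose F : {poly A} := c%:P * shift f.
have Fa : F`_a = 1.
  by rewrite coefCM cf -rmorphM mulVf // rmorph1.
have sF : size F = a.+1.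
  apply/eqP; rewrite eqn_leq; apply/andP; split.
    by rewrite /F mul_polyC (leq_trans (size_scale_leq _ _)).
  rewrite ltnNge; apply/negP => /leq_sizeP/(_ a (leqnn a)) F0.
  by have := oner_eq0 A; rewrite -Fa F0 eqxx.
have Fm : F \is monic by rewrite monicE lead_coefE sF /= Fa.
have D := Pdiv.RingMonic.rdivp_eq Fm (shift g).
set Q := Pdiv.Ring.rdivp _ _ in D; set r := Pdiv.Ring.rmodp _ _ in D.
have sr : (size r < a.+1)%N.
  by rewrite -sF Pdiv.Ring.ltn_rmodp monic_neq0.
have r0 : r = 0.
  apply/polyP => i; rewrite coef0; apply: mpoly_eval_eq0 => x.
  pose ev (h : {poly A}) := map_poly (mpoly.meval x : A -> K) h.
  (* On each line in the direction q, a power of F divides a power of g. *)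
  suff rx0 : ev r = 0 by have := coef0 K i; rewrite -rx0 coef_map.
  have Fx : ev F = ((mpoly.meval q f)^-1)%:P * mline idfun x q f.
    by rewrite /ev rmorphM /= map_polyC /= mpoly.mevalC ev_shift.
  have Fxm : ev F \is monic by apply: monic_map.
  have sFx : size (ev F) = a.+1.
    by rewrite /ev size_map_poly_id0 // (monicP Fm) rmorph1 oner_neq0.
  have dv : ev F %| mline idfun x q g.
    rewrite Fx mul_polyC dvdpZl ?invr_eq0 //.
    by rewrite -(@dvdp_pexp2r _ _ _ k) // -!mline_exp -E mlineM dvdp_mulr.
  have dr : ev F %| ev r.
    have := ev_shift x g; rewrite D rmorphD rmorphM /= => e.
    by move: dv; rewrite -e dvdp_addr // dvdp_mull.
  apply/eqP/negPn/negP => rx; have := dvdp_leq rx dr.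
  rewrite sFx leqNgt; case/negP; apply: leq_ltn_trans sr.
  exact: size_poly.
exists (Q.[0] * c).
rewrite -[LHS]shift0 D r0 addr0 hornerM hornerM hornerC shift0.
by rewrite mulrA mulrC.
Qed.

Lemma homog_cofactor a b f g w : f \is homog a -> f != 0 ->
  g \is homog b -> g != 0 -> g = f * w ->
  (a <= b)%N /\ w \is homog (b - a).
Proof.
move=> fa f0 gb g0 E; pose M := mpoly.mmeasure mpoly.mdeg w.
have Ew : w = \sum_(j < M) mpoly.pihomog mpoly.mdeg j w.
  by apply: mpoly.pihomog_partitionE.
have Eg : g = \sum_(j < M | (a + j == b)%N) f * mpoly.pihomog mpoly.mdeg j w.
  rewrite -[LHS](mpoly.pihomog_dE gb) E {1}Ew mulr_sumr raddf_sum /=.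
  rewrite [RHS]big_mkcond; apply: eq_bigr => j _.
  have h : f * mpoly.pihomog mpoly.mdeg j w \is homog (a + j).
    by apply: mpoly.dhomogM => //; apply: mpoly.pihomogP.
  case: eqP => [e|/eqP e]; first by apply: mpoly.pihomog_dE; rewrite -e.
  exact: mpoly.pihomog_ne0 e h.
have [ab|ba] := leqP a b; last first.
  case/eqP: g0; rewrite Eg big_pred0 // => j; apply/negbTE.
  by rewrite neq_ltn (leq_trans ba) ?leq_addr // orbT.
split=> //.
have -> : w = \sum_(j < M | (a + j == b)%N) mpoly.pihomog mpoly.mdeg j w.
  by apply: (mulfI f0); rewrite -E Eg mulr_sumr.
apply: rpred_sum => j /eqP <-; rewrite addKn; exact: mpoly.pihomogP.
Qed.

Lemma homog0_const f : f \is homog 0 -> exists c, f = mpoly.mpolyC n c.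
Proof.
move=> /mpoly.dhomogP f0; exists (mpoly.mcoeff mpoly.mnm0 f).
apply/mpoly.mpolyP => m; rewrite mpoly.mcoeffC.
case: (eqVneq mpoly.mnm0 m) => [<-|m0]; first by rewrite mulr1.
rewrite mulr0; apply/eqP; rewrite mpoly.mcoeff_eq0; apply/negP => mf.
have := f0 m mf; rewrite -[LHS]/(mpoly.mdeg m) => /eqP; rewrite mpoly.mdeg_eq0 eq_sym (negbTE m0).
done.
Qed.
End Divisibility.

(** * Common roots of homogeneous polynomials *)

Section CommonRoot.
Variables (n : nat) (K : numFieldType).
Implicit Types f g h : mpoly.mpoly n K.
Local Notation homog d := (@mpoly.ishomog1 n K d mpoly.mdeg).

(** If the k-th powers are proportional, f divides g and the degrees agree. *)
Lemma homog_exp_proportional a f g k c : (0 < k)%N ->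
  f \is homog a -> f != 0 -> g \is homog a ->
  g ^+ k = c *: f ^+ k -> exists c', g = c' *: f.
Proof.
move=> k0 fa f0 ga E.
have [->|g0] := eqVneq g 0; first by exists 0; rewrite scale0r.
have [|w Ew] := @homog_dvd_of_exp _ _ _ _ g (mpoly.mpolyC n c) k fa f0 k0.
  by rewrite E -mpoly.mul_mpolyC mulrC.
have [_] := homog_cofactor fa f0 ga g0 Ew.
rewrite subnn => /homog0_const[c' Ec]; exists c'.
by rewrite Ew Ec mulrC mpoly.mul_mpolyC.
Qed.

(** Euclid's algorithm on the degrees. *)
Lemma common_root2 a b f g c : (0 < a)%N -> (0 < b)%N ->
  f \is homog a -> f != 0 -> g \is homog b -> g != 0 ->
  g ^+ a = c *: f ^+ b ->
  exists h e, [/\ (0 < e)%N, h \is homog e,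
    exists c1 k, f = c1 *: h ^+ k & exists c2 l, g = c2 *: h ^+ l].
Proof.
have [N] := ubnP (a + b)%N; elim: N a b f g c => // N IH a b f g c.
wlog ab : a b f g c / (a <= b)%N => [W|].
  move=> abN a0 b0 fa f0 gb g0 E.
  have [ab|/ltnW ba] := leqP a b; first exact: (W a b f g c).
  have c0 : c != 0.
    by apply: contraNneq g0 => c0; move: E; rewrite c0 scale0r => /eqP; rewrite expf_eq0 a0.
  have [||h [e [e0 he hg hf]]] := W b a g f c^-1 ba _ b0 a0 gb g0 fa f0.
  - by rewrite addnC.
  - by rewrite E scalerA mulVf // scale1r.
  by exists h, e; split.
rewrite ltnS => abN a0 b0 fa f0 gb g0 E.
have [|w Ew] := @homog_dvd_of_exp _ _ _ _ g (c *: f ^+ (b - a)) a fa f0 a0.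
  by rewrite E -scalerAr -exprD subnKC.
have [_ wh] := homog_cofactor fa f0 gb g0 Ew.
have w0 : w != 0 by apply: contraNneq g0 => w0; rewrite Ew w0 mulr0.
have [ba0|ba0] := posnP (b - a).
  move: wh; rewrite ba0 => /homog0_const[d Ed]; exists f, a; split=> //.
    by exists 1, 1%N; rewrite scale1r expr1.
  by exists d, 1%N; rewrite expr1 Ew Ed mulrC mpoly.mul_mpolyC.
have [||h [e [e0 he [c1 [k fh]] [c2 [l wl]]]]] :=
    IH a (b - a)%N f w c _ a0 ba0 fa f0 wh w0.
- by rewrite subnKC // (leq_trans _ abN) // -[X in (X < _)%N]add0n ltn_add2r.
- apply: (mulfI (expf_neq0 a f0)); rewrite -exprMn -Ew E -scalerAr -exprD.
  by rewrite subnKC.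
exists h, e; split=> //; first by exists c1, k.
exists (c1 * c2), (k + l)%N.
by rewrite Ew {1}fh wl -scalerAl -scalerAr scalerA exprD.
Qed.

(** Homogeneous polynomials with pairwise parallel gradients are, up to
    constants, powers of one homogeneous polynomial. *)
Lemma common_root (s : seq (mpoly.mpoly n K)) :
  (forall f, f \in s -> f != 0 /\ exists2 a, (0 < a)%N & f \is homog a) ->
  {in s &, forall f g i j, mpoly.mderiv i f * mpoly.mderiv j g =
                           mpoly.mderiv j f * mpoly.mderiv i g} ->
  s != [::] ->
  exists h e, [/\ (0 < e)%N, h \is homog e &
    forall f, f \in s -> exists c k, f = c *: h ^+ k].
Proof.
elim: s => // f [|g s] IH Hs Hp _.
  have [f0 [a a0 fa]] := Hs f (mem_head _ _).
  exists f, a; split=> // f'; rewrite inE => /eqP ->.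
  by exists 1, 1%N; rewrite scale1r expr1.
have [|||h [e [e0 he hs]]] := IH.
- by move=> f' f's; apply: Hs; rewrite inE f's orbT.
- by move=> f' g' f's g's; apply: Hp; rewrite inE ?f's ?g's orbT.
- by [].
have [f0 [b b0 fb]] := Hs f (mem_head _ _).
have gs : g \in f :: g :: s by rewrite !inE eqxx orbT.
have [g0 [a a0 ga]] := Hs g gs.
have [c [k gE]] := hs g (mem_head _ _).
have c0 : c != 0 by apply: contraNneq g0 => c0; rewrite gE c0 scale0r.
have hk0 : h ^+ k != 0 by apply: contraNneq g0 => hk0; rewrite gE hk0 scaler0.
have aE : a = (e * k)%N.
  apply: (mpoly.dhomog_uniq (p := h ^+ k)) => //; last by apply: (@mpoly.dhomogMn _ _ mpoly.mdeg _ _ k he).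
  have -> : h ^+ k = c^-1 *: g by rewrite gE scalerA mulVf // scale1r.
  exact: mpoly.dhomogZ.
have k0 : (0 < k)%N by move: a0; rewrite aE muln_gt0 => /andP[].
have h0 : h != 0 by apply: contraNneq hk0 => ->; rewrite expr0n eqn0Ngt k0.
have [d E] := parallel_gradient_powers ga g0 fb a0 b0 (Hp _ _ gs (mem_head _ _)).
have hb : h ^+ b \is homog (e * b) by apply: (@mpoly.dhomogMn _ _ mpoly.mdeg).
have fe : f ^+ e \is homog (e * b).
  by rewrite mulnC; apply: (@mpoly.dhomogMn _ _ mpoly.mdeg).
have Ek : (f ^+ e) ^+ k = (d * c ^+ b) *: (h ^+ b) ^+ k.
  by rewrite -exprM -aE E gE exprZn scalerA -!exprM mulnC.
have [d' E'] := homog_exp_proportional k0 hb (expf_neq0 b h0) fe Ek.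
have [h' [e' [e'0 he' [c1 [k1 hE]] [c2 [k2 fE]]]]] :=
  common_root2 e0 b0 he h0 fb f0 E'.
exists h', e'; split=> // f'; rewrite inE => /orP[/eqP ->|/hs[c' [k' ->]]].
  by exists c2, k2.
exists (c' * c1 ^+ k'), (k1 * k')%N.
by rewrite hE exprZn scalerA exprM.
Qed.

End CommonRoot.

(** * Polynomials in two groups of variables *)

Section Bievaluation.
Variables (n : nat) (K : comNzRingType).
Implicit Types (z w : 'rV[K]_n) (p q : mpoly.mpoly (n + n) K).

(** The value at (z, w) of a polynomial in two groups of n variables. *)
Definition bieval z w p : K := mpoly.meval (row_mx z w 0) p.

Lemma bievalXl z w j : bieval z w (mX (lshift n j)) = z 0 j.
Proof. by rewrite /bieval mpoly.mevalXU row_mxEl. Qed.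

Lemma bievalXr z w j : bieval z w (mX (rshift n j)) = w 0 j.
Proof. by rewrite /bieval mpoly.mevalXU row_mxEr. Qed.

Lemma bievalC z w c : bieval z w (mpoly.mpolyC _ c) = c.
Proof. exact: mpoly.mevalC. Qed.

Lemma bievalD z w p q : bieval z w (p + q) = bieval z w p + bieval z w q.
Proof. exact: mpoly.mevalD. Qed.

Lemma bievalM z w p q : bieval z w (p * q) = bieval z w p * bieval z w q.
Proof. exact: mpoly.mevalM. Qed.

Lemma bievalB z w p q : bieval z w (p - q) = bieval z w p - bieval z w q.
Proof. exact: mpoly.mevalB. Qed.

Lemma bievalZ z w c p : bieval z w (c *: p) = c * bieval z w p.
Proof. exact: mpoly.mevalZ. Qed.

(** Induction on polynomials in two groups of variables. *)
Lemma mpoly_bi_ind (Q : mpoly.mpoly (n + n) K -> Prop) :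
  (forall c, Q (mpoly.mpolyC _ c)) ->
  (forall i, Q (mX (lshift n i))) -> (forall i, Q (mX (rshift n i))) ->
  (forall p q, Q p -> Q q -> Q (p + q)) ->
  (forall p q, Q p -> Q q -> Q (p * q)) -> forall p, Q p.
Proof.
move=> QC Ql Qr QD QM; apply: mpoly_gen_ind => // i.
by rewrite -(fintype.splitK i); case: (fintype.split i) => j /=.
Qed.

End Bievaluation.

(** A derivation acts on polynomials through their coefficients. *)
Section CoefDerivation.
Variables (A : comNzRingType) (d : A -> A).
Hypothesis dD : {morph d : x y / x + y}.
Hypothesis dM : forall x y, d (x * y) = d x * y + x * d y.

Let d0 : d 0 = 0.
Proof. by apply: (addIr (d 0)); rewrite -dD !add0r. Qed.

Let dsum (I : Type) (r : seq I) (F : I -> A) :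
  d (\sum_(i <- r) F i) = \sum_(i <- r) d (F i).
Proof. by apply: (big_morph d). Qed.

(** The derivation d applied to the coefficients of a polynomial. *)
Definition coefwise (u : {poly A}) : {poly A} := map_poly d u.

Lemma coef_coefwise u i : (coefwise u)`_i = d u`_i.
Proof. by rewrite coef_map_id0. Qed.

Lemma coefwiseD : {morph coefwise : u v / u + v}.
Proof. by move=> u v; apply/polyP => i; rewrite coefD !coef_coefwise coefD dD. Qed.

Lemma coefwiseM u v : coefwise (u * v) = coefwise u * v + u * coefwise v.
Proof.
apply/polyP => i; rewrite coef_coefwise coefD !coefM -big_split dsum /=.
by apply: eq_bigr => k _; rewrite !coef_coefwise dM.
Qed.

Lemma coefwiseC c : coefwise c%:P = (d c)%:P.
Proof.
by apply/polyP => i; rewrite coef_coefwise !coefC; case: eqP.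
Qed.

Lemma coefwiseX : coefwise 'X = 0.
Proof.
have d1 : d 1 = 0.
  by apply: (addIr (d 1)); rewrite add0r -[X in X + d 1]mulr1 -[X in _ + X]mul1r -dM mulr1.
by apply/polyP => i; rewrite coef_coefwise coefX coef0; case: eqP.
Qed.

End CoefDerivation.

Section Slices.
Variables (n : nat) (K : comNzRingType).
Let A : comNzRingType := mpoly.mpoly n K.
Let phi : {rmorphism K -> A} := @mpoly.mpolyC n K.
Let zX : 'rV[A]_n := \row_j mX j.
Implicit Types (z w : 'rV[K]_n) (p q : mpoly.mpoly (n + n) K).

(** The polynomial p(z, t w) in t, with coefficients that are polynomials in z. *)
Definition slices w : mpoly.mpoly (n + n) K -> {poly A} :=
  mline phi (row_mx zX 0 0) (row_mx 0 (map_mx phi w) 0).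

(** The part of degree b in the second group of variables, at w. *)
Definition slice b w p : mpoly.mpoly n K := (slices w p)`_b.

Lemma slicesXl w j : slices w (mX (lshift n j)) = (mX j : A)%:P.
Proof. by rewrite [LHS]mlineX !row_mxEl !mxE polyC0 mul0r addr0. Qed.

Lemma slicesXr w j : slices w (mX (rshift n j)) = (phi (w 0 j))%:P * 'X.
Proof. by rewrite [LHS]mlineX !row_mxEr !mxE polyC0 add0r. Qed.

Lemma slicesC w c : slices w (mpoly.mpolyC _ c) = (phi c)%:P.
Proof. exact: mlineC. Qed.

Lemma slicesD w p q : slices w (p + q) = slices w p + slices w q.
Proof. exact: mlineD. Qed.

Lemma slicesM w p q : slices w (p * q) = slices w p * slices w q.
Proof. exact: mlineM. Qed.

Lemma meval_slice z b w p :
  mpoly.meval (z 0) (slice b w p) =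
    (mline idfun (row_mx z 0 0) (row_mx 0 w 0) p)`_b.
Proof.
suff -> : mline idfun (row_mx z 0 0) (row_mx 0 w 0) p =
    map_poly (mpoly.meval (z 0) : A -> K) (slices w p).
  by rewrite coef_map.
elim/mpoly_bi_ind: p => [c|j|j|p q IHp IHq|p q IHp IHq].
- by rewrite mlineC slicesC map_polyC /= mpoly.mevalC.
- rewrite mlineX slicesXl map_polyC /= mpoly.mevalXU.
  by rewrite !row_mxEl !mxE polyC0 mul0r addr0.
- rewrite mlineX slicesXr rmorphM /= map_polyC map_polyX /= mpoly.mevalC.
  by rewrite !row_mxEr !mxE polyC0 add0r.
- by rewrite mlineD slicesD rmorphD /= IHp IHq.
- by rewrite mlineM slicesM rmorphM /= IHp IHq.
Qed.

Lemma horner_slices z w p t :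
  (mline idfun (row_mx z 0 0) (row_mx 0 w 0) p).[t] = bieval z (t *: w) p.
Proof.
rewrite horner_mline_id; apply: mpoly.meval_eq => i.
by rewrite -(fintype.splitK i); case: (fintype.split i) => j /=;
  rewrite ?row_mxEl ?row_mxEr !mxE ?mulr0 ?addr0 ?add0r.
Qed.

Lemma mderiv_slice j b w p :
  mpoly.mderiv j (slice b w p) = slice b w (mpoly.mderiv (lshift n j) p).
Proof.
pose d : A -> A := mpoly.mderiv j.
have dD : {morph d : x y / x + y} by apply: mpoly.mderivD.
have dM x y : d (x * y) = d x * y + x * d y by apply: mpoly.mderivM.
have dC c : d (phi c) = 0 by apply: mpoly.mderivC.
have d0 : d 0 = 0 by apply: mpoly.mderiv0.
suff DS : coefwise d (slices w p) = slices w (mpoly.mderiv (lshift n j) p).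
  by rewrite /slice -DS coef_coefwise.
elim/mpoly_bi_ind: p => [c|i|i|p q IHp IHq|p q IHp IHq].
- rewrite slicesC coefwiseC // dC mpoly.mderivC -[X in slices w X]mpoly.mpolyC0.
  by rewrite slicesC rmorph0.
- rewrite slicesXl mderivXU (inj_eq (@lshift_inj _ _)) coefwiseC //.
  have -> : d (mX i) = phi (j == i)%:R.
    by rewrite /d mderivXU rmorph_nat.
  by rewrite -(slicesC w) rmorph_nat.
- rewrite slicesXr mderivXU eq_lrshift coefwiseM // coefwiseC // dC.
  rewrite polyC0 mul0r add0r coefwiseX // mulr0.
  by rewrite -[X in slices w X]mpoly.mpolyC0 slicesC rmorph0.
- rewrite slicesD (coefwiseD dD) mpoly.mderivD slicesD.
  by congr (_ + _); [exact: IHp|exact: IHq].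
- rewrite slicesM (coefwiseM dD dM) mpoly.mderivM slicesD !slicesM.
  by congr (_ * _ + _ * _); [exact: IHp|exact: IHq].
Qed.

Lemma sliceD b w p q : slice b w (p + q) = slice b w p + slice b w q.
Proof. by rewrite /slice slicesD coefD. Qed.

(* A polynomial with a single power of t, homogeneous of total degree a. *)
Let mono w p a := exists (g : A) l r, [/\ slices w p = g%:P * 'X^r,
  g \is @mpoly.ishomog1 n K l mpoly.mdeg & (l + r = a)%N].

Let monoM w p a q b : mono w p a -> mono w q b -> mono w (p * q) (a + b)%N.
Proof.
move=> [g [l [r [Eg hg <-]]]] [g' [l' [r' [Eg' hg' <-]]]].
exists (g * g'), (l + l')%N, (r + r')%N; split.
- by rewrite slicesM Eg Eg' rmorphM /= mulrACA -exprD.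
- exact: mpoly.dhomogM.
- by rewrite addnACA.
Qed.

Let mono1 w : mono w 1 0.
Proof.
exists 1, 0%N, 0%N; split=> //; last exact: mpoly.dhomog1.
by rewrite -mpoly.mpolyC1 slicesC rmorph1 mulr1.
Qed.

Let monoX w i : mono w (mX i) 1.
Proof.
rewrite -(fintype.splitK i); case: (fintype.split i) => j /=.
  exists (mX j), 1%N, 0%N; rewrite slicesXl expr0 mulr1; split=> //.
  by rewrite mpoly.dhomogX; apply/eqP; apply: mpoly.mdeg1.
exists (phi (w 0 j)), 0%N, 1%N; rewrite slicesXr expr1; split=> //.
have -> : phi (w 0 j) = w 0 j *: (1 : mpoly.mpoly n K).
  by rewrite -mpoly.mul_mpolyC mulr1.
by apply: mpoly.dhomogZ; apply: mpoly.dhomog1.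
Qed.

Let monoXm w m : mono w (mpoly.mpolyX K m) (mpoly.mdeg m).
Proof.
rewrite mpoly.mpolyXE_id mpoly.mdegE.
apply: (big_ind2 (mono w)) => [|f a g b|i _]; [exact: mono1|exact: monoM|].
elim: (m i) => [|k IH]; first by rewrite expr0; exact: mono1.
by rewrite exprS -add1n; apply: monoM.
Qed.

Lemma slice_homog d b w p : p \is @mpoly.ishomog1 _ K d mpoly.mdeg ->
  slice b w p \is @mpoly.ishomog1 n K (d - b) mpoly.mdeg /\
  ((d < b)%N -> slice b w p = 0).
Proof.
move=> /mpoly.dhomogP pd.
have h0 e : (0 : mpoly.mpoly n K) \is @mpoly.ishomog1 n K e mpoly.mdeg.
  exact: rpred0.
pose good p := slice b w p \is @mpoly.ishomog1 n K (d - b) mpoly.mdeg /\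
  ((d < b)%N -> slice b w p = 0).
have sumgood s (F : mpoly.multinom (n + n) -> mpoly.mpoly (n + n) K) :
    {in s, forall m, good (F m)} -> good (\sum_(m <- s) F m).
  elim: s => [|m s IH] sF.
    have s0 : slice b w 0 = 0.
      by rewrite /slice -mpoly.mpolyC0 slicesC rmorph0 coef0.
    by rewrite big_nil /good s0; split.
  have [h1 h2] := sF m (mem_head _ _).
  have [|h1' h2'] := IH; first by move=> m' m's; apply: sF; rewrite inE m's orbT.
  rewrite big_cons /good sliceD; split; first exact: mpoly.dhomogD.
  by move=> db; rewrite h2 // h2' // addr0.
rewrite -/(good p) [p]mpoly.mpolyE; apply: sumgood => m mp.
have [g [l [r [E hg lr]]]] := monoXm w m.
have Es : slice b w (mpoly.mcoeff m p *: mpoly.mpolyX K m) =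
    if b == r then mpoly.mcoeff m p *: g else 0.
  rewrite /slice -mpoly.mul_mpolyC slicesM slicesC E coefCM coefCM coefXn.
  by case: eqP => _; rewrite ?mulr1 ?mulr0 ?mpoly.mul_mpolyC.
have dE : (l + r = d)%N by rewrite lr; apply: (pd m mp).
rewrite /good Es; case: eqVneq => [->|_]; last first.
  by split=> // _.
split; last by rewrite -dE ltnNge leq_addl.
by rewrite -dE addnK; apply: mpoly.dhomogZ.
Qed.

End Slices.

(** * Hermitian polynomials with parallel slices *)

Lemma horner_ext (K : numDomainType) (u v : {poly K}) :
  (forall t, u.[t] = v.[t]) -> u = v.
Proof.
move=> E; apply/eqP; rewrite -subr_eq0; apply/eqP.
by apply: (poly_inj_eq0 (@natr_inj K)) => k; rewrite hornerD hornerN E subrr.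
Qed.

(** Equal products in separate variables have equal products of coefficients. *)
Lemma coef_tensor_eq (K : numDomainType) (u1 v1 u2 v2 : {poly K}) :
  (forall t t', u1.[t] * v1.[t'] = u2.[t] * v2.[t']) ->
  forall b b', u1`_b * v1`_b' = u2`_b * v2`_b'.
Proof.
move=> E b b'.
have Eb t' : u1`_b * v1.[t'] = u2`_b * v2.[t'].
  rewrite -!coefMC; congr ((_ : {poly K})`_b); apply: horner_ext => t.
  by rewrite !hornerM !hornerC.
rewrite -!coefCM; congr ((_ : {poly K})`_b'); apply: horner_ext => t'.
by rewrite !hornerM !hornerC.
Qed.

Section NoPluriharmonicTerms.
Variables (n : nat) (K : comNzRingType).
Implicit Types (z w : 'rV[K]_n) (p : mpoly.mpoly (n + n) K).

Lemma bieval_r0 z p :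
  (forall m, mpoly.mcoeff m p != 0 -> (0 < \sum_(i < n) m (rshift n i))%N) ->
  bieval z 0 p = 0.
Proof.
move=> H; rewrite /bieval mpoly.mevalE big1_seq // => m /andP[_ mp].
have := H m; rewrite -mpoly.mcoeff_msupp mp => /(_ isT).
rewrite lt0n sum_nat_eq0 negb_forall => /existsP[i /= mi].
rewrite big_split_ord /= [X in _ * (_ * X)](bigD1 i) //= row_mxEr mxE.
by rewrite expr0n (negbTE mi) mul0r !mulr0.
Qed.

Lemma bieval_l0 w p :
  (forall m, mpoly.mcoeff m p != 0 -> (0 < \sum_(i < n) m (lshift n i))%N) ->
  bieval 0 w p = 0.
Proof.
move=> H; rewrite /bieval mpoly.mevalE big1_seq // => m /andP[_ mp].
have := H m; rewrite -mpoly.mcoeff_msupp mp => /(_ isT).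
rewrite lt0n sum_nat_eq0 negb_forall => /existsP[i /= mi].
rewrite big_split_ord /= [X in _ * (X * _)](bigD1 i) //= row_mxEl mxE.
by rewrite expr0n (negbTE mi) !mul0r mulr0.
Qed.

Lemma bieval_mderiv_r0 z p j :
  (forall m, mpoly.mcoeff m p != 0 -> (0 < \sum_(i < n) m (rshift n i))%N) ->
  bieval z 0 (mpoly.mderiv (lshift n j) p) = 0.
Proof.
move=> H; apply: bieval_r0 => m; rewrite mpoly.mcoeff_mderiv => m0.
have := H (mpoly.mnm_add m (mpoly.mnm1 (lshift n j))).
have -> : (\sum_(i < n) mpoly.mnm_add m (mpoly.mnm1 (lshift n j)) (rshift n i)
   = \sum_(i < n) m (rshift n i))%N.
  by apply: eq_bigr => i _; rewrite mpoly.mnmDE mpoly.mnm1E eq_lrshift addn0.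
by apply; apply: contraNneq m0 => ->; rewrite mul0rn.
Qed.

End NoPluriharmonicTerms.

Section Structure.
Variables (n : nat) (K : numFieldType) (conj : {rmorphism K -> K}).
Variables (p : mpoly.mpoly (n + n) K) (d : nat).
Implicit Types (z w : 'rV[K]_n).
Local Notation homog d := (@mpoly.ishomog1 n K d mpoly.mdeg).

Hypothesis p_homog : p \is @mpoly.ishomog1 (n + n) K d mpoly.mdeg.
Hypothesis p_noharm : forall m, mpoly.mcoeff m p != 0 ->
  (0 < \sum_(i < n) m (lshift n i))%N /\ (0 < \sum_(i < n) m (rshift n i))%N.
Hypothesis p_herm : forall z w,
  bieval z (map_mx conj w) p = conj (bieval w (map_mx conj z) p).
Hypothesis p_par : forall z w w' i j,
  bieval z w (mpoly.mderiv (lshift n i) p) * bieval z w' (mpoly.mderiv (lshift n j) p)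
  = bieval z w (mpoly.mderiv (lshift n j) p) * bieval z w' (mpoly.mderiv (lshift n i) p).

Let coefs z w q := mline idfun (row_mx z 0 0) (row_mx 0 w 0) q : {poly K}.

Let slice_par b b' w w' i j :
  mpoly.mderiv i (slice b w p) * mpoly.mderiv j (slice b' w' p) =
  mpoly.mderiv j (slice b w p) * mpoly.mderiv i (slice b' w' p).
Proof.
apply/eqP; rewrite -subr_eq0; apply/eqP/mpoly_eval_eq0 => x.
pose z : 'rV[K]_n := \row_i x i.
have zE f : mpoly.meval x f = mpoly.meval (z 0) f.
  by apply: mpoly.meval_eq => k; rewrite mxE.
have ms c u k : mpoly.meval (z 0) (mpoly.mderiv k (slice c u p)) =
    (coefs z u (mpoly.mderiv (lshift n k) p))`_c.
  by rewrite mderiv_slice meval_slice.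
rewrite zE mpoly.mevalB (mpoly.mevalM (z 0) (mpoly.mderiv i (slice b w p))).
rewrite (mpoly.mevalM (z 0) (mpoly.mderiv j (slice b w p))) !ms.
apply/eqP; rewrite subr_eq0; apply/eqP; apply: coef_tensor_eq => t t'.
by rewrite !horner_slices p_par.
Qed.

Let bieval_slices z w t :
  bieval z (t *: w) p = \sum_(b < d.+1) mpoly.meval (z 0) (slice b w p) * t ^+ b.
Proof.
rewrite -horner_slices horner_coef.
set u := mline _ _ _ _.
have uE b : mpoly.meval (z 0) (slice b w p) = u`_b by rewrite meval_slice.
have u0 b : (d < b)%N -> u`_b = 0.
  by move=> db; rewrite -uE (slice_homog b w p_homog).2 // mpoly.meval0.
have su : (size u <= d.+1)%N by apply/leq_sizeP => j /u0.
rewrite (big_ord_widen _ (fun i => u`_i * t ^+ i) su) big_mkcond /=.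
apply: eq_bigr => i _; rewrite uE; case: ltnP => // /(nth_default 0) ->.
by rewrite mul0r.
Qed.

Let bieval_slices1 z w :
  bieval z w p = \sum_(b < d.+1) mpoly.meval (z 0) (slice b w p).
Proof.
rewrite -[in LHS](scale1r w) bieval_slices; apply: eq_bigr => b _.
by rewrite expr1n mulr1.
Qed.

Let slice_scale b z w t : mpoly.meval ((t *: z) 0) (slice b w p) =
  t ^+ (d - b) * mpoly.meval (z 0) (slice b w p).
Proof.
have /mpoly.dhomogP h := (slice_homog b w p_homog).1.
rewrite !mpoly.mevalE mulr_sumr; apply: eq_big_seq => m mf.
rewrite mulrCA; congr (_ * _).
rewrite -(h m mf) -[X in t ^+ X]/(mpoly.mdeg m) mpoly.mdegE -prodrXr -big_split.
by apply: eq_bigr => i _; rewrite mxE exprMn.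
Qed.

Let slice_herm b z w : (b <= d)%N ->
  mpoly.meval (z 0) (slice b (map_mx conj w) p) =
  conj (mpoly.meval (w 0) (slice (d - b) (map_mx conj z) p)).
Proof.
move=> bd.
pose u := \poly_(b < d.+1) mpoly.meval (z 0) (slice b (map_mx conj w) p).
pose v := \poly_(b < d.+1)
  conj (mpoly.meval (w 0) (slice (d - b) (map_mx conj z) p)).
suff E : u = v.
  by have := congr1 (fun q : {poly K} => q`_b) E; rewrite !coef_poly ltnS bd.
apply/eqP; rewrite -subr_eq0; apply/eqP/(poly_inj_eq0 (@natr_inj K)) => k.
apply/eqP; rewrite hornerD hornerN subr_eq0; apply/eqP; rewrite !horner_poly.
have kmx : k%:R *: map_mx conj w = map_mx conj (k%:R *: w).
  by apply/matrixP => i j; rewrite !mxE rmorphM rmorph_nat.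
rewrite -bieval_slices kmx p_herm bieval_slices1.
rewrite rmorph_sum /= (reindex_inj rev_ord_inj) /=; apply: eq_bigr => i _.
have id : (i <= d)%N by rewrite -ltnS.
rewrite subSS slice_scale rmorphM rmorphXn rmorph_nat (subKn id).
exact: mulrC.
Qed.

Let slice0 w : slice 0 w p = 0.
Proof.
apply: mpoly_eval_eq0 => x; pose z : 'rV[K]_n := \row_i x i.
have -> : mpoly.meval x (slice 0 w p) = mpoly.meval (z 0) (slice 0 w p).
  by apply: mpoly.meval_eq => k; rewrite mxE.
rewrite meval_slice -horner_coef0 horner_slices scale0r.
by apply: bieval_r0 => m /p_noharm[].
Qed.

Let slice_d w : slice d w p = 0.
Proof.
have [] := slice_homog d w p_homog; rewrite subnn => /homog0_const[c E] _.
have cf0 : coefs 0 w p = 0.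
  apply: horner_ext => t; rewrite [LHS]horner_slices horner0.
  by apply: bieval_l0 => m /p_noharm[].
have : mpoly.meval ((0 : 'rV[K]_n) 0) (slice d w p) = 0.
  by rewrite meval_slice -/(coefs 0 w p) cf0 coef0.
by rewrite E mpoly.mevalC => ->; rewrite mpoly.mpolyC0.
Qed.

(** A Hermitian homogeneous polynomial whose slices have parallel gradients is
    a polynomial in one homogeneous holomorphic polynomial and its conjugate. *)
Lemma hermitian_structure : p != 0 ->
  exists h e (c : 'I_d.+1 -> K) (k l : 'I_d.+1 -> nat),
  [/\ (0 < e)%N, h \is homog e, h != 0,
    forall b, c b != 0 -> [/\ (0 < k b)%N, (0 < l b)%N & ((k b + l b) * e = d)%N] &
    forall z, bieval z (map_mx conj z) p =
      \sum_b c b * mpoly.meval (z 0) h ^+ k b * conj (mpoly.meval (z 0) h) ^+ l b].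
Proof.
move=> p0.
(* A representative of the slices of each degree, nonzero whenever possible. *)
pose P b f := (exists w, f = slice b w p) /\ (f != 0 \/ forall w, slice b w p = 0).
have /choice[g gP] : forall b : nat, exists f, P b f.
  move=> b; have [[w wb]|nw] := pselect (exists w, slice b w p != 0).
    by exists (slice b w p); split; [exists w|left].
  exists (slice b 0 p); split; first by exists 0.
  by right=> w; apply/eqP/negPn/negP => wb; apply: nw; exists w.
pose s := [seq g b | b <- iota 0 d.+1 & g b != 0].
have sP f : f \in s -> exists b, [/\ (0 < b < d)%N, f = g b & g b != 0].
  move=> /mapP[b]; rewrite mem_filter mem_iota /= add0n ltnS => /andP[gb bd] ->.
  exists b; split=> //; have [[w Ew] _] := gP b.
  rewrite lt0n ltn_neqAle bd andbT; apply/andP; split.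
    by apply: contraNneq gb => b0; rewrite Ew b0 slice0.
  by apply: contraNneq gb => b0; rewrite Ew b0 slice_d.
have gh b : g b \is homog (d - b).
  by have [[w ->] _] := gP b; have [] := slice_homog b w p_homog.
have gpar b b' i j : mpoly.mderiv i (g b) * mpoly.mderiv j (g b') =
    mpoly.mderiv j (g b) * mpoly.mderiv i (g b').
  by have [[w ->] _] := gP b; have [[w' ->] _] := gP b'; apply: slice_par.
have gs b : (b <= d)%N -> g b != 0 -> g b \in s.
  by move=> bd gb; apply: map_f; rewrite mem_filter gb mem_iota add0n ltnS.
have s0 : s != [::].
  apply: contraNneq p0 => s0; apply/eqP/mpoly_eval_eq0 => x.
  pose z : 'rV[K]_n := \row_i x (lshift n i).
  pose w : 'rV[K]_n := \row_i x (rshift n i).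
  have -> : mpoly.meval x p = bieval z w p.
    apply: mpoly.meval_eq => i.
    by rewrite -(fintype.splitK i); case: (fintype.split i) => j /=; rewrite ?row_mxEl ?row_mxEr mxE.
  rewrite bieval_slices1 big1 // => b _.
  have [_ [gb|->]] := gP b; last by rewrite mpoly.meval0.
  by have := gs b; rewrite s0 -ltnS => /(_ (ltn_ord b) gb).
have [h [e [e0 he hs]]] : exists h e, [/\ (0 < e)%N, h \is homog e &
    forall f, f \in s -> exists c k, f = c *: h ^+ k].
  apply: common_root => //.
    move=> f /sP[b [/andP[b0 bd] -> gb]]; split=> //.
    by exists (d - b)%N => //; rewrite subn_gt0.
  by move=> f f' /sP[b [_ -> _]] /sP[b' [_ -> _]] i j.
(* each nonzero slice is a constant times a power of h, of the right degree *)
have gpow b : (b <= d)%N -> g b != 0 -> exists c k,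
    [/\ (0 < k)%N, (k * e = d - b)%N, g b = c *: h ^+ k, h != 0 & c != 0].
  move=> bd gb; have [c [k E]] := hs _ (gs b bd gb).
  have [b' [/andP[b'0 b'd] _ _]] := sP _ (gs b bd gb).
  have c0 : c != 0 by apply: contraNneq gb => c0; rewrite E c0 scale0r.
  have hk0 : h ^+ k != 0 by apply: contraNneq gb => hk0; rewrite E hk0 scaler0.
  have bd' : (b < d)%N.
    rewrite ltn_neqAle bd andbT; apply: contraNneq gb => bdE.
    by have [[w ->] _] := gP b; rewrite bdE slice_d.
  have ke : (k * e = d - b)%N.
    apply: (mpoly.dhomog_uniq (mf := mpoly.mdeg) hk0).
      by rewrite mulnC; apply: (@mpoly.dhomogMn _ _ mpoly.mdeg).
    have -> : h ^+ k = c^-1 *: g b by rewrite E scalerA mulVf // scale1r.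
    exact: mpoly.dhomogZ.
  have k0 : (0 < k)%N.
    by rewrite lt0n; apply: contraTneq bd' => k0; rewrite -subn_gt0 -ke k0 mul0n.
  exists c, k; split=> //.
  by apply: contraNneq hk0 => ->; rewrite expr0n eqn0Ngt k0.
(* the slices of one degree are multiples of the chosen one *)
have gprop b w : (b <= d)%N -> g b != 0 -> exists a, slice b w p = a *: g b.
  move=> bd gb; have [c1 [k1 [k10 k1e _ _ _]]] := gpow b bd gb.
  have bd' : (0 < d - b)%N by rewrite -k1e muln_gt0 k10.
  have [[w' Ew'] _] := gP b.
  have sw : slice b w p \is homog (d - b) by have [] := slice_homog b w p_homog.
  have [->|sw0] := eqVneq (slice b w p) 0; first by exists 0; rewrite scale0r.
  have par i j : mpoly.mderiv i (g b) * mpoly.mderiv j (slice b w p) =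
      mpoly.mderiv j (g b) * mpoly.mderiv i (slice b w p).
    by rewrite Ew'; apply: slice_par.
  have [c E] := parallel_gradient_powers (gh b) gb sw bd' bd' par.
  exact: homog_exp_proportional bd' (gh b) gb sw E.
(* Hermitian symmetry shows that the slice of degree b at conj z depends on z
   through a power of conj (h z). *)
have main (b : 'I_d.+1) : exists ckl : K * nat * nat,
    (ckl.1.1 != 0 -> [/\ (0 < ckl.1.2)%N, (0 < ckl.2)%N & ((ckl.1.2 + ckl.2) * e = d)%N]) /\
    forall z, mpoly.meval (z 0) (slice b (map_mx conj z) p) =
      ckl.1.1 * mpoly.meval (z 0) h ^+ ckl.1.2 * conj (mpoly.meval (z 0) h) ^+ ckl.2.
  have bd : (b <= d)%N by rewrite -ltnS.
  have zero : (forall z, mpoly.meval (z 0) (slice b (map_mx conj z) p) = 0) ->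
      exists ckl : K * nat * nat, (ckl.1.1 != 0 ->
        [/\ (0 < ckl.1.2)%N, (0 < ckl.2)%N & ((ckl.1.2 + ckl.2) * e = d)%N]) /\
      forall z, mpoly.meval (z 0) (slice b (map_mx conj z) p) = ckl.1.1 *
        mpoly.meval (z 0) h ^+ ckl.1.2 * conj (mpoly.meval (z 0) h) ^+ ckl.2.
    move=> z0; exists (0 : K, 0%N, 0%N); split=> [|z]; first by rewrite eqxx.
    by rewrite z0 !mul0r.
  have [_ [gb|gb]] := gP b; last by apply: zero => z; rewrite gb mpoly.meval0.
  have [_ [gdb|gdb]] := gP (d - b)%N; last first.
    by apply: zero => z; rewrite slice_herm // gdb mpoly.meval0 rmorph0.
  have [y gy] := mpoly_neq0P gb; pose zb : 'rV[K]_n := \row_i y i.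
  have {}gy : mpoly.meval (zb 0) (g b) != 0.
    by rewrite -(mpoly.meval_eq (v1 := y)) // => i; rewrite mxE.
  have [c1 [k1 [k10 k1e E1 _ _]]] := gpow b bd gb.
  have [c2 [k2 [k20 k2e E2 _ _]]] := gpow (d - b)%N (leq_subr _ _) gdb.
  have [a' Ea'] := gprop (d - b)%N (map_mx conj zb) (leq_subr _ _) gdb.
  exists (c1 * conj (a' * c2) / mpoly.meval (zb 0) (g b), k1, k2); split=> /= [_|z].
    by split=> //; rewrite mulnDl k1e k2e subKn // subnK.
  have [a Ea] := gprop b (map_mx conj z) bd gb.
  have aE : a = conj (a' * c2) * conj (mpoly.meval (z 0) h) ^+ k2 /
      mpoly.meval (zb 0) (g b).
    apply: (mulIf gy); rewrite divfK // -mpoly.mevalZ -Ea slice_herm // Ea'.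
    by rewrite E2 !mpoly.mevalZ [mpoly.meval _ (h ^+ _)]rmorphXn mulrA !rmorphM rmorphXn.
  have gz : mpoly.meval (z 0) (g b) = c1 * mpoly.meval (z 0) h ^+ k1.
    by rewrite E1 mpoly.mevalZ [mpoly.meval _ (h ^+ _)]rmorphXn.
  rewrite Ea mpoly.mevalZ aE gz.
  ring.
have {main}/choice[t tP] := main.
have [f fs] : exists f, f \in s by case: (s) s0 => // f s' _; exists f; apply: mem_head.
have [b [/andP[b0 bd] _ gb]] := sP f fs.
have [_ [_ [_ _ _ h0 _]]] := gpow b (ltnW bd) gb.
exists h, e, (fun b => (t b).1.1), (fun b => (t b).1.2), (fun b => (t b).2).
split=> // [b' | z]; first by have [] := tP b'.
by rewrite bieval_slices1; apply: eq_bigr => b' _; have [_ ->] := tP b'.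
Qed.

End Structure.

(** * Expansions in two groups of variables *)

(** A polynomial in the second group of variables vanishes as soon as all its
    iterated derivatives vanish at one point. *)
Lemma bieval_taylor_eq0 (n : nat) (K : numDomainType)
    (C : mpoly.mpoly (n + n) K -> Prop) (z w0 : 'rV[K]_n) :
  (forall f j, C f -> C (mpoly.mderiv (rshift n j) f)) ->
  (forall f, C f -> bieval z w0 f = 0) ->
  forall f, C f -> forall w, bieval z w f = 0.
Proof.
move=> CD C0 f Cf w.
pose u (g : mpoly.mpoly (n + n) K) : {poly K} :=
  mline idfun (row_mx z w0 0) (row_mx 0 (w - w0) 0) g.
have uE g t : (u g).[t] = bieval z (w0 + t *: (w - w0)) g.
  rewrite horner_mline_id; apply: mpoly.meval_eq => i.
  by rewrite -(fintype.splitK i); case: (fintype.split i) => j /=;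
    rewrite ?row_mxEl ?row_mxEr !mxE ?mulr0 ?addr0.
have u0 g : C g -> (u g)`_0 = 0.
  by move=> Cg; rewrite -horner_coef0 uE scale0r addr0 C0.
have uk k : forall g, C g -> (u g)`_k = 0.
  elim: k => [|k IH] g Cg; first exact: u0.
  have := congr1 (fun q : {poly K} => q`_k)
    (deriv_mline idfun (row_mx z w0 0) (row_mx 0 (w - w0) 0) g).
  rewrite coef_deriv [X in _ = X]coef_sum [X in _ = X]big1 => [/eqP|i _].
    by rewrite mulrn_eq0 /= => /eqP.
  rewrite coefZ -(fintype.splitK i); case: (fintype.split i) => j /=.
    by rewrite row_mxEl mxE mul0r.
  by rewrite [_`_k](IH _ (CD _ j Cg)) mulr0.
have -> : bieval z w f = (u f).[1] by rewrite uE scale1r addrC subrK.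
suff -> : u f = 0 by rewrite horner0.
by apply/polyP => k; rewrite coef0 uk.
Qed.

(** A polynomial whose derivatives in the second group vanish is constant in it. *)
Lemma bieval_const_right (n : nat) (K : numDomainType)
    (z : 'rV[K]_n) (f : mpoly.mpoly (n + n) K) :
  (forall j w, bieval z w (mpoly.mderiv (rshift n j) f) = 0) ->
  forall w, bieval z w f = bieval z 0 f.
Proof.
move=> H w.
pose g : mpoly.mpoly (n + n) K := f - mpoly.mpolyC _ (bieval z 0 f).
suff : bieval z w g = 0.
  by rewrite bievalB bievalC => /eqP; rewrite subr_eq0 => /eqP.
pose C h := h = g \/ forall w, bieval z w h = 0.
apply: (@bieval_taylor_eq0 _ _ C z 0) => [h j|h|]; last by left.
- case=> [->|h0]; right=> w'.
    by rewrite /g mpoly.mderivB mpoly.mderivC subr0.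
  pose v : 'rV[K]_(n + n) := row_mx 0 (delta_mx 0 j).
  pose L q : {poly K} := mline idfun (row_mx z w' 0) (v 0) q.
  have L0 : L h = 0.
    apply: horner_ext => t; rewrite [LHS]horner_mline_id horner0.
    rewrite -[RHS](h0 (w' + t *: delta_mx 0 j)); apply: mpoly.meval_eq => i.
    by rewrite -(fintype.splitK i); case: (fintype.split i) => k /=;
      rewrite ?row_mxEl ?row_mxEr !mxE ?mulr0 ?addr0.
  have dL : (L h)^`() = \sum_(i < n + n) v 0 i *:
      L (mpoly.mderiv i h) by apply: deriv_mline.
  move: dL; rewrite L0 deriv0 => /(congr1 (fun q : {poly K} => q.[0])).
  rewrite horner0 horner_sum (bigD1 (rshift n j)) //= big1 ?addr0 => [|i].
    by rewrite hornerZ row_mxEr mxE !eqxx mul1r [(L _).[_]]horner_mline_id0 => /esym.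
  rewrite -(fintype.splitK i) hornerZ; case: (fintype.split i) => k /=.
    by rewrite row_mxEl mxE mul0r.
  by rewrite (inj_eq (@rshift_inj _ _)) row_mxEr mxE eqxx => /negbTE ->; rewrite mul0r.
- by case=> [->|//]; rewrite bievalB bievalC subrr.
Qed.

(** Identity theorem for polynomials. *)
Lemma mpoly_identity (n : nat) (K : numFieldType) (f : mpoly.mpoly n K)
    (z0 : 'rV[K]_n) :
  (forall v : 'rV[K]_n, exists u : nat -> K, injective u /\
     forall k, mpoly.meval ((z0 + u k *: v) 0) f = 0) -> f = 0.
Proof.
move=> H; apply: mpoly_eval_eq0 => x.
pose v : 'rV[K]_n := \row_i x i - z0; have [u [u_inj u0]] := H v.
have E t : (mline idfun (z0 0) (v 0) f).[t] = mpoly.meval ((z0 + t *: v) 0) f.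
  by rewrite horner_mline_id; apply: mpoly.meval_eq => i; rewrite !mxE.
have L0 : mline idfun (z0 0) (v 0) f = 0.
  by apply: (poly_inj_eq0 u_inj) => k; rewrite E.
have := E 1; rewrite L0 horner0 => ->; apply: mpoly.meval_eq => i.
by rewrite !mxE mul1r addrC subrK.
Qed.

(** Expansion of a polynomial along a pair of polynomial curves. *)
Section BivariateExpansion.
Variables (n : nat) (K : comNzRingType) (al be : 'I_n -> {poly K}).
Implicit Types p : mpoly.mpoly (n + n) K.

Let A : comNzRingType := {poly {poly K}}.
Let cst : {rmorphism K -> A} := @polyC {poly K} \o @polyC K.
(* Substitution of the curve al(s) in the first group and be(t) in the second,
   as a polynomial in t over the polynomials in s. *)
Let h (i : 'I_(n + n)) : A :=
  match fintype.split i with inl j => (al j)%:P | inr j => map_poly polyC (be j) end.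
Let B p : A := mpoly.mmap cst h p.

Let hl j : h (lshift n j) = (al j)%:P.
Proof. by rewrite /h -[lshift n j]/(fintype.unsplit (inl j)) fintype.unsplitK. Qed.

Let hr j : h (rshift n j) = map_poly polyC (be j).
Proof. by rewrite /h -[rshift n j]/(fintype.unsplit (inr j)) fintype.unsplitK. Qed.

Let BE p s t : (B p).[t%:P].[s] =
  bieval (\row_j (al j).[s]) (\row_j (be j).[t]) p.
Proof.
elim/mpoly_bi_ind: p => [c|j|j|p q IHp IHq|p q IHp IHq].
- by rewrite [B _]mpoly.mmapC bievalC /= !hornerC.
- by rewrite [B _]mpoly.mmapX mpoly.mmap1U hl bievalXl mxE hornerC.
- by rewrite [B _]mpoly.mmapX mpoly.mmap1U hr bievalXr mxE horner_map hornerC.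
- by rewrite [B _]rmorphD bievalD !hornerD; congr (_ + _).
- by rewrite [B _]rmorphM bievalM !hornerM; congr (_ * _).
Qed.

Let a0 : 'rV[K]_n := \row_j (al j)`_0.
Let b0 : 'rV[K]_n := \row_j (be j)`_0.

Let B00 p : (B p)`_0`_0 = bieval a0 b0 p.
Proof.
rewrite -!horner_coef0 -polyC0 BE; congr bieval;
by apply/rowP => j; rewrite !mxE horner_coef0.
Qed.

Let dX (u : A) : A := coefwise (@deriv K) u.
Let dY (u : A) : A := deriv u.

Let dXC c : dX (cst c) = 0.
Proof. by rewrite /dX coefwiseC ?derivC // => x y; rewrite derivD. Qed.

Let dX_B p : dX (B p) =
  \sum_(j < n) B (mpoly.mderiv (lshift n j) p) * (((al j)^`())%:P : A).
Proof.
rewrite [LHS](@mpoly_chain_rule _ _ _ cst h dX).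
- rewrite big_split_ord /= [X in _ + X]big1 ?addr0 => [|j _].
    apply: eq_bigr => j _; rewrite hl /dX coefwiseC //; exact: derivD.
  rewrite hr; apply/eqP; rewrite [dX _](_ : _ = 0) ?mulr0 //.
  apply/polyP => k; rewrite coef_coefwise ?coef0; last exact: derivD.
  by rewrite coef_map derivC.
- by apply: coefwiseD; exact: derivD.
- by apply: coefwiseM; [exact: derivD|exact: derivM].
- exact: dXC.
Qed.

Let dY_B p : dY (B p) =
  \sum_(j < n) B (mpoly.mderiv (rshift n j) p) * (map_poly polyC (be j)^`() : A).
Proof.
rewrite [LHS](@mpoly_chain_rule _ _ _ cst h dY).
- rewrite big_split_ord /= [X in X + _]big1 ?add0r => [|j _].
    by apply: eq_bigr => j _; rewrite hr /dY deriv_map.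
  by rewrite hl /dY derivC mulr0.
- exact: derivD.
- exact: derivM.
- by move=> c; apply: derivC.
Qed.

Lemma bieval_expansion p : exists (N : nat) (k : nat -> nat -> K),
  [/\ forall s t, bieval (\row_j (al j).[s]) (\row_j (be j).[t]) p =
        \sum_(i < N.+2) \sum_(j < N.+2) k i j * s ^+ i * t ^+ j,
      k 0%N 0%N = bieval a0 b0 p,
      k 1%N 0%N = \sum_(j < n) (al j)`_1 * bieval a0 b0 (mpoly.mderiv (lshift n j) p),
      k 0%N 1%N = \sum_(j < n) (be j)`_1 * bieval a0 b0 (mpoly.mderiv (rshift n j) p) &
      k 1%N 1%N = \sum_(j < n) \sum_(l < n) (al j)`_1 * (be l)`_1 *
        bieval a0 b0 (mpoly.mderiv (rshift n l) (mpoly.mderiv (lshift n j) p))].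
Proof.
pose N := (size (B p) + \max_(j < size (B p)) size ((B p)`_j)%R)%N.
exists N, (fun i j => (B p)`_j`_i); split.
- move=> s t; rewrite -BE.
  rewrite (@horner_coef_wide _ N.+2 (B p)); last first.
    by apply: leq_trans (leq_addr _ _) (leq_addl 2 _).
  rewrite horner_sum exchange_big.
  apply: eq_bigr => j _ /=.
  rewrite hornerM horner_exp hornerC -mulr_suml; congr (_ * _).
  apply: horner_coef_wide; case: (ltnP j (size (B p))) => [jB|]; last first.
    by move=> /(nth_default 0) ->; rewrite size_poly0.
  apply: leq_trans (leq_trans (leq_addl _ _) (leq_addl 2 _)).
  exact: (leq_bigmax (F := fun j : 'I_(size (B p)) => size ((B p)`_j)%R) (Ordinal jB)).
- exact: B00.
- transitivity ((dX (B p))`_0`_0).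
    by rewrite coef_coefwise ?coef_deriv //; exact: derivD.
  rewrite dX_B !coef_sum; apply: eq_bigr => j _.
  by rewrite coefMC coef0M B00 coef_deriv mulr1n mulrC.
- transitivity ((dY (B p))`_0`_0); first by rewrite coef_deriv mulr1n.
  rewrite dY_B !coef_sum; apply: eq_bigr => j _.
  by rewrite !coef0M B00 coef_map coefC /= coef_deriv mulr1n mulrC.
- transitivity ((dY (dX (B p)))`_0`_0).
    by rewrite coef_deriv mulr1n coef_coefwise ?coef_deriv //; exact: derivD.
  rewrite dX_B /dY (big_morph _ (@derivD {poly K}) (@deriv0 {poly K})) !coef_sum.
  apply: eq_bigr => j _; rewrite derivM derivC mulr0 addr0 coefMC coef0M.
  rewrite -/(dY _) dY_B !coef_sum mulr_suml; apply: eq_bigr => l _.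
  rewrite !coef0M B00 coef_map coefC /= !coef_deriv !mulr1n.
  by rewrite -mulrA mulrC [X in X * _]mulrC.
Qed.

End BivariateExpansion.

(** * Hermitian symmetry of real-valued polynomials *)

Section HermitianSymmetry.
Variables (R : rcfType) (n : nat).
Implicit Types (p q : mpoly.mpoly (n + n) R[i]) (z w : 'rV[R[i]]_n).

Let I : R[i] := 0 +i* 1.

(** The points (z, conj z) form a totally real subspace, on which only the
    zero polynomial vanishes. *)
Lemma bieval_conj_eq0 q :
  (forall z, bieval z (map_mx (@conjc R) z) q = 0) -> q = 0.
Proof.
move=> q0.
pose h (k : 'I_(n + n)) : mpoly.mpoly (n + n) R[i] :=
  match fintype.split k with
  | inl j => mX (lshift n j) + I *: mX (rshift n j)
  | inr j => mX (lshift n j) - I *: mX (rshift n j)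
  end.
pose q' := mpoly.mmap (@mpoly.mpolyC (n + n) R[i]) h q.
have q'E x : mpoly.meval x q' =
    bieval (\row_j (x (lshift n j) + I * x (rshift n j)))
           (\row_j (x (lshift n j) - I * x (rshift n j))) q.
  rewrite /q'; elim/mpoly_bi_ind: (q) => [c|j|j|p r IHp IHr|p r IHp IHr].
  - by rewrite mpoly.mmapC mpoly.mevalC bievalC.
  - rewrite mpoly.mmapX mpoly.mmap1U bievalXl mxE /h.
    rewrite -[lshift n j]/(fintype.unsplit (inl j)) fintype.unsplitK /=.
    by rewrite mpoly.mevalD mpoly.mevalZ !mpoly.mevalXU.
  - rewrite mpoly.mmapX mpoly.mmap1U bievalXr mxE /h.
    rewrite -[rshift n j]/(fintype.unsplit (inr j)) fintype.unsplitK /=.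
    by rewrite mpoly.mevalB mpoly.mevalZ !mpoly.mevalXU.
  - by rewrite rmorphD mpoly.mevalD bievalD; congr (_ + _).
  - by rewrite rmorphM mpoly.mevalM bievalM; congr (_ * _).
have q'0 : q' = 0.
  apply: mpoly_nat_eq0 => x; rewrite q'E.
  have cI : conjc I = - I by apply/eqP; rewrite eq_complex /= oppr0 !eqxx.
  pose z := \row_j ((x (lshift n j))%:R + I * (x (rshift n j))%:R).
  have -> : \row_j ((x (lshift n j))%:R - I * (x (rshift n j))%:R) =
      map_mx (@conjc R) z.
    have cD (a b : R[i]) : conjc (a + b) = conjc a + conjc b by exact: rmorphD.
    have cM (a b : R[i]) : conjc (a * b) = conjc a * conjc b by exact: rmorphM.
    by apply/rowP => j; rewrite !mxE cD cM !conjc_nat cI mulNr.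
  exact: q0.
apply: mpoly_eval_eq0 => y.
pose u := \row_j y (lshift n j); pose v := \row_j y (rshift n j).
have -> : mpoly.meval y q = bieval u v q.
  apply: mpoly.meval_eq => k.
  by rewrite -(fintype.splitK k); case: (fintype.split k) => j /=; rewrite ?row_mxEl ?row_mxEr mxE.
pose x (k : 'I_(n + n)) : R[i] := match fintype.split k with
  | inl j => (u 0 j + v 0 j) / 2%:R | inr j => (u 0 j - v 0 j) / (I * 2%:R) end.
have xl j : x (lshift n j) = (u 0 j + v 0 j) / 2%:R.
  by rewrite /x -[lshift n j]/(fintype.unsplit (inl j)) fintype.unsplitK.
have I0 : I != 0 by rewrite eq_complex /= oner_eq0 andbF.
have xr j : I * x (rshift n j) = (u 0 j - v 0 j) / 2%:R.
  rewrite /x -[rshift n j]/(fintype.unsplit (inr j)) fintype.unsplitK invfM mulrCA !mulrA.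
  by congr (_ / _); rewrite -mulrA divff ?mulr1.
have t0 : (2%:R : R[i]) != 0 by rewrite pnatr_eq0.
have uE : u = \row_j (x (lshift n j) + I * x (rshift n j)).
  by apply/rowP => j; rewrite [RHS]mxE xl xr; field.
have vE : v = \row_j (x (lshift n j) - I * x (rshift n j)).
  by apply/rowP => j; rewrite [RHS]mxE xl xr; field.
by rewrite uE vE -q'E q'0 mpoly.meval0.
Qed.

(** A polynomial with real values at the points (z, conj z) is Hermitian. *)
Lemma bieval_hermitian p :
  (forall z, conjc (bieval z (map_mx (@conjc R) z) p) =
             bieval z (map_mx (@conjc R) z) p) ->
  forall z w, bieval z (map_mx (@conjc R) w) p =
              conjc (bieval w (map_mx (@conjc R) z) p).
Proof.
move=> pR.
pose h (k : 'I_(n + n)) : mpoly.mpoly (n + n) R[i] :=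
  match fintype.split k with inl j => mX (rshift n j) | inr j => mX (lshift n j) end.
pose p' := mpoly.mmap (@mpoly.mpolyC (n + n) R[i] \o @conjc R) h p.
have cc (z : 'rV[R[i]]_n) : map_mx (@conjc R) (map_mx (@conjc R) z) = z.
  by apply/rowP => j; rewrite !mxE conjcK.
have p'E z w : bieval z w p' =
    conjc (bieval (map_mx (@conjc R) w) (map_mx (@conjc R) z) p).
  rewrite /p'; elim/mpoly_bi_ind: (p) => [c|j|j|f g IHf IHg|f g IHf IHg].
  - by rewrite mpoly.mmapC !bievalC.
  - rewrite mpoly.mmapX mpoly.mmap1U bievalXl mxE conjcK /h.
    by rewrite -[lshift n j]/(fintype.unsplit (inl j)) fintype.unsplitK bievalXr.
  - rewrite mpoly.mmapX mpoly.mmap1U bievalXr mxE conjcK /h.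
    by rewrite -[rshift n j]/(fintype.unsplit (inr j)) fintype.unsplitK bievalXl.
  - by rewrite rmorphD !bievalD rmorphD; congr (_ + _).
  - by rewrite rmorphM !bievalM rmorphM; congr (_ * _).
have pp' : p = p'.
  apply/eqP; rewrite -subr_eq0; apply/eqP/bieval_conj_eq0 => z.
  by rewrite bievalB p'E cc pR subrr.
by move=> z w; rewrite {1}pp' p'E cc.
Qed.

End HermitianSymmetry.

(** * Moduli and derivatives of complex-valued functions *)

Section ReIm.
Variable R : realType.
Implicit Types y z : CC R.

Lemma cReD y z : complex.Re (y + z) = complex.Re y + complex.Re z.
Proof. by case: y => a b; case: z. Qed.

Lemma cImD y z : complex.Im (y + z) = complex.Im y + complex.Im z.
Proof. by case: y => a b; case: z. Qed.

Lemma cReN z : complex.Re (- z) = - complex.Re z.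
Proof. by case: z. Qed.

Lemma cImN z : complex.Im (- z) = - complex.Im z.
Proof. by case: z. Qed.

Lemma cReM y z : complex.Re (y * z) =
  complex.Re y * complex.Re z - complex.Im y * complex.Im z.
Proof. by case: y => a b; case: z. Qed.

Lemma cImM y z : complex.Im (y * z) =
  complex.Re y * complex.Im z + complex.Im y * complex.Re z.
Proof. by case: y => a b; case: z. Qed.

Lemma complex_ext y z : complex.Re y = complex.Re z ->
  complex.Im y = complex.Im z -> y = z.
Proof. by case: y => a b; case: z => a' b' /= -> ->. Qed.

Definition cReImE := (cReD, cImD, cReN, cImN, cReM, cImM).

End ReIm.

Section Modulus.
Variable R : realType.

(** The norm of a vector of a complex normed space as a real number. *)
Definition nrm (V : normedZmodType (CC R)) (v : V) : R := complex.Re `|v|.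

Section Additive.
Variable V : normedZmodType (CC R).
Implicit Types u v w : V.

Lemma nrmE v : `|v| = (nrm v)%:C :> CC R.
Proof. by rewrite /nrm RRe_real // normr_real. Qed.

Lemma nrm_ge0 v : 0 <= nrm v.
Proof. by have := normr_ge0 v; rewrite nrmE ler0c. Qed.

Lemma nrm0 : nrm (0 : V) = 0.
Proof. by rewrite /nrm normr0. Qed.

Lemma nrm_eq0 v : nrm v = 0 -> v = 0.
Proof. by move=> v0; apply/normr0_eq0; rewrite nrmE v0. Qed.

Lemma nrmN v : nrm (- v) = nrm v.
Proof. by rewrite /nrm normrN. Qed.

Lemma nrmC u v : nrm (u - v) = nrm (v - u).
Proof. by rewrite -nrmN opprB. Qed.

Lemma ler_nrmD u v : nrm (u + v) <= nrm u + nrm v.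
Proof. by rewrite -lecR rmorphD /= -!nrmE ler_normD. Qed.

Lemma ler_nrmB u v : nrm (u - v) <= nrm u + nrm v.
Proof. by rewrite -[nrm v]nrmN ler_nrmD. Qed.

Lemma ler_nrm_dist u v w : nrm (u - w) <= nrm (u - v) + nrm (v - w).
Proof. by rewrite -[u - w](subrKA v) ler_nrmD. Qed.

End Additive.

Implicit Types z : CC R.

Lemma nrmZ (V : normedModType (CC R)) z (v : V) : nrm (z *: v) = nrm z * nrm v.
Proof. by apply: complexI; rewrite rmorphM /= -!nrmE normrZ. Qed.

Lemma nrmM (y z : CC R) : nrm (y * z) = nrm y * nrm z.
Proof. by apply: complexI; rewrite rmorphM /= -!nrmE normrM. Qed.

Lemma nrm_real (x : R) : nrm (x%:C : CC R) = `|x|.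
Proof.
by apply: complexI; rewrite -nrmE normc_def /= expr0n addr0 sqrtr_sqr.
Qed.

Lemma ler_Re_nrm z : `|complex.Re z| <= nrm z.
Proof. by rewrite -lecR -nrmE normc_ge_Re. Qed.

Lemma ler_Im_nrm z : `|complex.Im z| <= nrm z.
Proof.
have -> : nrm z = nrm (- 'i * z : CC R).
  by rewrite mulNr nrmN nrmM /nrm normc_def /= expr0n add0r expr1n sqrtr1 mul1r.
apply: le_trans (ler_Re_nrm _); case: z => a b /=.
by rewrite oppr0 mul0r mulN1r sub0r opprK.
Qed.

Lemma ler_nrm_ReIm z : nrm z <= `|complex.Re z| + `|complex.Im z|.
Proof.
rewrite -[X in _ <= X + _]nrm_real -[X in _ <= _ + X]nrm_real.
have -> : nrm ((complex.Im z)%:C : CC R) = nrm ('i * (complex.Im z)%:C : CC R).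
  by rewrite nrmM [X in X * _]/nrm normc_def /= expr0n add0r expr1n sqrtr1 mul1r.
have {1}-> : z = (complex.Re z)%:C + 'i * (complex.Im z)%:C by exact: complexE.
by rewrite -lecR rmorphD /= -!nrmE ler_normD.
Qed.

End Modulus.

Section ComplexDerivative.
Variable R : realType.
Local Notation C := (CC R).
Implicit Types (F G : C -> C) (a l z : C) (k : R -> C).

(** F has the complex derivative l at a. *)
Definition cdiff F a l := forall e : R, 0 < e -> exists2 d : R, 0 < d &
  forall h : C, nrm h < d -> nrm (F (a + h) - F a - l * h) <= e * nrm h.

(** The complex-valued function k has the derivative l at the real point t. *)
Definition rdiff k (t : R) l := forall e : R, 0 < e -> exists2 d : R, 0 < d &
  forall h : R, `|h| < d -> nrm (k (t + h) - k t - l * h%:C) <= e * `|h|.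

Lemma rdiff_lip k t l : rdiff k t l -> exists2 d : R, 0 < d &
  forall h : R, `|h| < d -> nrm (k (t + h) - k t) <= (nrm l + 1) * `|h|.
Proof.
move=> /(_ 1 ltr01)[d d0 H]; exists d => // h hd.
have := ler_nrmD (k (t + h) - k t - l * h%:C) (l * h%:C).
rewrite subrK nrmM nrm_real => /le_trans; apply.
by rewrite mulrDl addrC lerD2l H.
Qed.

Lemma rdiff_comp F k t l m : cdiff F (k t) l -> rdiff k t m ->
  rdiff (F \o k) t (l * m).
Proof.
move=> dF dk e e0; have [d2 d20 Hk] := rdiff_lip dk.
pose B := nrm m + 1; have B0 : 0 < B by rewrite ltr_wpDl // nrm_ge0.
have [d1 d10 HF] := dF _ (divr_gt0 (divr_gt0 e0 (ltr0Sn R 1)) B0).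
pose L := nrm l + 1; have L0 : 0 < L by rewrite ltr_wpDl // nrm_ge0.
have [d3 d30 Hk'] := dk _ (divr_gt0 (divr_gt0 e0 (ltr0Sn R 1)) L0).
exists (Num.min (d1 / B) (Num.min d2 d3)).
  by rewrite !lt_min divr_gt0 // d20.
move=> h; rewrite !lt_min ltr_pdivlMr // => /and3P[h1 h2 h3].
set x := k (t + h) - k t.
have xB : nrm x <= B * `|h| by apply: Hk.
have /HF : nrm x < d1 by apply: le_lt_trans xB _; rewrite mulrC.
rewrite [k t + x]addrC subrK => Fx.
have -> : (F \o k) (t + h) - (F \o k) t - l * m * h%:C =
   (F (k (t + h)) - F (k t) - l * x) + l * (x - m * h%:C).
  by rewrite /=; ring.
apply: le_trans (ler_nrmD _ _) _.
rewrite nrmM (_ : e * `|h| = e / 2 * `|h| + e / 2 * `|h|); last by field.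
apply: lerD; first apply: le_trans Fx _.
  apply: (@le_trans _ _ (e / 2 / B * (B * `|h|))).
    by rewrite ler_wpM2l // !divr_ge0 ?(ltW e0) ?(ltW B0).
  by rewrite mulrA divfK // gt_eqF.
have := Hk' _ h3; rewrite -/x => Hx.
apply: (@le_trans _ _ (nrm l * (e / 2 / L * `|h|))).
  by rewrite ler_wpM2l // nrm_ge0.
rewrite (_ : e / 2 * `|h| = L * (e / 2 / L * `|h|)); last first.
  by field; rewrite gt_eqF.
rewrite ler_wpM2r ?lerDl // mulr_ge0 // !divr_ge0 ?(ltW e0) ?(ltW L0) //.
Qed.

Lemma rdiff_cst l t : rdiff (fun=> l) t 0.
Proof.
move=> e e0; exists 1 => // h _; rewrite subrr mul0r subr0 nrm0.
by rewrite mulr_ge0 ?(ltW e0).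
Qed.

Lemma rdiffD k1 k2 t l1 l2 : rdiff k1 t l1 -> rdiff k2 t l2 ->
  rdiff (fun x => k1 x + k2 x) t (l1 + l2).
Proof.
move=> d1 d2 e e0; have e20 : 0 < e / 2 by rewrite divr_gt0.
have [x x0 H1] := d1 _ e20; have [y y0 H2] := d2 _ e20.
exists (Num.min x y) => [|h]; first by rewrite lt_min x0.
rewrite lt_min => /andP[hx hy].
rewrite (_ : _ - _ = (k1 (t + h) - k1 t - l1 * h%:C) +
  (k2 (t + h) - k2 t - l2 * h%:C)); last by ring.
apply: le_trans (ler_nrmD _ _) _.
rewrite (_ : e * `|h| = e / 2 * `|h| + e / 2 * `|h|); last by field.
by rewrite lerD // ?H1 ?H2.
Qed.

Lemma rdiff_mulC (c : C) k t l : rdiff k t l -> rdiff (fun x => c * k x) t (c * l).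
Proof.
move=> dk; apply: (@rdiff_comp (fun z => c * z)) => // e e0.
exists 1 => // h _; rewrite (_ : _ - _ = 0); last by ring.
rewrite nrm0.
by rewrite mulr_ge0 ?(ltW e0) ?nrm_ge0.
Qed.

Lemma rdiffM k1 k2 t l1 l2 : rdiff k1 t l1 -> rdiff k2 t l2 ->
  rdiff (fun x => k1 x * k2 x) t (l1 * k2 t + k1 t * l2).
Proof.
move=> d1 d2.
have sq k l : rdiff k t l -> rdiff (fun x => k x ^+ 2) t (2%:R * k t * l).
  move=> dk; apply: (@rdiff_comp (fun z => z ^+ 2)) => // e e0.
  exists e => // h he; rewrite (_ : _ - _ = h * h); last by ring.
  by rewrite nrmM ler_wpM2r ?nrm_ge0 // ltW.
have := rdiff_mulC (4%:R^-1) (rdiffD (sq _ _ (rdiffD d1 d2))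
  (rdiff_mulC (-1) (sq _ _ (rdiffD d1 (rdiff_mulC (-1) d2))))).
have four : (4%:R : C) != 0 by rewrite pnatr_eq0.
rewrite (_ : (fun x => _) = (fun x => k1 x * k2 x)); last first.
  by apply/funext => x; field.
by rewrite (_ : 4%:R^-1 * _ = l1 * k2 t + k1 t * l2); last by field.
Qed.

(** The derivative of a real function, in terms of epsilon and delta. *)
Lemma is_derive_epsP (f : R -> R) (t l : R) : is_derive t 1 f l <->
  forall e : R, 0 < e -> exists2 d : R, 0 < d &
    forall h : R, `|h| < d -> `|f (t + h) - f t - l * h| <= e * `|h|.
Proof.
split=> [[df <-] e e0|H].
- have /eqaddoP /(_ e e0) := derivable_nbhs df.
  move=> /nbhs_ballP[d /= d0 Hd]; exists d => // h hd.
  have := Hd h; rewrite /ball /= sub0r normrN => /(_ hd).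
  rewrite /= opprD -![(_ + _ : _ -> _) _]/(_ + _) -![(- _ : _ -> _) _]/(- _).
  by rewrite /cst /= addrA [h%:A]mulr1 [h + t]addrC [h *: _]mulrC.
- have lim : h^-1 *: ((f \o shift t) (h *: 1) - f t) @[h --> 0^'] --> l.
    apply/cvgrPdist_le => e e0; have [d d0 Hd] := H e e0.
    apply/nbhs_ballP; exists d => //= h; rewrite /ball /= sub0r normrN => hd h0.
    have n0 : 0 < `|h| by rewrite normr_gt0.
    rewrite /= [h%:A]mulr1 [h + t]addrC.
    rewrite (_ : l - _ = - ((f (t + h) - f t - l * h) / h)); last first.
      by rewrite /GRing.scale /=; field.
    by rewrite normrN normrM normfV ler_pdivrMr // Hd.
  by apply: DeriveDef; [apply/cvg_ex; exists l|exact: cvg_lim].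
Qed.

Lemma rdiff_real (f : R -> R) (t l : R) : is_derive t 1 f l ->
  rdiff (fun x => (f x)%:C) t l%:C.
Proof.
move=> /is_derive_epsP H e e0; have [d d0 Hd] := H e e0; exists d => // h hd.
rewrite (_ : _ - _ = (f (t + h) - f t - l * h)%:C); first by rewrite nrm_real Hd.
by rewrite !rmorphB rmorphM.
Qed.

Lemma rdiff_Re k t l : rdiff k t l ->
  is_derive t 1 (fun x => complex.Re (k x)) (complex.Re l).
Proof.
move=> H; apply/is_derive_epsP => e e0; have [d d0 Hd] := H e e0.
exists d => // h hd; apply: le_trans (Hd h hd).
apply: le_trans (ler_Re_nrm _); rewrite le_eqVlt; apply/orP; left; apply/eqP.
by congr (`|_|); rewrite !cReImE /= mulr0 subr0.
Qed.

(** The point of argument t on the unit circle. *)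
Definition expi (t : R) : C := cos t +i* sin t.

Lemma expiE t : expi t = (cos t)%:C + 'i * (sin t)%:C.
Proof. exact: complexE. Qed.

Lemma nrm_expi t : nrm (expi t) = 1.
Proof. by rewrite /nrm normc_def /= cos2Dsin2 sqrtr1. Qed.

Lemma expiN t : expi (- t) * expi t = 1.
Proof.
apply: complex_ext; rewrite !cReImE /= cosN sinN.
  by rewrite mulNr opprK -!expr2 cos2Dsin2.
by rewrite mulNr [cos t * _]mulrC subrr.
Qed.

Lemma expiD2pi t : expi (t + 2 * pi) = expi t.
Proof. by rewrite /expi mulrC -[2]/(1 *+ 2) mulrnAr mulr1 cosD2pi sinD2pi. Qed.

Lemma rdiff_expi t : rdiff expi t ('i * expi t).
Proof.
have := rdiffD (rdiff_real (is_derive_cos t))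
  (rdiff_mulC 'i (rdiff_real (is_derive_sin t))).
rewrite (_ : (fun x => _) = expi); last by apply/funext => x; rewrite expiE.
rewrite (_ : _ + _ = 'i * expi t) //.
by apply: complex_ext; rewrite !cReImE /=; ring.
Qed.

Lemma rdiff_id t : rdiff (fun x => x%:C) t 1.
Proof. exact: rdiff_real (is_derive_id t 1). Qed.

End ComplexDerivative.

(** * Integrals over a period *)

Section RealCalculus.
Variable R : realType.
Implicit Types (f g w : R -> R).

Lemma real_MVT f (df : R -> R) (a b : R) : a <= b ->
  (forall x, a <= x <= b -> is_derive x 1 f (df x)) ->
  exists2 c, a <= c <= b & f b - f a = df c * (b - a).
Proof.
move=> ab H; have [x xab||c cab E] := @MVT_segment R f df a b ab.
- by apply: H; move: xab; rewrite in_itv /= => /andP[/ltW -> /ltW ->].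
- apply: derivable_within_continuous => x; rewrite in_itv /= => xab.
  by have [] := H x xab.
- by exists c => //; rewrite in_itv /= in cab.
Qed.

(** On an open interval, a function with zero derivative is constant. *)
Lemma derive0_const f (a b : R) : (forall x, a < x < b -> is_derive x 1 f 0) ->
  forall x y, a < x < b -> a < y < b -> f x = f y.
Proof.
move=> H; suff S x y : x <= y -> a < x < b -> a < y < b -> f x = f y.
  by move=> x y xab yab; case: (lerP x y) => [|/ltW] xy; [exact: S|rewrite (S y x)].
move=> xy /andP[ax xb] /andP[ay yb].
have [c cxy|c _ E] := @real_MVT f (fun=> 0) x y xy.
  by apply: H; case/andP: cxy => xc cy; rewrite (lt_le_trans ax) //= (le_lt_trans cy).
by apply/esym/eqP; rewrite -subr_eq0 E mul0r.
Qed.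

(** The integral over [0, 2 pi]. *)
Definition circ_int f : R := (\int[@lebesgue_measure R]_(t in `[0%R, (2 * pi)%R]) f t)%R.

Lemma twopi_gt0 : 0 < 2 * pi :> R.
Proof. by rewrite mulr_gt0 // pi_gt0. Qed.

Lemma circ_integrable f : continuous f ->
  (@lebesgue_measure R).-integrable `[0%R, (2 * pi)%R] (EFin \o f).
Proof.
move=> cf; apply: continuous_compact_integrable; first exact: segment_compact.
exact: continuous_subspaceT.
Qed.

Lemma continuous_FTC f F (a b : R) : a < b -> continuous f ->
  (forall x, a <= x <= b -> is_derive x 1 F (f x)) ->
  (\int[@lebesgue_measure R]_(t in `[a, b]) (f t)%:E = (F b - F a)%:E)%E.
Proof.
move=> ab cf dF; rewrite (continuous_FTC2 ab (F := F)) //.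
- exact: continuous_subspaceT.
- have cF x : a <= x <= b -> {for x, continuous F}.
    by move=> /dF[d _]; apply/differentiable_continuous/derivable1_diffP.
  split.
  + move=> x; rewrite in_itv /= => /andP[/ltW ax /ltW xb].
    by have [] := dF x; rewrite ?ax.
  + by apply: cvg_at_right_filter; apply: cF; rewrite lexx ltW.
  + by apply: cvg_at_left_filter; apply: cF; rewrite lexx ltW.
- move=> x; rewrite in_itv /= => /andP[/ltW ax /ltW xb].
  by rewrite derive1E; have [] := dF x; rewrite ?ax.
Qed.

Lemma circ_int_FTC f F : continuous f ->
  (forall x, 0 <= x <= 2 * pi -> is_derive x 1 F (f x)) ->
  circ_int f = F (2 * pi) - F 0.
Proof.
by move=> cf dF; rewrite /circ_int /Rintegral (continuous_FTC twopi_gt0 cf dF).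
Qed.

Lemma circ_intD f g : continuous f -> continuous g ->
  circ_int (fun t => f t + g t) = circ_int f + circ_int g.
Proof. by move=> cf cg; apply: RintegralD => //; exact: circ_integrable. Qed.

Lemma circ_intB f g : continuous f -> continuous g ->
  circ_int (fun t => f t - g t) = circ_int f - circ_int g.
Proof. by move=> cf cg; apply: RintegralB => //; exact: circ_integrable. Qed.

Lemma circ_int_cst (c : R) : circ_int (fun=> c) = 2 * pi * c.
Proof.
transitivity (c * (2 * pi) - c * 0); last by ring.
apply: (@circ_int_FTC (fun=> c) (fun x => c * x)).
- by move=> x; apply: cst_continuous.
- move=> x _; apply/is_derive_epsP => e e0; exists 1 => // h _.
  rewrite (_ : _ - _ = 0); last by ring.
  by rewrite normr0 mulr_ge0 // ltW.
Qed.

Lemma le_circ_int f g : continuous f -> continuous g ->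
  (forall t, f t <= g t) -> circ_int f <= circ_int g.
Proof.
by move=> cf cg fg; apply: le_Rintegral => //; exact: circ_integrable.
Qed.

Lemma circ_int_bound f (M : R) : continuous f -> (forall t, `|f t| <= M) ->
  `|circ_int f| <= 2 * pi * M.
Proof.
move=> cf fM; rewrite ler_norml; apply/andP; split.
- rewrite -mulrN -circ_int_cst; apply: le_circ_int => //; first exact: cst_continuous.
  by move=> t; have := fM t; rewrite ler_norml => /andP[].
- rewrite -circ_int_cst; apply: le_circ_int => //; first exact: cst_continuous.
  by move=> t; have := fM t; rewrite ler_norml => /andP[].
Qed.

Lemma antiderivative w (a b : R) : continuous w ->
  exists W, forall x, a < x < b -> is_derive x 1 W (w x).
Proof.
move=> cw; exists (fun x => (\int[@lebesgue_measure R]_(t in `[a, x]) w t)%R) => x /andP[ax xb].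
have [|d <-] := @continuous_FTC1_closed R w a x b xb _ ax (cw x).
- apply: continuous_compact_integrable; first exact: segment_compact.
  exact: continuous_subspaceT.
by rewrite derive1E; exact: derivableP.
Qed.

Lemma is_derive_translate f (x y l : R) : is_derive (x + y) 1 f l ->
  is_derive x 1 (fun t => f (t + y)) l.
Proof.
move=> /is_derive_epsP H; apply/is_derive_epsP => e e0.
by have [d d0 Hd] := H e e0; exists d => // h hd; rewrite (addrAC x h y) Hd.
Qed.

(** The integral of a periodic function over a period does not depend on the
    starting point. *)
Lemma circ_int_translate w (x : R) : continuous w ->
  (forall t, w (t + 2 * pi) = w t) ->
  circ_int (fun t => w (t + x)) = circ_int w.
Proof.
move=> cw wp; pose T := `|x| + 2 * pi + 1.
have [W dW] := antiderivative (- T) T cw.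
have pi0 := twopi_gt0.
have wE y : - (`|x| + 1) < y < `|x| + 1 ->
    circ_int (fun t => w (t + y)) = W (2 * pi + y) - W y.
  move=> /andP[y1 y2]; rewrite -[X in _ - W X]add0r.
  apply: (@circ_int_FTC _ (fun t => W (t + y))).
  - move=> t; apply: (@continuous_comp R R R (fun t => t + y) w); last exact: cw.
    by apply: cvgD; [exact: cvg_id|exact: cvg_cst].
  - move=> t /andP[t0 t1]; apply: is_derive_translate; apply: dW; rewrite /T.
    by apply/andP; split; lra.
have inx : - (`|x| + 1) < x < `|x| + 1.
  by apply/andP; split; [have := ler_norm (- x); rewrite normrN|have := ler_norm x]; lra.
have in0 : - (`|x| + 1) < 0 < `|x| + 1.
  by have := normr_ge0 x; move=> ?; apply/andP; split; lra.
have -> : circ_int w = circ_int (fun t => w (t + 0)).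
  by congr circ_int; apply/funext => t; rewrite addr0.
rewrite !wE //; apply: (@derive0_const (fun y => W (2 * pi + y) - W y) _ _ _ _ _ inx in0).
move=> y /andP[y1 y2]; rewrite -(subrr (w y)).
have d1 : is_derive y 1 (fun y => W (2 * pi + y)) (w y).
  rewrite -wp (_ : (fun y => _) = (fun y => W (y + 2 * pi))); last first.
    by apply/funext => t; rewrite addrC.
  by apply: is_derive_translate; apply: dW; rewrite /T; apply/andP; split; lra.
have d2 : is_derive y 1 W (w y).
  by apply: dW; rewrite /T; apply/andP; split; lra.
exact: is_deriveB.
Qed.

End RealCalculus.

(** * Circle means of functions satisfying the Cauchy-Riemann equations *)

Section CauchyFormula.
Variable R : realType.
Local Notation C := (CC R).

Lemma rdiff_Im (k : R -> C) t l : rdiff k t l ->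
  is_derive t 1 (fun x => complex.Im (k x)) (complex.Im l).
Proof.
move=> /(rdiff_mulC (- 'i)) /rdiff_Re.
rewrite (_ : (fun x => _) = (fun x => complex.Im (k x))); last first.
  by apply/funext => x; rewrite !cReImE /=; ring.
by rewrite (_ : complex.Re _ = complex.Im l) // !cReImE /=; ring.
Qed.

Lemma is_derive_continuous (f : R -> R) (x l : R) : is_derive x 1 f l ->
  {for x, continuous f}.
Proof. by move=> [d _]; apply/differentiable_continuous/derivable1_diffP. Qed.


(** If H, as a function of polar coordinates (r, t), satisfies the
    Cauchy-Riemann equations with bounded derivatives, then its mean over the
    circles is stationary.  The derivatives need not be continuous: the
    differentiation under the integral sign rests on dominated convergence.
    The radial increment is compared with a rotation, which does not change
    the mean. *)
Lemma circle_mean_derive0 (H A : R -> R -> C) (r0 d B : R) : 0 < d -> 0 < r0 ->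
  (forall r t, `|r - r0| < d -> rdiff (H ^~ t) r (A r t)) ->
  (forall r t, `|r - r0| < d -> rdiff (H r) t ('i * r%:C * A r t)) ->
  (forall r t, `|r - r0| < d -> nrm (A r t) <= B) ->
  (forall r t, H r (t + 2 * pi) = H r t) ->
  is_derive r0 1 (fun r => circ_int (fun t => complex.Re (H r t))) 0.
Proof.
move=> d0 r00 Hr Ht HB Hp.
pose f x t := complex.Re (H (r0 + x) t) - complex.Im (H r0 (t + x / r0)).
pose df x t := complex.Re (A (r0 + x) t) - complex.Re (A r0 (t + x / r0)).
have near x : `|x| < d -> `|r0 + x - r0| < d by rewrite addrAC subrr add0r.
have near0 : `|r0 - r0| < d by rewrite subrr normr0.
have cRe r : `|r - r0| < d -> continuous (fun t => complex.Re (H r t)).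
  by move=> rd t; apply: is_derive_continuous (rdiff_Re (Ht _ t rd)).
have cIm : continuous (fun t => complex.Im (H r0 t)).
  by move=> t; apply: is_derive_continuous (rdiff_Im (Ht _ t near0)).
have cImx x : continuous (fun t => complex.Im (H r0 (t + x / r0))).
  move=> t; apply: (@continuous_comp R R R (fun t => t + x / r0)
    (fun t => complex.Im (H r0 t))); last exact: cIm.
  by apply: cvgD; [exact: cvg_id|exact: cvg_cst].
have dfE (x t : R) : `|x| < d -> is_derive x 1 (f ^~ t) (df x t).
  move=> xd; apply: is_deriveB.
    have := rdiff_Re (Hr _ t (near _ xd)) => /is_derive_epsP D.
    apply/is_derive_epsP => e e0; have [d' d'0 D'] := D e e0.
    by exists d' => // h hd'; rewrite addrA D'.
  have := rdiff_Im (Ht _ (t + x / r0) near0) => /is_derive_epsP D.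
  have -> : complex.Re (A r0 (t + x / r0)) =
      complex.Im ('i * r0%:C * A r0 (t + x / r0)) / r0.
    by rewrite !cReImE /=; field; rewrite gt_eqF.
  apply/is_derive_epsP => e e0; have [|d' d'0 D'] := D (e * r0); first by rewrite mulr_gt0.
  exists (d' * r0) => [|h hd']; first by rewrite mulr_gt0.
  have hr : `|h / r0| < d' by rewrite normrM normfV (gtr0_norm r00) ltr_pdivrMr.
  have eqh : e * r0 * `|h / r0| = e * `|h|.
    by rewrite normrM normfV (gtr0_norm r00); field; rewrite gt_eqF.
  have := D' _ hr; rewrite eqh mulrDl addrA.
  by rewrite [h / r0 as X in _ * X]mulrC mulrA.
have dfB (x t : R) : `|x| < d -> `|df x t| <= 2 * B.
  move=> xd; apply: le_trans (ler_normB _ _) _.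
  rewrite (_ : 2 * B = B + B); last by ring.
  by apply: lerD; apply: le_trans (ler_Re_nrm _) _; apply: HB => //; apply: near.
have inI (x : R) : `]- d, d[%classic x -> `|x| < d by rewrite /= in_itv /= ltr_norml.
have I0 : `]- d, d[%classic 0 by rewrite /= in_itv /= oppr_lt0 d0.
have B0 : 0 <= 2 * B by apply: le_trans (dfB 0 0 _); rewrite ?normr0.
have mB : measurable (`[0%R, (2 * pi)%R]%classic : set (measurableTypeR R)).
  exact: measurable_itv.
have cf (x : R) : `|x| < d -> continuous (f x).
  by move=> xd t; apply: cvgB; [apply: cRe; exact: near|exact: cImx].
have intf (x : R) : `]- d, d[%classic x ->
    (@lebesgue_measure R).-integrable `[0%R, 2 * pi] (EFin \o f x).
  by move=> /inI xd; apply: circ_integrable; exact: cf.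
have der (x t : R) : `]- d, d[%classic x -> `[0%R, 2 * pi]%classic t -> derivable (f ^~ t) x 1.
  by move=> /inI xd _; have [] := dfE x t xd.
have intG : (@lebesgue_measure R).-integrable `[0%R, 2 * pi] (EFin \o (fun=> 2 * B)).
  by apply: circ_integrable => x; exact: cst_continuous.
have Gub (x t : R) : `]- d, d[%classic x -> `[0%R, 2 * pi]%classic t ->
    `|partial1of2 f x t| <= 2 * B.
  move=> /inI xd _; rewrite partial1of2E.
  by have [_ ->] := dfE x t xd; exact: dfB.
have D1 := derivable_under_integral mB I0 intf der (fun=> B0) intG Gub.
have D2 := differentiation_under_integral mB I0 intf der (fun=> B0) intG Gub.
pose K := circ_int (fun t => complex.Im (H r0 t)).
have FE (x : R) : `|x| < d -> (\int[@lebesgue_measure R]_(t in `[0%R, 2 * pi]) f x t)%R =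
    circ_int (fun t => complex.Re (H (r0 + x) t)) - K.
  move=> xd; rewrite -[LHS]/(circ_int (f x)) /f circ_intB //; last exact/cRe/near.
  congr (_ - _); apply: circ_int_translate => // t.
  by rewrite Hp.
have D : is_derive (0 : R) 1 (fun x => (\int[@lebesgue_measure R]_(t in `[0%R, 2 * pi]) f x t)%R) 0.
  apply: DeriveDef; first exact: D1.
  rewrite -derive1E D2 (_ : (fun t => _) = (fun=> 0)); last first.
    apply/funext => t; rewrite partial1of2E.
    have z0 : `|0 : R| < d by rewrite normr0.
    have [_ ->] := dfE 0 t z0.
    by rewrite /df mul0r !addr0 subrr.
  by rewrite Rintegral_cst // mul0r.
move/is_derive_epsP: D => D; apply/is_derive_epsP => e e0.
have [d' d'0 D'] := D e e0; exists (Num.min d d'); first by rewrite lt_min d0.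
move=> h; rewrite lt_min => /andP[hd /D']; rewrite add0r !FE ?normr0 // addr0.
by rewrite opprB addrA subrK.
Qed.

End CauchyFormula.

(** * Complex circle integrals and Cauchy's theorem *)

Section ComplexCircleIntegral.
Variable R : realType.
Local Notation C := (CC R).
Implicit Types k : R -> C.

(** Continuity of the real and imaginary parts. *)
Definition ccont k := continuous (fun t => complex.Re (k t)) /\
                      continuous (fun t => complex.Im (k t)).

(** The integral over [0, 2 pi] of a complex-valued function. *)
Definition cint k : C := circ_int (fun t => complex.Re (k t)) +i*
                         circ_int (fun t => complex.Im (k t)).

Lemma rdiff_ccont k (l : R -> C) : (forall t, rdiff k t (l t)) -> ccont k.
Proof.
move=> H; split=> t; first exact: is_derive_continuous (rdiff_Re (H t)).
exact: is_derive_continuous (rdiff_Im (H t)).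
Qed.

Lemma ccontD k1 k2 : ccont k1 -> ccont k2 -> ccont (fun t => k1 t + k2 t).
Proof.
move=> [r1 i1] [r2 i2]; split=> t.
  rewrite (_ : (fun t => _) = (fun t => complex.Re (k1 t) + complex.Re (k2 t))).
    by apply: cvgD; [exact: r1|exact: r2].
  by apply/funext => x; rewrite cReD.
rewrite (_ : (fun t => _) = (fun t => complex.Im (k1 t) + complex.Im (k2 t))).
  by apply: cvgD; [exact: i1|exact: i2].
by apply/funext => x; rewrite cImD.
Qed.

Lemma ccontM k1 k2 : ccont k1 -> ccont k2 -> ccont (fun t => k1 t * k2 t).
Proof.
move=> [r1 i1] [r2 i2]; split=> t.
  rewrite (_ : (fun t => _) = (fun t => complex.Re (k1 t) * complex.Re (k2 t) -
      complex.Im (k1 t) * complex.Im (k2 t))).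
    by apply: cvgB; apply: cvgM; [exact: r1|exact: r2|exact: i1|exact: i2].
  by apply/funext => x; rewrite cReM.
rewrite (_ : (fun t => _) = (fun t => complex.Re (k1 t) * complex.Im (k2 t) +
    complex.Im (k1 t) * complex.Re (k2 t))).
  by apply: cvgD; apply: cvgM; [exact: r1|exact: i2|exact: i1|exact: r2].
by apply/funext => x; rewrite cImM.
Qed.

Lemma ccont_cst (c : C) : ccont (fun=> c).
Proof. by split=> t; exact: cst_continuous. Qed.

Lemma ccont_expi : ccont (@expi R).
Proof. exact: rdiff_ccont (@rdiff_expi R). Qed.

Lemma ccont_expiN : ccont (fun t => expi (- t) : C).
Proof.
split=> t.
  rewrite (_ : (fun t => _) = (fun t => complex.Re (expi t))); first exact: ccont_expi.1.
  by apply/funext => x; rewrite /= cosN.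
rewrite (_ : (fun t => _) = (fun t => - complex.Im (expi t))).
  by apply: cvgN; exact: ccont_expi.2.
by apply/funext => x; rewrite /= sinN.
Qed.

Lemma cintD k1 k2 : ccont k1 -> ccont k2 ->
  cint (fun t => k1 t + k2 t) = cint k1 + cint k2.
Proof.
move=> [r1 i1] [r2 i2]; apply: complex_ext; rewrite ?cReD ?cImD -circ_intD //;
by congr circ_int; apply/funext => t; rewrite ?cReD ?cImD.
Qed.

Lemma circ_intZ (f : R -> R) (c : R) : continuous f ->
  circ_int (fun t => c * f t) = c * circ_int f.
Proof. by move=> cf; apply: RintegralZl => //; exact: circ_integrable. Qed.

Lemma cintZ k (c : C) : ccont k -> cint (fun t => c * k t) = c * cint k.
Proof.
move=> [rk ik].
have cm (f : R -> R) (a : R) : continuous f -> continuous (fun t => a * f t).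
  by move=> cf t; apply: cvgM; [exact: cvg_cst|exact: cf].
apply: complex_ext.
  rewrite cReM -!circ_intZ // -circ_intB; try exact: cm.
  by congr circ_int; apply/funext => t; rewrite cReM.
rewrite cImM -!circ_intZ // -circ_intD; try exact: cm.
by congr circ_int; apply/funext => t; rewrite cImM.
Qed.

Lemma cint_bound k (M : R) : ccont k -> (forall t, nrm (k t) <= M) ->
  nrm (cint k) <= 4 * pi * M.
Proof.
move=> [rk ik] kM; apply: le_trans (ler_nrm_ReIm _) _.
rewrite (_ : 4 * pi * M = 2 * pi * M + 2 * pi * M); last by ring.
apply: lerD; apply: circ_int_bound => // t; apply: le_trans (kM t).
  exact: ler_Re_nrm.
exact: ler_Im_nrm.
Qed.

Lemma cint_expiN : cint (fun t => expi (- t)) = 0.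
Proof.
have [cr ci] := ccont_expiN.
have p2 : 2 * pi = pi *+ 2 :> R by rewrite mulrC mulr_natr.
apply: complex_ext => /=.
  transitivity (sin (2 * pi) - sin 0 : R); last by rewrite p2 sin2pi sin0 subrr.
  by apply: circ_int_FTC => // x _; rewrite cosN; exact: is_derive_sin.
transitivity (cos (2 * pi) - cos 0 : R); last by rewrite p2 cos2pi cos0 subrr.
by apply: circ_int_FTC => // x _; rewrite sinN; exact: is_derive_cos.
Qed.

End ComplexCircleIntegral.

Section Cauchy.
Variable R : realType.
Local Notation C := (CC R).
Implicit Types (F : C -> C) (s : C).

Lemma cdiff_lip_bound F a l (M d : R) : 0 < d -> cdiff F a l ->
  (forall h, nrm h < d -> nrm (F (a + h) - F a) <= M * nrm h) -> nrm l <= M.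
Proof.
move=> d0 dF HM; apply/ler_addgt0Pr => e e0; have [d' d'0 H] := dF e e0.
pose x := Num.min d d' / 2.
have x0 : 0 < x by rewrite divr_gt0 // lt_min d0.
have xm : x < Num.min d d' by rewrite ltr_pdivrMr // ltr_pMr ?ltr1n // lt_min d0.
have nx : nrm (x%:C : C) = x by rewrite nrm_real gtr0_norm.
have /andP[xd xd'] : (nrm (x%:C : C) < d) && (nrm (x%:C : C) < d') by rewrite nx -lt_min.
have h1 := HM _ xd; have h2 := H _ xd'.
have : nrm (l * x%:C) <= (M + e) * nrm (x%:C : C).
  rewrite mulrDl (_ : l * x%:C = (F (a + x%:C) - F a) -
    (F (a + x%:C) - F a - l * x%:C)); last by ring.
  by apply: le_trans (ler_nrmB _ _) _; apply: lerD.
by rewrite nrmM nx ler_pM2r.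
Qed.

(** The real part of Cauchy's formula for the derivative at the centre. *)
Lemma cauchy_Re F (F1 : C -> C) (M r r0 : R) : 0 < r0 < r ->
  (forall s, nrm s < r -> cdiff F s (F1 s)) ->
  (forall s s', nrm s < r -> nrm s' < r -> nrm (F s - F s') <= M * nrm (s - s')) ->
  circ_int (fun t => complex.Re (F (r0%:C * expi t) * (expi (- t) * (r0^-1)%:C))) =
    2 * pi * complex.Re (F1 0).
Proof.
move=> /andP[r00 r0r] dF lF.
have r_gt0 : 0 < r by exact: lt_trans r0r.
have M0 : 0 <= M.
  have := lF 0 (r0%:C); rewrite nrm0 nrm_real gtr0_norm // sub0r nrmN nrm_real gtr0_norm //.
  move=> /(_ r_gt0 r0r) /(le_trans (nrm_ge0 _)).
  by rewrite pmulr_lge0.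
pose H x t : C := F (x%:C * expi t) * (expi (- t) * (x^-1)%:C).
pose A x t : C := F1 (x%:C * expi t) * (x^-1)%:C -
  F (x%:C * expi t) * expi (- t) * (x^-2)%:C.
pose J x := circ_int (fun t => complex.Re (H x t)).
have inC x t : 0 < x < r -> nrm (x%:C * expi t : C) < r.
  by move=> /andP[x0 xr]; rewrite nrmM nrm_expi mulr1 nrm_real gtr0_norm.
have F1M s : nrm s < r -> nrm (F1 s) <= M.
  move=> sr; apply: (@cdiff_lip_bound F s (F1 s) M (r - nrm s)).
  - by rewrite subr_gt0.
  - exact: dF.
  - move=> h hr; have := lF (s + h) s; rewrite addrAC subrr add0r; apply => //.
    by apply: le_lt_trans (ler_nrmD _ _) _; rewrite addrC -ltrBrDr.
have FB s : nrm s < r -> nrm (F s) <= nrm (F 0) + M * r.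
  move=> sr; rewrite -[F s](subrK (F 0)) addrC.
  apply: le_trans (ler_nrmD _ _) _; apply: lerD => //.
  apply: le_trans (lF _ _ sr _) _; first by rewrite nrm0.
  by rewrite subr0 ler_wpM2l // ltW.
have xn0 x : 0 < x -> (x%:C : C) != 0.
  by move=> x0; rewrite -(rmorph0 (real_complex R)) (inj_eq (@complexI R)) gt_eqF.
have invE x : (x^-1)%:C = (x%:C)^-1 :> C by rewrite fmorphV.
have inv2E x : (x^-2)%:C = (x%:C)^-2 :> C by rewrite fmorphV rmorphXn.
have Ht y t : 0 < y < r -> rdiff (H y) t ('i * y%:C * A y t).
  move=> yr; have /andP[y0 _] := yr.
  have d1 : rdiff (fun t => y%:C * expi t) t (y%:C * ('i * expi t)).
    exact: rdiff_mulC (rdiff_expi t).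
  have d2 : rdiff (fun t => expi (- t) * (y^-1)%:C) t (- 'i * expi (- t) * (y^-1)%:C).
    have dN : rdiff (fun t => expi (- t)) t (- 'i * expi (- t)).
      move=> e e0; have [d' d'0 D] := rdiff_expi (- t) e0.
      exists d' => // h hd; have := D (- h); rewrite normrN => /(_ hd).
      by rewrite rmorphN /= mulrN mulNr opprD mulNr.
    rewrite (_ : (fun t => _) = (fun t => (y^-1)%:C * expi (- t))); last first.
      by apply/funext => u; rewrite mulrC.
    by rewrite mulrC; apply: rdiff_mulC.
  have d3 := rdiffM (rdiff_comp (dF _ (inC y t yr)) d1) d2.
  have -> : 'i * y%:C * A y t =
    F1 (y%:C * expi t) * (y%:C * ('i * expi t)) * (expi (- t) * (y^-1)%:C) +
    F (y%:C * expi t) * (- 'i * expi (- t) * (y^-1)%:C).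
    have e1 : expi t * expi (- t) = 1 :> C by rewrite mulrC expiN.
    rewrite /A invE inv2E; have := xn0 _ y0; move: (y%:C) => Y Y0.
    transitivity ('i * F1 (Y * expi t) * (expi t * expi (- t)) -
       'i * F (Y * expi t) * expi (- t) / Y); last by field.
    by rewrite e1; field.
  exact: d3.
have dJ x : 0 < x < r -> is_derive x 1 J 0.
  move=> /andP[x0 xr].
  pose d := Num.min (x / 2) (r - x).
  have d0 : 0 < d by rewrite lt_min divr_gt0 // subr_gt0.
  have near y : `|y - x| < d -> x / 2 < y < r.
    by rewrite lt_min !ltr_norml => /andP[/andP[h1 _] /andP[_ h2]]; apply/andP; split; lra.
  have near' y : `|y - x| < d -> 0 < y < r.
    by move=> /near /andP[h ->]; rewrite (lt_trans _ h) // divr_gt0.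
  pose B := M * (x / 2)^-1 + (nrm (F 0) + M * r) * (x / 2) ^- 2.
  apply: (@circle_mean_derive0 R H A x d B d0 x0).
  - move=> y t /near' yr; have /andP[y0 _] := yr.
    have d1 : rdiff (fun y => y%:C * expi t) y (expi t).
      have := rdiffM (rdiff_id y) (rdiff_cst (expi t) y).
      by rewrite mul1r mulr0 addr0.
    have d2 : rdiff (fun y => (y^-1)%:C) y (- y^-2)%:C.
      apply: rdiff_real; have y_neq0 : y != 0 by rewrite gt_eqF.
      have := is_deriveV y_neq0 (is_derive_id y (1 : R)).
      by rewrite /GRing.scale /= mulr1.
    have d3 := rdiffM (rdiff_comp (dF _ (inC y t yr)) d1) (rdiff_mulC (expi (- t)) d2).
    have -> : A y t = F1 (y%:C * expi t) * expi t * (expi (- t) * (y^-1)%:C) +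
      F (y%:C * expi t) * (expi (- t) * (- y^-2)%:C).
      rewrite /A rmorphN /= !mulrN -!mulrA; congr (_ * _ - _).
      by rewrite !mulrA [expi t * _]mulrC expiN mul1r.
    exact: d3.
  - by move=> y t /near'; apply: Ht.
  - move=> y t yd; have yr := near' _ yd; have /andP[y2 _] := near _ yd.
    have /andP[y0 _] := yr.
    rewrite /A; apply: le_trans (ler_nrmB _ _) _; apply: lerD.
      rewrite nrmM nrm_real; apply: ler_pM => //; first exact: nrm_ge0.
        exact/F1M/inC.
      by rewrite gtr0_norm ?invr_gt0 // lef_pV2 ?posrE ?divr_gt0 // ltW.
    rewrite !nrmM nrm_expi mulr1 nrm_real; apply: ler_pM => //; first exact: nrm_ge0.
      exact/FB/inC.
    rewrite gtr0_norm ?invr_gt0 ?exprn_gt0 // lef_pV2 ?posrE ?exprn_gt0 ?divr_gt0 //.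
    by rewrite lerXn2r ?nnegrE ?divr_ge0 ?ltW.
  - move=> y t; rewrite /H expiD2pi opprD.
    suff -> : expi (- t - 2 * pi) = expi (- t) :> C by [].
    by rewrite -[LHS]expiD2pi subrK.
have Jc x : 0 < x < r -> J x = J r0.
  by move=> xr; apply: (derive0_const dJ); rewrite ?r00.
rewrite -/(J r0).
(* as the radius tends to zero, the mean tends to the derivative at the centre *)
apply/eqP; rewrite -subr_eq0 -normr_le0; apply/ler_addgt0Pr => e e0.
rewrite add0r; have pi2 := twopi_gt0 R.
have nr0 : nrm (0 : C) < r by rewrite nrm0.
have [d d0 D] := dF 0 nr0 _ (divr_gt0 e0 pi2).
pose x := Num.min d r / 2.
have x0 : 0 < x by rewrite divr_gt0 // lt_min d0.
have /andP[xd xr] : (x < d) && (x < r).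
  by rewrite -lt_min ltr_pdivrMr // ltr_pMr ?ltr1n // lt_min d0.
rewrite -(Jc x) ?x0 //.
pose E t := H x t + (- (F 0 / x%:C) * expi (- t) + - F1 0).
have cH : ccont (H x) by apply: rdiff_ccont => t; apply: Ht; rewrite x0.
have cE : ccont E.
  apply: ccontD => //; apply: ccontD; last exact: ccont_cst.
  by apply: ccontM; [exact: ccont_cst|exact: ccont_expiN].
have EH : cint (H x) = cint E + cint (fun t => F1 0).
  transitivity (cint (fun t => E t + (F1 0 + F 0 / x%:C * expi (- t)))).
    by congr cint; apply/funext => t; rewrite /E; ring.
  have c1 := ccont_cst (F1 0); have c2 := ccontM (ccont_cst (F 0 / x%:C)) (@ccont_expiN R).
  rewrite cintD //; last exact: ccontD.
  by rewrite cintD // cintZ ?cint_expiN ?mulr0 ?addr0 //; exact: ccont_expiN.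
have -> : J x = circ_int (fun t => complex.Re (E t)) + 2 * pi * complex.Re (F1 0).
  by have := congr1 (@complex.Re R) EH; rewrite cReD /= circ_int_cst.
rewrite addrK.
rewrite -[X in _ <= X](divfK (lt0r_neq0 pi2)) [X in _ <= X]mulrC.
apply: circ_int_bound; first exact: cE.1.
move=> t; apply: le_trans (ler_Re_nrm _) _.
have -> : E t = (F (0 + x%:C * expi t) - F 0 - F1 0 * (x%:C * expi t)) *
    (expi (- t) * (x^-1)%:C).
  rewrite /E /H add0r invE; have := xn0 _ x0; move: (x%:C) => X X0.
  have e1 : expi t * expi (- t) = 1 :> C by rewrite mulrC expiN.
  transitivity (F (X * expi t) * (expi (- t) / X) - F 0 / X * expi (- t) -
    F1 0 * (expi t * expi (- t))); last by field.
  by rewrite e1; ring.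
rewrite nrmM; have nx : nrm (x%:C * expi t : C) = x.
  by rewrite nrmM nrm_expi mulr1 nrm_real gtr0_norm.
have -> : nrm (expi (- t) * (x^-1)%:C : C) = x^-1.
  by rewrite nrmM nrm_expi mul1r nrm_real gtr0_norm ?invr_gt0.
rewrite ler_pdivrMr //; have := D (x%:C * expi t); rewrite nx; exact.
Qed.

End Cauchy.

(** * Cauchy's formula for Lipschitz holomorphic functions *)

Section HolomorphicLipschitz.
Variable R : realType.
Local Notation C := (CC R).

Lemma cdiff_mulC (F : C -> C) (c a l : C) : cdiff F a l ->
  cdiff (fun s => c * F s) a (c * l).
Proof.
move=> dF e e0; pose L := nrm c + 1; have L0 : 0 < L by rewrite ltr_wpDl // nrm_ge0.
have [d d0 D] := dF _ (divr_gt0 e0 L0); exists d => // h hd.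
rewrite (_ : _ - _ = c * (F (a + h) - F a - l * h)); last by ring.
rewrite nrmM; apply: (@le_trans _ _ (L * (e / L * nrm h))).
  by apply: ler_pM; rewrite ?nrm_ge0 ?D // /L lerDl.
by rewrite mulrA [L * _]mulrC divfK // gt_eqF.
Qed.

Lemma Im_ReNi (z : C) : complex.Im z = complex.Re (- 'i * z).
Proof. by rewrite cReM cReN cImN /= oppr0 mul0r sub0r mulN1r opprK. Qed.

(** Cauchy's formula for the derivative at the centre of a disc. *)
Lemma cauchy_formula (F F1 : C -> C) (M r r0 : R) : 0 < r0 < r ->
  (forall s, nrm s < r -> cdiff F s (F1 s)) ->
  (forall s s', nrm s < r -> nrm s' < r -> nrm (F s - F s') <= M * nrm (s - s')) ->
  F1 0 = ((2 * pi)^-1)%:C *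
    cint (fun t => F (r0%:C * expi t) * (expi (- t) * (r0^-1)%:C)).
Proof.
move=> r0r dF lF; have pi2 := lt0r_neq0 (twopi_gt0 R).
have h1 := cauchy_Re r0r dF lF.
have h2 := @cauchy_Re R (fun s => - 'i * F s) (fun s => - 'i * F1 s) M r r0 r0r.
apply: complex_ext; rewrite !cReImE /= mul0r ?subr0 ?addr0.
  by rewrite h1 mulrA mulVf ?mul1r.
suff -> : circ_int (fun t => complex.Im (F (r0%:C * expi t) * (expi (- t) * (r0^-1)%:C))) =
    2 * pi * complex.Im (F1 0) by rewrite mulrA mulVf ?mul1r.
rewrite (Im_ReNi (F1 0)).
rewrite -h2.
- by congr circ_int; apply/funext => t; rewrite Im_ReNi; congr (complex.Re _); exact: mulrA.
- by move=> s sr; apply: cdiff_mulC; exact: dF.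
- move=> s s' sr s'r; rewrite -mulrBr nrmM.
  have -> : nrm (- 'i : C) = 1 by rewrite nrmN /nrm normc_def /= expr0n add0r expr1n sqrtr1.
  by rewrite mul1r; exact: lF.
Qed.

(** The mean value inequality along a segment issued from the origin. *)
Lemma complex_MVT (F F1 : C -> C) (l s : C) (K : R) :
  (forall t : R, 0 <= t <= 1 -> cdiff F (t%:C * s) (F1 (t%:C * s))) ->
  (forall t : R, 0 <= t <= 1 -> nrm (F1 (t%:C * s) - l) <= K) ->
  nrm (F s - F 0 - l * s) <= K * nrm s.
Proof.
move=> dF bF; set g := F s - F 0 - l * s.
have [g0|g0] := eqVneq (nrm g) 0.
  rewrite g0 mulr_ge0 ?nrm_ge0 //.
  by apply: le_trans (nrm_ge0 _) (bF 0 _); rewrite lexx ler01.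
pose c := conjc g : C.
pose k (t : R) : C := c * (F (t%:C * s) + (- l * s) * t%:C).
pose k1 (t : R) : C := c * (F1 (t%:C * s) * s + (- l * s) * 1).
have dk t : 0 <= t <= 1 -> rdiff k t (k1 t).
  move=> t01; apply: rdiff_mulC; apply: rdiffD.
    have ds : rdiff (fun t : R => t%:C * s) t s.
      rewrite (_ : (fun t : R => _) = (fun t => s * t%:C)); last first.
        by apply/funext => x; rewrite mulrC.
      by have := rdiff_mulC s (rdiff_id t); rewrite mulr1.
    exact: (rdiff_comp (dF t t01) ds).
  exact: rdiff_mulC (rdiff_id t).
have [t t01 E] := @real_MVT R (fun t => complex.Re (k t))
  (fun t => complex.Re (k1 t)) 0 1 ler01 (fun t t01 => rdiff_Re (dk t t01)).
have cn : nrm c = nrm g by rewrite /nrm; congr complex.Re; exact: normcJ.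
have E1 : complex.Re (k 1) - complex.Re (k 0) = nrm g ^+ 2.
  transitivity (complex.Re (c * g)).
    by rewrite /k /g !mul1r mul0r mulr0 addr0 !cReImE /=; ring.
  by rewrite mulrC /c -sqr_normc nrmE -rmorphXn.
have E2 : complex.Re (k1 t) <= nrm g * (K * nrm s).
  apply: le_trans (ler_norm _) _; apply: le_trans (ler_Re_nrm _) _.
  rewrite /k1 mulr1 -mulrDl !nrmM cn ler_wpM2l ?nrm_ge0 //.
  by rewrite ler_wpM2r ?nrm_ge0 ?bF.
have gp : 0 < nrm g by rewrite lt_neqAle eq_sym g0 nrm_ge0.
have : nrm g * nrm g <= nrm g * (K * nrm s).
  by rewrite -expr2 -E1 E subr0 mulr1.
by rewrite ler_pM2l.
Qed.

Lemma expi_lip (t u : R) : nrm (expi t - expi u : C) <= 2 * `|t - u|.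
Proof.
have lip (f f' : R -> R) : (forall x : R, is_derive x 1 f (f' x)) ->
    (forall x, `|f' x| <= 1) -> forall x y : R, `|f x - f y| <= `|x - y|.
  move=> df bf; suff S (x y : R) : x <= y -> `|f x - f y| <= `|x - y|.
    by move=> x y; case: (leP x y) => [|/ltW] xy; [exact: S|rewrite distrC (distrC x); exact: S].
  move=> xy; have [c _ E] := real_MVT xy (fun z _ => df z).
  by rewrite distrC E normrM (distrC x) ler_piMl.
apply: le_trans (ler_nrm_ReIm _) _; rewrite !cReImE /=.
rewrite (_ : 2 * `|t - u| = `|t - u| + `|t - u|); last by ring.
apply: lerD.
  apply: (lip _ _ (@is_derive_cos R)) => x.
  by rewrite normrN ler_norml sin_geN1 sin_le1.
by apply: (lip _ _ (@is_derive_sin R)) => x; rewrite ler_norml cos_geN1 cos_le1.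
Qed.

Lemma ccont_lip (k : R -> C) (L : R) :
  (forall t u, nrm (k t - k u) <= L * `|t - u|) -> ccont k.
Proof.
move=> kL.
have lc (f : R -> R) : (forall t u, `|f t - f u| <= L * `|t - u|) -> continuous f.
  move=> fL t; pose L1 := `|L| + 1; have L10 : 0 < L1 by rewrite ltr_wpDl.
  apply/cvgrPdist_le => e e0; apply/nbhs_ballP; exists (e / L1) => /=.
    by rewrite divr_gt0.
  move=> u; rewrite /ball /= ltr_pdivlMr // => tu.
  apply: le_trans (fL t u) _; apply: le_trans (ltW tu); rewrite mulrC.
  by rewrite ler_wpM2l // /L1 (le_trans (ler_norm _)) // lerDl.
split; apply: lc => t u; apply: le_trans (kL t u).
  by rewrite -[complex.Re (k t) - _]/(_ - _) -cReN -cReD ler_Re_nrm.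
by rewrite -cImN -cImD ler_Im_nrm.
Qed.

Variable V : normedModType C.
Implicit Types (f : V -> C) (Df : V -> V -> C) (z b : V).

(** On the ball of radius r around z0, the function f is Lipschitz, and it has
    the complex derivative Df b along every complex line of direction b. *)
Definition holo_lip f Df z0 (r M : R) :=
  (forall z b, nrm (z - z0) < r -> cdiff (fun s => f (z + s *: b)) 0 (Df b z)) /\
  (forall z z', nrm (z - z0) < r -> nrm (z' - z0) < r ->
     nrm (f z - f z') <= M * nrm (z - z')).

Lemma holo_line f Df z0 r M z b s : holo_lip f Df z0 r M ->
  nrm (z + s *: b - z0) < r -> cdiff (fun s => f (z + s *: b)) s (Df b (z + s *: b)).
Proof.
move=> [H _] sr e e0; have [d d0 D] := H _ b sr e e0; exists d => // h hd.
by have := D h hd; rewrite add0r scale0r addr0 scalerDl addrA.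
Qed.

Lemma ler_nrm_shift z z0 (v : V) : nrm (z + v - z0) <= nrm (z - z0) + nrm v.
Proof. by rewrite addrAC ler_nrmD. Qed.

Lemma holo_ccont f Df z0 r M z b (p : R) : holo_lip f Df z0 r M -> 0 < p ->
  nrm (z - z0) + p * nrm b < r -> ccont (fun t => f (z + (p%:C * expi t) *: b)).
Proof.
move=> H p0 pr; apply: (@rdiff_ccont _ _
  (fun t => Df b (z + (p%:C * expi t) *: b) * (p%:C * ('i * expi t)))) => t.
apply: (@rdiff_comp R (fun s => f (z + s *: b)) (fun t => p%:C * expi t)).
  apply: holo_line H _; apply: le_lt_trans pr; apply: le_trans (ler_nrm_shift _ _ _) _.
  by rewrite nrmZ nrmM nrm_expi mulr1 nrm_real gtr0_norm.
exact: rdiff_mulC (rdiff_expi t).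
Qed.

Lemma ccont_kernel (p : R) : ccont (fun t => expi (- t) * (p^-1)%:C : C).
Proof. by apply: ccontM; [exact: ccont_expiN|exact: ccont_cst]. Qed.

Lemma holo_formula f Df z0 r M z b (p : R) : holo_lip f Df z0 r M -> 0 < p ->
  nrm (z - z0) + p * nrm b < r ->
  Df b z = ((2 * pi)^-1)%:C *
    cint (fun t => f (z + (p%:C * expi t) *: b) * (expi (- t) * (p^-1)%:C)).
Proof.
move=> H p0 pr.
pose gap := r - (nrm (z - z0) + p * nrm b).
have gap0 : 0 < gap by rewrite subr_gt0.
have nb1 : 0 < nrm b + 1 by rewrite ltr_wpDl // nrm_ge0.
pose r' := p + gap / (nrm b + 1).
have rr' s : nrm s < r' -> nrm (z + s *: b - z0) < r.
  move=> sr'; apply: le_lt_trans (ler_nrm_shift _ _ _) _; rewrite nrmZ.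
  have [b0|b0] := eqVneq (nrm b) 0.
    by rewrite b0 mulr0 addr0; move: pr; rewrite b0 mulr0 addr0.
  have bp : 0 < nrm b by rewrite lt_neqAle eq_sym b0 nrm_ge0.
  apply: (@lt_le_trans _ _ (nrm (z - z0) + r' * nrm b)).
    by rewrite ltrD2l ltr_pM2r.
  rewrite /r' mulrDl addrA -lerBrDl -/gap.
  by rewrite mulrAC ler_pdivrMr // ler_wpM2l ?lerDl // ltW.
have := @cauchy_formula (fun s => f (z + s *: b)) (fun s => Df b (z + s *: b))
  (M * nrm b) r' p.
rewrite scale0r addr0; apply.
- by rewrite p0 /= /r' ltrDl divr_gt0.
- by move=> s /rr' sr; apply: holo_line H sr.
- move=> s s' /rr' sr /rr' s'r; apply: le_trans (H.2 _ _ sr s'r) _.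
  rewrite opprD addrACA subrr add0r -scalerBl nrmZ.
  by rewrite mulrA mulrAC.
Qed.

Let nrm2pi : nrm (((2 * pi)^-1)%:C : C) = (2 * pi)^-1.
Proof. by rewrite nrm_real gtr0_norm // invr_gt0 twopi_gt0. Qed.

Lemma cint_kernel_bound (k : R -> C) (p B : R) : 0 < p -> ccont k ->
  (forall t, nrm (k t) <= B) ->
  nrm (((2 * pi)^-1)%:C * cint (fun t => k t * (expi (- t) * (p^-1)%:C))) <=
    2 * B / p.
Proof.
move=> p0 ck kB; rewrite nrmM nrm2pi ler_pdivrMl ?twopi_gt0 //.
rewrite (_ : 2 * pi * (2 * B / p) = 4 * pi * (B * p^-1)); last by ring.
apply: cint_bound => [|t]; first by apply: ccontM => //; exact: ccont_kernel.
rewrite !nrmM nrm_expi mul1r nrm_real gtr0_norm ?invr_gt0 //.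
by rewrite ler_wpM2r // invr_ge0 ltW.
Qed.

(** The integral formula for Df b is Lipschitz in the base point. *)
Lemma holo_D_lip f Df z0 r M b : 0 < r -> holo_lip f Df z0 r M ->
  exists2 K, 0 <= K & forall z z', nrm (z - z0) < r / 2 -> nrm (z' - z0) < r / 2 ->
    nrm (Df b z - Df b z') <= K * nrm (z - z').
Proof.
move=> r0 H; have nb1 : 0 < nrm b + 1 by rewrite ltr_wpDl // nrm_ge0.
pose p := r / (2 * (nrm b + 1)).
have p0 : 0 < p by rewrite divr_gt0 // mulr_gt0.
have pb : p * nrm b <= r / 2.
  rewrite /p invfM mulrA -mulrA ler_piMr ?divr_ge0 ?(ltW r0) //.
  by rewrite ler_pdivrMl // mulr1 lerDl.
have inr z : nrm (z - z0) < r / 2 -> nrm (z - z0) + p * nrm b < r.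
  by move=> zr; rewrite [ltRHS]splitr ltr_leD.
exists (2 * `|M| / p) => [|z z' zr z'r].
  by rewrite divr_ge0 ?(ltW p0) // mulr_ge0.
rewrite (holo_formula H p0 (inr z zr)) (holo_formula H p0 (inr z' z'r)) -mulrBr.
pose k t := f (z + (p%:C * expi t) *: b).
pose k' t := f (z' + (p%:C * expi t) *: b).
rewrite -/(cint (fun t => k t * (expi (- t) * (p^-1)%:C))).
rewrite -/(cint (fun t => k' t * (expi (- t) * (p^-1)%:C))).
have ck : ccont k by apply: holo_ccont H p0 (inr z zr).
have ck' : ccont k' by apply: holo_ccont H p0 (inr z' z'r).
have -> : cint (fun t => k t * (expi (- t) * (p^-1)%:C)) -
    cint (fun t => k' t * (expi (- t) * (p^-1)%:C)) =
    cint (fun t => (k t + -1 * k' t) * (expi (- t) * (p^-1)%:C)).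
  have cK := ccont_kernel p.
  rewrite -[X in _ - X]mul1r -mulNr -cintZ; last exact: ccontM.
  rewrite -cintD; last by apply: ccontM; [exact: ccont_cst|exact: ccontM].
    by congr cint; apply/funext => t; ring.
  exact: ccontM.
rewrite (_ : 2 * `|M| / p * nrm (z - z') = 2 * (`|M| * nrm (z - z')) / p); last by ring.
apply: cint_kernel_bound => // [|t].
  by apply: ccontD => //; apply: ccontM => //; exact: ccont_cst.
rewrite mulN1r /k /k'.
have sh (y : V) : nrm (y - z0) < r / 2 -> nrm (y + (p%:C * expi t) *: b - z0) < r.
  move=> /inr; apply: le_lt_trans; apply: le_trans (ler_nrm_shift _ _ _) _.
  by rewrite nrmZ nrmM nrm_expi mulr1 nrm_real gtr0_norm.
apply: le_trans (H.2 _ _ (sh _ zr) (sh _ z'r)) _.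
rewrite opprD addrACA subrr addr0 ler_wpM2r ?nrm_ge0 //; exact: ler_norm.
Qed.

End HolomorphicLipschitz.

(** * Derivatives of holomorphic functions *)

Section HolomorphicDerivative.
Variable R : realType.
Local Notation C := (CC R).
Variable V : normedModType C.
Implicit Types (f : V -> C) (Df : V -> V -> C) (z b : V).

(** The first-order Taylor formula with quadratic remainder. *)
Lemma holo_second f Df z0 r M b K : holo_lip f Df z0 r M -> 0 <= r -> 0 <= K ->
  (forall z z', nrm (z - z0) < r / 2 -> nrm (z' - z0) < r / 2 ->
    nrm (Df b z - Df b z') <= K * nrm (z - z')) ->
  forall y s, nrm (y - z0) + nrm s * nrm b < r / 2 ->
    nrm (f (y + s *: b) - f y - Df b y * s) <= K * nrm b * nrm s * nrm s.
Proof.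
move=> H r0 K0 HK y s ys.
have half x : x < r / 2 -> x < r by move=> /lt_le_trans; apply; rewrite ler_pdivrMr // ler_peMr // ler1n.
have yr : nrm (y - z0) < r / 2.
  by apply: le_lt_trans ys; rewrite lerDl mulr_ge0 ?nrm_ge0.
have seg (t : R) : 0 <= t <= 1 -> nrm (y + (t%:C * s) *: b - z0) < r / 2.
  move=> /andP[t0 t1]; apply: le_lt_trans ys; apply: le_trans (ler_nrm_shift _ _ _) _.
  rewrite lerD2l nrmZ nrmM nrm_real ger0_norm //.
  by rewrite ler_wpM2r ?nrm_ge0 // ler_piMl ?nrm_ge0.
have := @complex_MVT R (fun s => f (y + s *: b)) (fun s => Df b (y + s *: b))
  (Df b y) s (K * nrm b * nrm s).
rewrite scale0r addr0; apply => t t01.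
  by apply: holo_line H _; apply/half/seg.
apply: le_trans (HK _ _ (seg t t01) yr) _.
rewrite addrAC subrr add0r nrmZ nrmM nrm_real.
rewrite (_ : K * nrm b * nrm s = K * (1 * nrm s * nrm b)); last by ring.
case/andP: t01 => t0 t1; rewrite ger0_norm // ler_wpM2l //.
by rewrite !ler_wpM2r ?nrm_ge0.
Qed.

(** The directional derivatives of a Lipschitz holomorphic function are again
    Lipschitz and holomorphic, on a smaller ball. *)
Lemma holo_D f Df z0 r M b : 0 < r -> holo_lip f Df z0 r M ->
  exists D2 K, holo_lip (Df b) D2 z0 (r / 4) K.
Proof.
move=> r0 H; have [K K0 HK] := holo_D_lip b r0 H.
have nb1 : 0 < nrm b + 1 by rewrite ltr_wpDl // nrm_ge0.
pose p := r / (8 * (nrm b + 1)).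
have p0 : 0 < p by rewrite divr_gt0 // mulr_gt0.
have pb : p * nrm b <= r / 8.
  rewrite /p invfM mulrA -mulrA ler_piMr ?divr_ge0 ?(ltW r0) //.
  by rewrite ler_pdivrMl // mulr1 lerDl.
pose zeta t : C := p%:C * expi t.
have nz t : nrm (zeta t *: b) <= r / 8.
  by rewrite nrmZ nrmM nrm_expi mulr1 nrm_real gtr0_norm.
exists (fun b' z => ((2 * pi)^-1)%:C *
  cint (fun t => Df b' (z + zeta t *: b) * (expi (- t) * (p^-1)%:C))), K.
split=> [z b' zr|z z' zr z'r]; last first.
  have h x : x < r / 4 -> x < r / 2 by move=> xr; lra.
  by apply: HK; apply: h.
have [K' K'0 HK'] := holo_D_lip b' r0 H.
have nb1' : 0 < nrm b' + 1 by rewrite ltr_wpDl // nrm_ge0.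
have inz t : nrm (z + zeta t *: b - z0) < r * 3 / 8.
  by apply: le_lt_trans (ler_nrm_shift _ _ _) _; have := nz t; lra.
have cDf : ccont (fun t => Df b' (z + zeta t *: b)).
  apply: (@ccont_lip R _ (K' * (p * 2 * nrm b))) => t u.
  have h x : x < r * 3 / 8 -> x < r / 2 by move=> xr; lra.
  apply: le_trans (HK' _ _ (h _ (inz t)) (h _ (inz u))) _.
  rewrite -[leRHS]mulrA ler_wpM2l //.
  rewrite opprD addrACA subrr add0r -scalerBl nrmZ -mulrBr nrmM nrm_real gtr0_norm //.
  rewrite [leRHS](_ : _ = p * (2 * `|t - u|) * nrm b); last by ring.
  by rewrite ler_wpM2r ?nrm_ge0 // ler_wpM2l ?(ltW p0) // expi_lip.
move=> e e0.
pose Q := 2 * (K' * nrm b') / p + 1.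
have Q0 : 0 < Q.
  by rewrite ltr_wpDl // divr_ge0 ?(ltW p0) // mulr_ge0 // mulr_ge0 ?nrm_ge0.
exists (Num.min (r / (8 * (nrm b' + 1))) (e / Q)).
  by rewrite lt_min !divr_gt0 // mulr_gt0.
move=> s; rewrite lt_min => /andP[sr se]; rewrite add0r scale0r addr0.
have sb : nrm s * nrm b' <= r / 8.
  apply: (@le_trans _ _ (nrm s * (nrm b' + 1))).
    by rewrite ler_wpM2l ?nrm_ge0 // lerDl.
  move: sr; rewrite ltr_pdivlMr ?mulr_gt0 // => sr.
  by rewrite ler_pdivlMr //; apply: le_trans (ltW sr); rewrite mulrAC -mulrA [8 * _]mulrC mulrA.
have inf1 : nrm (z + s *: b' - z0) + p * nrm b < r.
  apply: le_lt_trans (lerD (ler_nrm_shift _ _ _) pb) _; rewrite nrmZ; lra.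
have inf0 : nrm (z - z0) + p * nrm b < r by lra.
rewrite (holo_formula H p0 inf1) (holo_formula H p0 inf0).
pose k1 t := f (z + s *: b' + (p%:C * expi t) *: b).
pose k0 t := f (z + (p%:C * expi t) *: b).
pose k2 t := Df b' (z + zeta t *: b).
have ck1 : ccont k1 by apply: holo_ccont H p0 inf1.
have ck0 : ccont k0 by apply: holo_ccont H p0 inf0.
have -> : ((2 * pi)^-1)%:C * cint (fun t => k1 t * (expi (- t) * (p^-1)%:C)) -
   ((2 * pi)^-1)%:C * cint (fun t => k0 t * (expi (- t) * (p^-1)%:C)) -
   ((2 * pi)^-1)%:C * cint (fun t => k2 t * (expi (- t) * (p^-1)%:C)) * s =
   ((2 * pi)^-1)%:C * cint (fun t => (k1 t + (-1 * k0 t + - s * k2 t)) *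
     (expi (- t) * (p^-1)%:C)).
  have cK := @ccont_kernel R p.
  have c1 : ccont (fun t => k1 t * (expi (- t) * (p^-1)%:C)) by apply: ccontM.
  have c0 : ccont (fun t => k0 t * (expi (- t) * (p^-1)%:C)) by apply: ccontM.
  have c2 : ccont (fun t => k2 t * (expi (- t) * (p^-1)%:C)) by apply: ccontM.
  transitivity (((2 * pi)^-1)%:C * (cint (fun t => k1 t * (expi (- t) * (p^-1)%:C)) +
    (cint (fun t => -1 * (k0 t * (expi (- t) * (p^-1)%:C))) +
     cint (fun t => - s * (k2 t * (expi (- t) * (p^-1)%:C)))))).
    by rewrite !cintZ //; ring.
  have cc c (k : R -> C) : ccont k -> ccont (fun t => c * k t).
    by move=> ck; apply: ccontM => //; exact: ccont_cst.
  rewrite -cintD; try exact: cc.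
  rewrite -cintD //; last by apply: ccontD; exact: cc.
  by congr (_ * cint _); apply/funext => t; ring.
apply: (@le_trans _ _ (2 * (K' * nrm b' * nrm s * nrm s) / p)).
  apply: cint_kernel_bound => // [|t].
    apply: ccontD => //; apply: ccontD; apply: ccontM => //; exact: ccont_cst.
  have h : nrm (z + zeta t *: b - z0) + nrm s * nrm b' < r / 2.
    by have := inz t; lra.
  have := holo_second H (ltW r0) K'0 HK' h.
  rewrite (_ : k1 t + _ = f (z + zeta t *: b + s *: b') - f (z + zeta t *: b) -
    Df b' (z + zeta t *: b) * s) //.
  by rewrite /k1 /k0 /k2 addrAC /zeta; ring.
rewrite (_ : 2 * (K' * nrm b' * nrm s * nrm s) / p =
  (2 * (K' * nrm b') / p * nrm s) * nrm s); last by ring.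
rewrite ler_wpM2r ?nrm_ge0 //; move: se; rewrite ltr_pdivlMr // => /ltW.
apply: le_trans; rewrite mulrC ler_wpM2l ?nrm_ge0 //.
by rewrite /Q lerDl.
Qed.

End HolomorphicDerivative.

(** * Balls on which a differentiable function is Lipschitz *)

Section Frechet.
Variable R : realType.
Local Notation C := (CC R).

Lemma gt0_complex (e : C) : 0 < e -> exists2 d : R, 0 < d & e = d%:C.
Proof.
by case: e => a b; rewrite ltcE /= => /andP[/eqP -> a0]; exists a.
Qed.

Lemma nbhs_nrmP (V : normedModType C) (x : V) (P : set V) :
  nbhs x P <-> exists2 d : R, 0 < d & forall y, nrm (y - x) < d -> P y.
Proof.
split=> [/nbhs_ballP[e /= /gt0_complex[d d0 ->] H]|[d d0 H]].
  exists d => // y yd; apply: H; rewrite -ball_normE /ball_ /= distrC.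
  by rewrite nrmE ltcR.
apply/nbhs_ballP; exists d%:C => /=; first by rewrite ltcR.
move=> y; rewrite -ball_normE /ball_ /= distrC nrmE ltcR; exact: H.
Qed.

Lemma frechet_eps (V : normedModType C) (f : V -> C) z : differentiable f z ->
  forall e : R, 0 < e -> exists2 d : R, 0 < d &
  forall h, nrm h < d -> nrm (f (z + h) - f z - 'd f z h) <= e * nrm h.
Proof.
move=> df e e0; have e0' : 0 < e%:C :> C by rewrite ltcR.
have /eqaddoP /(_ _ e0') /nbhs_nrmP[d d0 H] := diff_locally df.
exists d => // h hd; have := H h; rewrite subr0 => /(_ hd).
rewrite /= -![(_ + _ : _ -> _) _]/(_ + _) -![(- _ : _ -> _) _]/(- _) /=.
rewrite [h + z]addrC -![(_ + _ : _ -> _) _]/(_ + _) /cst opprD addrA.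
by rewrite !nrmE -rmorphM /= lecR.
Qed.

Lemma frechet_cdiff (V : normedModType C) (f : V -> C) z b : differentiable f z ->
  cdiff (fun s => f (z + s *: b)) 0 ('d f z b).
Proof.
move=> df e e0; pose B := nrm b + 1; have B0 : 0 < B by rewrite ltr_wpDl // nrm_ge0.
have [d d0 H] := frechet_eps df (divr_gt0 e0 B0).
exists (d / B) => [|h]; first exact: divr_gt0.
rewrite ltr_pdivlMr // => hd; rewrite add0r scale0r addr0.
have hb : nrm (h *: b) <= nrm h * B by rewrite nrmZ ler_wpM2l ?nrm_ge0 // lerDl.
have dE : 'd f z (h *: b) = 'd f z b * h by rewrite linearZ /=; exact: mulrC.
have := H (h *: b) (le_lt_trans hb hd); rewrite dE.
move=> /le_trans; apply.
apply: (@le_trans _ _ (e / B * (nrm h * B))).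
  by rewrite ler_wpM2l // divr_ge0 // ltW.
by rewrite mulrCA divfK ?gt_eqF // mulrC.
Qed.

Lemma nrm_rV_ltP n (v : 'rV[C]_n) (e : R) : 0 < e ->
  (nrm v < e <-> forall j, nrm (v 0 j) < e).
Proof.
move=> e0; have ballE (w : C) : ball (0 : C) e%:C w <-> nrm w < e.
  by rewrite -ball_normE /ball_ /= sub0r normrN nrmE ltcR.
have ballEv : ball (0 : 'rV[C]_n) e%:C v <-> nrm v < e.
  by rewrite -ball_normE /ball_ /= sub0r normrN nrmE ltcR.
rewrite -ballEv; split=> [[_ H] j|H].
  by apply/ballE; have := H 0 j; rewrite mxE.
split; first by rewrite ltcR.
by move=> i j; rewrite mxE ord1; apply/ballE.
Qed.

Lemma nrm_coord n (v : 'rV[C]_n) j : nrm (v 0 j) <= nrm v.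
Proof.
apply/ler_addgt0Pr => e e0.
have h : 0 < nrm v + e by rewrite ltr_wpDl // nrm_ge0.
by apply/ltW; apply: ((nrm_rV_ltP v h).1 _ j); rewrite ltrDl.
Qed.

Lemma nrm_rV_le n (v : 'rV[C]_n) (e : R) : 0 <= e ->
  (forall j, nrm (v 0 j) <= e) -> nrm v <= e.
Proof.
move=> e0 H; apply/ler_addgt0Pr => d d0; apply/ltW/nrm_rV_ltP => [|j].
  by rewrite ltr_wpDl.
by apply: le_lt_trans (H j) _; rewrite ltrDl.
Qed.

Lemma diff_bound n (f : 'rV[C]_n -> C) z : differentiable f z ->
  exists2 L : R, 0 <= L & forall h, nrm ('d f z h) <= L * nrm h.
Proof.
move=> df; exists (\sum_(j < n) nrm ('d f z (delta_mx 0 j))) => [|h].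
  by apply: sumr_ge0 => j _; exact: nrm_ge0.
rewrite {1}[h]row_sum_delta linear_sum /= mulr_suml.
apply: (@le_trans _ _ (\sum_(j < n) nrm ('d f z (h 0 j *: delta_mx 0 j)))).
  elim/big_rec2 : _ => [|j y x _ yx]; first by rewrite nrm0.
  by apply: le_trans (ler_nrmD _ _) _; rewrite lerD2l.
apply: ler_sum => j _; rewrite linearZ /= nrmZ mulrC ler_wpM2l ?nrm_ge0 //.
exact: nrm_coord.
Qed.

End Frechet.

(* The spaces of matrices over R are complete normed modules; Baire and Banach
   are applied in them. *)
HB.instance Definition _ (R : realType) (m n : nat) := Complete.on 'M[R]_(m, n).

Section Baire.
Variable R : realType.
Local Notation C := (CC R).
Variable n : nat.

(* The identification of C^n with R^(2n), a complete normed space over R, to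
   which Baire's theorem applies. *)
Let theta (x : 'rV[R]_(n + n)) : 'rV[C]_n :=
  \row_j (x 0 (lshift n j) +i* x 0 (rshift n j)).

Let thetaI (z : 'rV[C]_n) : 'rV[R]_(n + n) :=
  row_mx (\row_j complex.Re (z 0 j)) (\row_j complex.Im (z 0 j)).

Let thetaK z : theta (thetaI z) = z.
Proof.
apply/rowP => j; rewrite mxE row_mxEl row_mxEr !mxE.
by apply: complex_ext.
Qed.

Let theta_lip x (d : R) : 0 < d -> exists2 e : R, 0 < e &
  forall y, ball x e y -> nrm (theta y - theta x) < d.
Proof.
move=> d0; exists (d / 2) => [|y [_ H]]; first by rewrite divr_gt0.
apply/nrm_rV_ltP => // j; apply: le_lt_trans (ler_nrm_ReIm _) _.
rewrite !mxE !cReImE /= [ltRHS]splitr; apply: ltrD; rewrite distrC.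
  exact: (H 0 (lshift n j)).
exact: (H 0 (rshift n j)).
Qed.

Let theta_ball x (e : R) : 0 < e -> forall z, nrm (z - theta x) < e ->
  ball x e (thetaI z).
Proof.
move=> e0 z ze; split=> // i k; rewrite ord1 -ball_normE /ball_ /= distrC.
have zj j : nrm (z 0 j - theta x 0 j) < e.
  by have := (nrm_rV_ltP (z - theta x) e0).1 ze j; rewrite !mxE.
rewrite -(fintype.splitK k); case: (fintype.split k) => j /=; apply: le_lt_trans (zj j).
  rewrite row_mxEl !mxE; apply: le_trans (ler_Re_nrm _).
  by rewrite cReD cReN.
rewrite row_mxEr !mxE; apply: le_trans (ler_Im_nrm _).
by rewrite cImD cImN.
Qed.

(** By Baire's theorem, an everywhere differentiable function is Lipschitz on
    some ball inside any nonempty open set. *)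
Lemma differentiable_lipschitz_ball (G : 'rV[C]_n -> C) (U : set 'rV[C]_n) :
  (forall z, differentiable G z) -> open U -> U !=set0 ->
  exists z0 r M, [/\ 0 < r, forall z, nrm (z - z0) < r -> U z &
    holo_lip G (fun b z => 'd G z b) z0 r M].
Proof.
move=> dG oU [u Uu].
have contG z (e : R) : 0 < e -> exists2 d : R, 0 < d &
    forall h, nrm h < d -> nrm (G (z + h) - G z) < e.
  move=> e0; have [L L0 HL] := diff_bound (dG z).
  have [d d0 H] := frechet_eps (dG z) (@ltr01 R).
  have L1 : 0 < L + 1 by rewrite ltr_wpDl.
  exists (Num.min d (e / (L + 1))) => [|h]; first by rewrite lt_min d0 divr_gt0.
  rewrite lt_min ltr_pdivlMr // => /andP[/H h1 h2]; apply: le_lt_trans h2.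
  rewrite -[G _ - _](subrK ('d G z h)); apply: le_trans (ler_nrmD _ _) _.
  rewrite (_ : nrm h * (L + 1) = 1 * nrm h + L * nrm h); last by ring.
  by apply: lerD.
pose W : set 'rV[R]_(n + n) := [set x | U (theta x)].
have oW : open W.
  rewrite openE => x Wx; have /nbhs_nrmP[d d0 Hd] : nbhs (theta x) U by exact: open_nbhs_nbhs.
  have [e e0 He] := theta_lip x d0.
  by apply/nbhs_ballP; exists e => //= y /He /Hd.
(* E k consists of the points at which the difference quotients with increment
   shorter than 1 / (k+1) are bounded by k+1. *)
pose E (k : nat) : set 'rV[R]_(n + n) := [set x | forall h, nrm h < k.+1%:R^-1 ->
  nrm (G (theta x + h) - G (theta x)) <= k.+1%:R * nrm h].
have oE k : open (~` E k).
  rewrite openE => x /existsNP[h /not_implyP[hk /negP]]; rewrite -ltNge => Hh.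
  pose gap := nrm (G (theta x + h) - G (theta x)) - k.+1%:R * nrm h.
  have gap0 : 0 < gap / 2 by rewrite divr_gt0 // subr_gt0.
  have [d1 d10 H1] := contG (theta x + h) _ gap0.
  have [d2 d20 H2] := contG (theta x) _ gap0.
  have d120 : 0 < Num.min d1 d2 by rewrite lt_min d10.
  have [e e0 He] := theta_lip x d120.
  apply/nbhs_ballP; exists e => //= y /He; rewrite lt_min => /andP[y1 y2] /(_ h hk).
  apply/negP; rewrite -ltNge -subr_gt0.
  have a1 := H2 _ y2; have a2 := H1 _ y1.
  rewrite [theta x + _]addrC subrK in a1.
  have e1 : theta x + h + (theta y - theta x) = theta y + h.
    by rewrite [theta x + h]addrC -addrA [theta x + _]addrC subrK addrC.
  rewrite e1 in a2.
  have := ler_nrm_dist (G (theta x + h)) (G (theta y + h)) (G (theta x)).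
  have := ler_nrm_dist (G (theta y + h)) (G (theta y)) (G (theta x)).
  by rewrite nrmC /gap in a2; rewrite /gap in a1 => T2 T1; lra.
have [k [S [oS [x Sx] SW SE]]] : exists k S, [/\ open S, S !=set0, S `<=` W & S `<=` E k].
  apply: contrapT => nO.
  pose F k := ~` E k `|` ~` closure W.
  have oF k : open (F k).
    by apply: openU => //; rewrite openC; exact: closed_closure.
  have dF k : dense (F k).
    move=> S [x Sx] oS; have [[y [Sy Wy]]|SW] := pselect (S `&` W !=set0).
      have oSW : open (S `&` W) by exact: openI.
      have /existsNP[y' /not_implyP[[Sy' Wy'] nE]] : ~ (S `&` W `<=` E k).
        move=> h; apply: nO; exists k, (S `&` W).
        split; [exact: oSW|by exists y|by move=> ? []|exact: h].
      by exists y'; split=> //; left.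
    exists x; split=> //; right => cWx; apply: SW.
    have /cWx[y [Wy Sy]] : nbhs x S by exact: open_nbhs_nbhs.
    by exists y.
  have [x [Wx Fx]] : W `&` \bigcap_k F k !=set0.
    have bF : dense (\bigcap_k F k) by apply: Baire => k; split.
    by apply: bF => //; exists (thetaI u); rewrite /W /= thetaK.
  have [L L0 HL] := diff_bound (dG (theta x)).
  have [d d0 H] := frechet_eps (dG (theta x)) (@ltr01 R).
  have [N NL] : exists N : nat, L + 1 <= N.+1%:R /\ N.+1%:R^-1 < d.
    pose m := Num.max (L + 1) (d^-1 + 1).
    have [N NP] : exists N : nat, m < N%:R.
      exists (Num.bound m); apply: archi_boundP.
      by rewrite le_max (addr_ge0 L0).
    have mN : m < N.+1%:R by apply: lt_trans NP _; rewrite ltr_nat.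
    exists N; move: mN; rewrite gt_max => /andP[/ltW -> h2]; split=> //.
    rewrite invf_plt ?posrE ?ltr0Sn //; apply: lt_trans h2.
    by rewrite ltrDl.
  case: (Fx N I) => [nE|]; last by apply; exact: subset_closure.
  apply: nE => h hN; case: NL => NL Nd.
  have hd : nrm h < d by exact: lt_trans hN Nd.
  have h1 := H h hd; rewrite -[G _ - _](subrK ('d G (theta x) h)).
  apply: le_trans (ler_nrmD _ _) _.
  apply: (@le_trans _ _ ((L + 1) * nrm h)); last by rewrite ler_wpM2r ?nrm_ge0.
  by rewrite mulrDl addrC; apply: lerD.
have /nbhs_ballP[e /= e0 He] : nbhs x S by exact: open_nbhs_nbhs.
pose r := Num.min e (k.+1%:R^-1 / 2).
have r0 : 0 < r by rewrite lt_min e0 divr_gt0.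
have inO z : nrm (z - theta x) < r -> S (thetaI z).
  rewrite lt_min => /andP[ze _]; apply: He; exact: theta_ball.
exists (theta x), r, k.+1%:R; split=> //.
- by move=> z /inO /SW; rewrite /W /= thetaK.
- split=> [z b _|z z' zr z'r]; first exact: frechet_cdiff.
  have := SE _ (inO _ z'r) (z - z'); rewrite /= thetaK [z' + _]addrC subrK; apply.
  apply: le_lt_trans (ler_nrm_dist z (theta x) z') _.
  rewrite (nrmC (theta x) z') [ltRHS]splitr.
  by move: zr z'r; rewrite !lt_min => /andP[_ h1] /andP[_ h2]; apply: ltrD.
Qed.

End Baire.

(** * The implicit function theorem *)

Section ComplexContraction.
Variable R : realType.
Local Notation C := (CC R).

Lemma normr_rV_le m (v : 'rV[R]_m) (e : R) : 0 <= e ->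
  (forall j, `|v 0 j| <= e) -> `|v| <= e.
Proof.
move=> e0 H; apply/ler_addgt0Pr => d d0; apply/ltW.
have ed : 0 < e + d by rewrite ltr_wpDl.
have : ball (0 : 'rV[R]_m) (e + d) v.
  split=> // i j; rewrite mxE ord1 -ball_normE /ball_ /= sub0r normrN.
  by apply: le_lt_trans (H j) _; rewrite ltrDl.
by rewrite -ball_normE /ball_ /= sub0r normrN.
Qed.

Lemma normr_coord m (v : 'rV[R]_m) j : `|v 0 j| <= `|v|.
Proof.
apply/ler_addgt0Pr => e e0; apply/ltW.
have : ball (0 : 'rV[R]_m) (`|v| + e) v.
  by rewrite -ball_normE /ball_ /= sub0r normrN ltrDl.
by case=> _ /(_ 0 j); rewrite mxE -ball_normE /ball_ /= sub0r normrN.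
Qed.

(** A function close to an invertible affine map vanishes somewhere: Newton's
    simplified iteration is a contraction of a square in the plane. *)
Lemma near_linear_zero (F : C -> C) (c0 : C) (r : R) : 0 < r -> c0 != 0 ->
  (forall t t', nrm t <= 2 * r -> nrm t' <= 2 * r ->
     nrm (F t - F t' - c0 * (t - t')) <= nrm c0 / 4 * nrm (t - t')) ->
  nrm (F 0) <= nrm c0 * r / 2 ->
  exists2 t, nrm t <= 2 * r & F t = 0.
Proof.
move=> r0 c00 HF HF0.
have nc0 : 0 < nrm c0.
  by rewrite lt_neqAle nrm_ge0 andbT eq_sym; apply: contraNneq c00 => /nrm_eq0 ->.
(* Banach in the plane with its maximum norm, which is within a factor 2 of the
   modulus; this is why the bounds hold on a disc of twice the radius. *)
pose q (x : 'rV[R]_2) : C := x 0 0 +i* x 0 1.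
pose T (t : C) := t - c0^-1 * F t.
pose S (x : 'rV[R]_2) : 'rV[R]_2 :=
  \row_j (if j == 0 then complex.Re (T (q x)) else complex.Im (T (q x))).
have qS x : q (S x) = T (q x) by rewrite /q !mxE /=; exact: complex_ext.
have qB x y : q (x - y) = q x - q y by apply: complex_ext; rewrite !cReImE /= !mxE.
have qle x : nrm (q x) <= 2 * `|x|.
  apply: le_trans (ler_nrm_ReIm _) _; rewrite mulr_natl mulr2n.
  by apply: lerD; exact: normr_coord.
have leq x : `|x| <= nrm (q x).
  apply: normr_rV_le => [|j]; first exact: nrm_ge0.
  have [->|j1] : j = 0 \/ j = 1.
  - by case: j => -[|[|//]] jl; [left|right]; exact: val_inj.
  - exact: (ler_Re_nrm (q x)).
  - by rewrite j1; exact: (ler_Im_nrm (q x)).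
have ci : c0^-1 * c0 = 1 by exact: mulVf.
have nci : nrm c0^-1 * nrm c0 = 1 by rewrite -nrmM ci (nrm_real 1) normr1.
have TB t t' : nrm t <= 2 * r -> nrm t' <= 2 * r -> nrm (T t - T t') <= 4^-1 * nrm (t - t').
  move=> ht ht'; have -> : T t - T t' = - c0^-1 * (F t - F t' - c0 * (t - t')).
    rewrite /T mulrBr !mulNr opprK [c0^-1 * (c0 * _)]mulrA ci mul1r; ring.
  rewrite nrmM nrmN; apply: le_trans (ler_wpM2l (nrm_ge0 _) (HF _ _ ht ht')) _.
  by rewrite !mulrA nci mul1r.
pose U : set 'rV[R]_2 := [set x | `|x| <= r].
have Uq x : U x -> nrm (q x) <= 2 * r.
  by move=> Ux; apply: le_trans (qle x) _; rewrite ler_pM2l.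
have q0 : q 0 = 0 by apply: complex_ext; rewrite /= mxE.
have SU : set_fun U U S.
  move=> x /Uq Ux; apply: le_trans (leq _) _; rewrite qS.
  have := ler_nrm_dist (T (q x)) (T 0) 0.
  have n0 : nrm (0 : C) <= 2 * r by rewrite nrm0 mulr_ge0 // ltW.
  have := TB _ _ Ux n0; rewrite !subr0 /T sub0r nrmN nrmM.
  have : nrm c0^-1 * nrm (F 0) <= r / 2.
    apply: le_trans (ler_wpM2l (nrm_ge0 _) HF0) _.
    by rewrite !mulrA nci mul1r.
  move=> h1 h2 h3; lra.
pose sf : {fun U >-> U} := HB.pack S (isFun.Build _ _ U U S SU).
have [|||x Ux xE] := @banach_fixed_point R _ U sf.
- exists (2^-1)%:nng; split=> /=; first by rewrite invf_lt1 ?ltr1n.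
  move=> [x y] [/= Ux Uy]; apply: le_trans (leq _) _; rewrite qB !qS.
  apply: le_trans (TB _ _ (Uq _ Ux) (Uq _ Uy)) _; rewrite -qB.
  by have := qle (x - y); move=> h; lra.
- have -> : U = Num.norm @^-1` [set y | y <= r] by [].
  apply: preimage_closed; last exact: closed_le.
  by move=> x _; exact: norm_continuous.
- by exists 0; rewrite /U /= normr0 ltW.
exists (q x); first exact: Uq.
have : q x = T (q x) by rewrite -qS {1}xE.
rewrite /T => /eqP; rewrite -subr_eq0 opprB addrC subrK mulf_eq0 invr_eq0 (negbTE c00).
by move/eqP.
Qed.

End ComplexContraction.

Section LevelSetGraph.
Variable R : realType.
Local Notation C := (CC R).
Variables (n : nat) (p : 'I_n).

(** The embedding of C^(n-1) onto the coordinate hyperplane x_p = 0. *)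
Definition hyper_mx : 'M[C]_(n.-1, n) := \matrix_(k, j) (j == lift p k)%:R.

Lemma hyper_mx_lift (x : 'rV[C]_n.-1) k : (x *m hyper_mx) 0 (lift p k) = x 0 k.
Proof.
rewrite mxE (bigD1 k) //= mxE eqxx mulr1 big1 ?addr0 // => i ik.
by rewrite mxE (inj_eq lift_inj) eq_sym (negbTE ik) mulr0.
Qed.

Lemma hyper_mx_p (x : 'rV[C]_n.-1) : (x *m hyper_mx) 0 p = 0.
Proof. by rewrite mxE big1 // => i _; rewrite mxE (negbTE (neq_lift _ _)) mulr0. Qed.

Lemma nrm_hyper (x : 'rV[C]_n.-1) : nrm (x *m hyper_mx) <= nrm x.
Proof.
apply: nrm_rV_le => [|j]; first exact: nrm_ge0.
case: (unliftP p j) => [k ->|->]; first by rewrite hyper_mx_lift nrm_coord.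
by rewrite hyper_mx_p nrm0 nrm_ge0.
Qed.

Lemma hyper_mx_tr (x : 'rV[C]_n.-1) (t : C) :
  (x *m hyper_mx + t *: delta_mx 0 p) *m hyper_mx^T = x.
Proof.
apply/rowP => k; rewrite mxE (bigD1 (lift p k)) //= big1 => [|j jk].
  rewrite addr0 mxE hyper_mx_lift !mxE eqxx [lift p k == p]eq_sym (negbTE (neq_lift _ _)) /=.
  by rewrite eqxx mulr0 addr0 mulr1.
by rewrite [X in _ * X]mxE [X in _ * X]mxE (negbTE jk) mulr0.
Qed.

Lemma nrm_hyper_tr (x : 'rV[C]_n) : nrm (x *m hyper_mx^T) <= nrm x.
Proof.
apply: nrm_rV_le => [|k]; first exact: nrm_ge0.
rewrite mxE (bigD1 (lift p k)) //= big1 => [|j jk].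
  by rewrite addr0 !mxE eqxx mulr1 nrm_coord.
by rewrite !mxE (negbTE jk) mulr0.
Qed.

Lemma nrm_delta_le (t : C) : nrm (t *: delta_mx 0 p : 'rV[C]_n) <= nrm t.
Proof.
apply: nrm_rV_le => [|j]; first exact: nrm_ge0.
rewrite !mxE eqxx /= nrmM; case: eqP => _; last by rewrite nrm0 mulr0 nrm_ge0.
by rewrite (nrm_real 1) normr1 mulr1.
Qed.

Variables (G : 'rV[C]_n -> C) (z0 : 'rV[C]_n) (r M : R).
Hypothesis dG : forall z, differentiable G z.
Hypothesis r0 : 0 < r.
Hypothesis hG : holo_lip G (fun b z => 'd G z b) z0 r M.
Let ep : 'rV[C]_n := delta_mx 0 p.
Let c0 : C := 'd G z0 ep.
Hypothesis c00 : c0 != 0.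

Let pt (x : 'rV[C]_n.-1) (t : C) : 'rV[C]_n := z0 + (x *m hyper_mx + t *: ep).

Let nc0 : 0 < nrm c0.
Proof. by rewrite lt_neqAle nrm_ge0 andbT eq_sym; apply: contraNneq c00 => /nrm_eq0 ->. Qed.

Let pt_near x t : nrm (pt x t - z0) <= nrm x + nrm t.
Proof.
rewrite /pt addrC addKr; apply: le_trans (ler_nrmD _ _) _.
by apply: lerD; [exact: nrm_hyper|exact: nrm_delta_le].
Qed.

Let ptB x t x' t' : pt x t - pt x' t' = (x - x') *m hyper_mx + (t - t') *: ep.
Proof. by rewrite /pt mulmxBl scalerBl opprD addrACA subrr add0r opprD addrACA. Qed.

Let M_ge0 : 0 <= `|M| := normr_ge0 M.

Let GLip z z' : nrm (z - z0) < r -> nrm (z' - z0) < r ->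
  nrm (G z - G z') <= `|M| * nrm (z - z').
Proof.
move=> zr zr'; apply: le_trans (hG.2 _ _ zr zr') _.
by rewrite ler_wpM2r ?nrm_ge0 // ler_norm.
Qed.

(** Near z0 the level set of G is the graph of a Lipschitz function g, with the
    derivatives given by implicit differentiation. *)
Lemma level_set_graph : exists (g : 'rV[C]_n.-1 -> C) (d K : R),
  let phi x := z0 + (x *m hyper_mx + g x *: ep) in
  let Dg b x := - ('d G (phi x) (b *m hyper_mx) / 'd G (phi x) ep) in
  [/\ 0 < d, g 0 = 0,
    forall x, nrm x < d -> nrm (phi x - z0) < r /\ G (phi x) = G z0,
    forall x, nrm x < d -> forall e : R, 0 < e -> exists2 d' : R, 0 < d' &
      forall h, nrm h < d' -> nrm (g (x + h) - g x - Dg h x) <= e * nrm h &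
    holo_lip g Dg 0 d K].
Proof.
have [K1 K10 HK1] := holo_D_lip ep r0 hG.
pose s := Num.min (r / 16) (nrm c0 / (16 * (K1 + 1))).
have K1p : 0 < K1 + 1 by rewrite ltr_wpDl.
have s0 : 0 < s by rewrite lt_min !divr_gt0 // mulr_gt0.
have sr : s <= r / 16 by rewrite ge_min lexx.
have sK : K1 * (4 * s) <= nrm c0 / 4.
  have : s <= nrm c0 / (16 * (K1 + 1)) by rewrite ge_min lexx orbT.
  rewrite ler_pdivlMr ?mulr_gt0 // => h; have : 0 <= s * K1 by rewrite mulr_ge0 // ltW.
  by move=> h'; lra.
pose d := Num.min s (nrm c0 * s / (2 * (`|M| + 1))).
have Mp : 0 < `|M| + 1 by rewrite ltr_wpDl.
have d0 : 0 < d by rewrite lt_min s0 divr_gt0 // mulr_gt0.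
have ds : d <= s by rewrite ge_min lexx.
have dM (x : 'rV[C]_n.-1) : nrm x < d -> `|M| * nrm x <= nrm c0 * s / 2.
  move=> xd; have : nrm x < nrm c0 * s / (2 * (`|M| + 1)).
    by apply: lt_le_trans xd _; rewrite ge_min lexx orbT.
  rewrite ltr_pdivlMr ?mulr_gt0 // => h; have := nrm_ge0 x.
  by move=> h'; lra.
have pt_s x t : nrm x < s -> nrm t <= 2 * s -> nrm (pt x t - z0) < r / 4.
  by move=> h1 h2; have h3 := pt_near x t; lra.
have Dnear x t : nrm x < s -> nrm t <= 2 * s -> nrm ('d G (pt x t) ep - c0) <= nrm c0 / 4.
  move=> h1 h2; have h3 := pt_s _ _ h1 h2; have z0r : nrm (z0 - z0) < r / 2.
    by rewrite subrr nrm0 divr_gt0.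
  apply: le_trans (HK1 _ _ _ z0r) _; first by apply: lt_le_trans h3 _; lra.
  apply: le_trans sK; rewrite ler_wpM2l //; have := pt_near x t; lra.
have key x t t' : nrm x < s -> nrm t <= 2 * s -> nrm t' <= 2 * s ->
    nrm (G (pt x t) - G (pt x t') - c0 * (t - t')) <= nrm c0 / 4 * nrm (t - t').
  move=> xs ts ts'.
  pose H (w : C) := G (pt x t' + w *: ep).
  have ptE w : pt x t' + w *: ep = pt x (t' + w) by rewrite /pt scalerDl !addrA.
  have tau (u : R) : 0 <= u <= 1 -> nrm (t' + u%:C * (t - t')) <= 2 * s.
    move=> /andP[u0 u1]; have -> : t' + u%:C * (t - t') = (1 - u)%:C * t' + u%:C * t.
      by rewrite rmorphB /= rmorph1; ring.
    apply: le_trans (ler_nrmD _ _) _; rewrite !nrmM !nrm_real ger0_norm ?subr_ge0 // ger0_norm //.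
    have h1 : (1 - u) * nrm t' <= (1 - u) * (2 * s) by rewrite ler_wpM2l // subr_ge0.
    have h2 : u * nrm t <= u * (2 * s) by rewrite ler_wpM2l.
    by apply: le_trans (lerD h1 h2) _; rewrite -mulrDl subrK mul1r.
  have := @complex_MVT R H (fun w => 'd G (pt x t' + w *: ep) ep) c0 (t - t') (nrm c0 / 4).
  rewrite /H scale0r addr0 ptE [t' + _]addrC subrK; apply=> u u01.
    apply: (holo_line hG); rewrite ptE; apply: lt_trans (pt_s _ _ xs (tau _ u01)) _.
    by move: r0; lra.
  by rewrite ptE; apply: Dnear (tau _ u01).
have sol x : exists t, nrm x < d -> nrm t <= 2 * s /\ G (pt x t) = G z0.
  have [xd|] := boolP (nrm x < d); last by exists 0.
  have xs : nrm x < s by exact: lt_le_trans xd ds.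
  have [||t t1 t2] := @near_linear_zero R (fun t => G (pt x t) - G z0) c0 s s0 c00.
  - move=> t t' h1 h2; have := key _ _ _ xs h1 h2.
    by rewrite (_ : G (pt x t) - G z0 - (G (pt x t') - G z0) = G (pt x t) - G (pt x t')) //; ring.
  - apply: le_trans (dM _ xd).
    have h0 : nrm (0 : C) <= 2 * s by rewrite nrm0 mulr_ge0 // ltW.
    apply: le_trans (GLip _ _) _.
    + by apply: lt_trans (pt_s _ _ xs h0) _; move: r0; lra.
    + by rewrite subrr nrm0.
    rewrite ler_wpM2l //; apply: le_trans (pt_near x 0) _.
    by rewrite nrm0 addr0.
  - by exists t => _; split=> //; apply/eqP; rewrite -subr_eq0; apply/eqP.
have [g Hg] := choice sol.
pose K := 2 * `|M| / nrm c0.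
have K0 : 0 <= K by rewrite divr_ge0 ?mulr_ge0 ?nrm_ge0.
(* The derivative in the p-th direction stays close to c0, so that the solution
   is unique, and depends on x in a Lipschitz way. *)
have uniq x t t' : nrm x < s -> nrm t <= 2 * s -> nrm t' <= 2 * s ->
    nrm (t - t') <= 2 / nrm c0 * nrm (G (pt x t) - G (pt x t')).
  move=> h1 h2 h3; have := key _ _ _ h1 h2 h3.
  have := ler_nrm_dist (c0 * (t - t')) (G (pt x t) - G (pt x t')) 0.
  rewrite !subr0 nrmM (nrmC (c0 * _)) => h4 h5.
  rewrite mulrAC ler_pdivlMr // mulrC.
  have : 0 <= nrm c0 * nrm (t - t') by rewrite mulr_ge0 // nrm_ge0.
  lra.
have gLip x x' : nrm x < d -> nrm x' < d -> nrm (g x - g x') <= K * nrm (x - x').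
  move=> xd xd'; have xs := lt_le_trans xd ds; have xs' := lt_le_trans xd' ds.
  have [g1 g2] := Hg x xd; have [g1' g2'] := Hg x' xd'.
  apply: le_trans (uniq _ _ _ xs g1 g1') _; rewrite g2 -g2'.
  rewrite /K -mulrA [_ / _]mulrC mulrA [2 / nrm c0]mulrC -!mulrA ler_wpM2l ?invr_ge0 ?nrm_ge0 //.
  rewrite ler_wpM2l //.
  apply: le_trans (GLip _ _) _.
  + by apply: lt_trans (pt_s _ _ xs' g1') _; move: r0; lra.
  + by apply: lt_trans (pt_s _ _ xs g1') _; move: r0; lra.
  rewrite ler_wpM2l // ptB subrr scale0r addr0 (nrmC x).
  exact: nrm_hyper.
exists g, d, K => phi Dg.
have phiE x : phi x = pt x (g x) by [].
have frech x : nrm x < d -> forall e : R, 0 < e -> exists2 d' : R, 0 < d' &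
      forall h, nrm h < d' -> nrm (g (x + h) - g x - Dg h x) <= e * nrm h.
  move=> xd e e0; have [g1 g2] := Hg x xd; have xs := lt_le_trans xd ds.
  have [b bE] : exists b : C, 'd G (phi x) ep = b by eexists.
  have b0 : 0 < nrm b.
    have := Dnear _ _ xs g1; rewrite -phiE bE.
    have := ler_nrm_dist c0 b 0; rewrite (subr0 c0) (subr0 b) (nrmC c0) => h1 h2.
    by move: nc0; lra.
  have bn0 : b != 0 by apply: contraTneq b0 => ->; rewrite nrm0 ltxx.
  have KK : 0 < 1 + K by rewrite ltr_pwDl.
  have e'0 : 0 < e * nrm b / (1 + K) by rewrite divr_gt0 ?mulr_gt0.
  have [d1 d10 H1] := frechet_eps (dG (phi x)) e'0.
  exists (Num.min (d - nrm x) (d1 / (1 + K))) => [|h].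
    by rewrite lt_min subr_gt0 xd divr_gt0.
  rewrite lt_min ltr_pdivlMr // => /andP[h1 h2].
  have xhd : nrm (x + h) < d by have := ler_nrmD x h; lra.
  have [g1' g2'] := Hg (x + h) xhd.
  pose D := g (x + h) - g x.
  have DE : phi x + (h *m hyper_mx + D *: ep) = pt (x + h) (g (x + h)).
    rewrite {1}phiE -(subrK (pt x (g x)) (pt _ (g (x + h)))) ptB addrC.
    by rewrite (_ : x + h - x = h) // [x + h]addrC addrK.
  have Dle : nrm (h *m hyper_mx + D *: ep) <= nrm h * (1 + K).
    rewrite mulrDr mulr1; apply: le_trans (ler_nrmD _ _) _; apply: lerD.
      exact: nrm_hyper.
    apply: le_trans (nrm_delta_le _) _; rewrite mulrC.
    by have := gLip _ _ xhd xd; rewrite [x + h]addrC addrK [h + x]addrC.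
  have := H1 _ (le_lt_trans Dle h2); rewrite DE g2' phiE g2 subrr sub0r nrmN -phiE => h3.
  have dGD : 'd G (phi x) (h *m hyper_mx + D *: ep) = 'd G (phi x) (h *m hyper_mx) + D * b.
    by rewrite linearD linearZ bE.
  have h4 : nrm ('d G (phi x) (h *m hyper_mx) + D * b) <= e * nrm b * nrm h.
    rewrite -dGD; apply: le_trans h3 _.
    apply: le_trans (ler_wpM2l (ltW e'0) Dle) _.
    by rewrite [nrm h * _]mulrC mulrA divfK // gt_eqF.
  rewrite -/D /Dg bE opprK (_ : D + _ = ('d G (phi x) (h *m hyper_mx) + D * b) / b); last first.
    by rewrite mulrDl mulfK // addrC.
  rewrite nrmM; have bi : nrm b * nrm b^-1 = 1 by rewrite -nrmM divff // (nrm_real 1) normr1.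
  apply: le_trans (ler_wpM2r (nrm_ge0 _) h4) _.
  by rewrite -[e * _ * _]mulrA mulrCA mulrC !mulrA -[nrm b^-1 * _]mulrC bi mul1r mulrC.
split=> //.
- have n0 : nrm (0 : 'rV[C]_n.-1) < d by rewrite nrm0.
  have [g1 g2] := Hg 0 n0; have h0 : nrm (0 : C) <= 2 * s by rewrite nrm0 mulr_ge0 // ltW.
  have := uniq _ _ _ (lt_le_trans n0 ds) g1 h0.
  rewrite g2 /pt mul0mx scale0r !addr0 subrr nrm0 mulr0 subr0 => h.
  by apply: nrm_eq0; apply/eqP; rewrite eq_le h nrm_ge0.
- move=> x xd; have [g1 g2] := Hg x xd; split=> //.
  by apply: lt_trans (pt_s _ _ (lt_le_trans xd ds) g1) _; move: r0; lra.
split=> [x b|x x']; rewrite !subr0; last exact: gLip.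
move=> xd e e0; have B0 : 0 < nrm b + 1 by rewrite ltr_wpDl // nrm_ge0.
have [d1 d10 H1] := frech x xd _ (divr_gt0 e0 B0).
exists (d1 / (nrm b + 1)) => [|h]; first exact: divr_gt0.
rewrite ltr_pdivlMr // => hd; rewrite add0r scale0r addr0.
have hb : nrm (h *: b) <= nrm h * (nrm b + 1) by rewrite nrmZ ler_wpM2l ?nrm_ge0 // lerDl.
have DE : Dg (h *: b) x = Dg b x * h.
  have dGZ : 'd G (phi x) (h *: (b *m hyper_mx)) = h * 'd G (phi x) (b *m hyper_mx).
    by rewrite linearZ.
  by rewrite /Dg -scalemxAl dGZ -mulrA mulNr [X in _ = - X]mulrC.
have := H1 (h *: b) (le_lt_trans hb hd); rewrite DE.
move=> /le_trans; apply; apply: (@le_trans _ _ (e / (nrm b + 1) * (nrm h * (nrm b + 1)))).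
  by rewrite ler_wpM2l // divr_ge0 // ltW.
by rewrite mulrCA divfK ?gt_eqF // mulrC.
Qed.

End LevelSetGraph.

(** * Charts of level sets *)

Section Parametrization.
Variable R : realType.
Local Notation C := (CC R).

Lemma linear_lip_continuous (V W : normedModType C) (L : {linear V -> W}) (B : R) :
  (forall h, nrm (L h) <= B * nrm h) -> continuous L.
Proof.
move=> HB; apply: bounded_linear_continuous; apply/ex_bound.
exists (`|B|%:C); apply/nbhs_nrmP; exists 1 => // h; rewrite subr0 => h1 /=.
rewrite nrmE lecR; apply: le_trans (HB h) _; apply: le_trans (ler_norm _) _.
by rewrite normrM ler_piMr // ger0_norm ?nrm_ge0 // ltW.
Qed.

Lemma frechet_differentiable (V : normedModType C) (f : V -> C) x
    (L : {linear V -> C}) (B : R) :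
  (forall h, nrm (L h) <= B * nrm h) ->
  (forall e : R, 0 < e -> exists2 d : R, 0 < d &
    forall h, nrm h < d -> nrm (f (x + h) - f x - L h) <= e * nrm h) ->
  differentiable f x.
Proof.
move=> HB Hf; have cL := linear_lip_continuous HB.
have fE : f \o shift x = cst (f x) + L +o_ 0 id.
  apply/eqaddoP => e /gt0_complex[e' e'0 ->]; have [d d0 H] := Hf e' e'0.
  apply/nbhs_nrmP; exists d => // h; rewrite subr0 => /H {}H.
  rewrite /= -![(_ + _ : _ -> _) _]/(_ + _) -![(- _ : _ -> _) _]/(- _) /=.
  rewrite [h + x]addrC -![(_ + _ : _ -> _) _]/(_ + _) /cst opprD addrA.
  by rewrite !nrmE -rmorphM /= lecR.
by apply/diff_locallyP; rewrite (diff_unique cL fE).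
Qed.

Variables (n : nat) (p : 'I_n).
Variables (G : 'rV[C]_n -> C) (z0 : 'rV[C]_n) (r M : R).
Hypothesis dG : forall z, differentiable G z.
Hypothesis r0 : 0 < r.
Hypothesis hG : holo_lip G (fun b z => 'd G z b) z0 r M.
Hypothesis c00 : 'd G z0 (delta_mx 0 p) != 0.
Variable U : set 'rV[C]_n.
Hypothesis ballU : forall z, nrm (z - z0) < r -> U z.

(** The holomorphic implicit function theorem, in the form of a chart of the
    level set of G through z0, the graph of a function of the coordinates other
    than the p-th. *)
Lemma level_set_chart : exists (g : 'rV[C]_n.-1 -> C) (d K : R),
  let phi x := z0 + (x *m hyper_mx R p + g x *: delta_mx 0 p) in
  let Dg b x := - ('d G (phi x) (b *m hyper_mx R p) / 'd G (phi x) (delta_mx 0 p)) in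
  [/\ 0 < d, g 0 = 0, holo_lip g Dg 0 d K &
    level_set_parametrization U G (G z0) [set x | nrm x < d] phi].
Proof.
have [g [d [K [d0 g0 gG Hg hg]]]] := level_set_graph dG r0 hG c00.
set A := hyper_mx R p in gG Hg hg *; set e : 'rV[C]_n := delta_mx 0 p in gG Hg hg *.
exists g, d, K => phi Dg; split; [exact: d0|exact: g0|exact: hg|].
have dgx x : nrm x < d -> differentiable g x.
  move=> xd; have [L0 L00 HL0] := diff_bound (dG (phi x)).
  have Llin : linear (fun h => Dg h x : C).
    move=> a h h'; rewrite /Dg mulmxDl -scalemxAl.
    have -> : 'd G (phi x) (a *: (h *m A) + h' *m A) =
              a * 'd G (phi x) (h *m A) + 'd G (phi x) (h' *m A).
      by rewrite linearD linearZ.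
    rewrite -[a *: _]/(a * _); ring.
  pose L : {linear 'rV[C]_n.-1 -> C} :=
    HB.pack (fun h => Dg h x : C) (GRing.isLinear.Build _ _ _ _ _ Llin).
  apply: (@frechet_differentiable _ g x L (L0 * nrm ('d G (phi x) e)^-1)) (Hg x xd).
  move=> h; rewrite /= /Dg nrmN nrmM mulrAC ler_wpM2r ?nrm_ge0 //.
  apply: le_trans (HL0 _) _; rewrite ler_wpM2l //; exact: nrm_hyper.
pose mA : {linear 'rV[C]_n.-1 -> 'rV[C]_n} := mulmxr A.
pose mT : {linear 'rV[C]_n -> 'rV[C]_n.-1} := mulmxr A^T.
have cA : continuous mA.
  by apply: (@linear_lip_continuous _ _ _ 1) => h; rewrite mul1r; exact: nrm_hyper.
have cT : continuous mT.
  by apply: (@linear_lip_continuous _ _ _ 1) => h; rewrite mul1r; exact: nrm_hyper_tr.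
have dphi x : nrm x < d -> differentiable phi x.
  move=> xd; have -> : phi = cst z0 + ((mA : _ -> _) + (fun x => g x *: e)) by [].
  apply: differentiableD; first exact: differentiable_cst.
  apply: differentiableD; first exact: linear_differentiable.
  by apply: differentiableZl; exact: dgx.
have mTphi : mT \o phi = cst (mT z0) + id.
  apply/funext => x; rewrite /= /phi mulmxDl hyper_mx_tr.
  by [].
split.
- rewrite openE => x xd; apply/nbhs_nrmP; exists (d - nrm x); first by rewrite subr_gt0.
  by move=> y yd /=; have := ler_nrmD (y - x) x; rewrite subrK => h; move: yd; lra.
- move=> x xd; split; first exact: dphi.
  apply: (can_inj (g := mT)) => h.
  have dT : differentiable mT (phi x) by exact: linear_differentiable.
  have : 'd (mT \o phi) x h = mT ('d phi x h).
    by rewrite (diff_comp (dphi x xd) dT) /= (diff_lin _ cT).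
  move=> <-; rewrite mTphi.
  have idc : continuous (idfun : {linear 'rV[C]_n.-1 -> 'rV[C]_n.-1}) by move=> y.
  have dI : differentiable (idfun : 'rV[C]_n.-1 -> 'rV[C]_n.-1) x.
    exact: linear_differentiable.
  rewrite (diffD (differentiable_cst (mT z0) x) dI).
  pose W := 'rV[C]_n.-1; transitivity (0 + h); last exact: add0r.
  apply: (f_equal2 (fun u v : W => u + v)).
    exact: (congr1 (fun F : W -> W => F h) (diff_cst (mT z0) x)).
  exact: (congr1 (fun F : W -> W => F h) (diff_lin x idc)).
- move=> x y _ _ xy; have : (mT \o phi) x = (mT \o phi) y by rewrite /= xy.
  by rewrite mTphi => /addrI.
- by move=> x /gG[/ballU].
Qed.

End Parametrization.

(** * Double power sums *)

Section DoublePowerSums.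
Variable R : realType.
Local Notation C := (CC R).
Implicit Types (s t : C) (k c : nat -> nat -> C).

Lemma nrm_conjc s : nrm (conjc s) = nrm s.
Proof. by rewrite /nrm !normc_def /= ; case: s => a b /=; rewrite sqrrN. Qed.

Lemma nrmX s m : nrm (s ^+ m) = nrm s ^+ m.
Proof. by elim: m => [|m IH]; rewrite ?expr0 ?(nrm_real 1) ?normr1 // !exprS nrmM IH. Qed.

(** The double power sum with coefficients k. *)
Definition dsum N k s t : C := \sum_(i < N.+2) \sum_(j < N.+2) k i j * s ^+ i * t ^+ j.

Lemma dsum_low N k c : (forall i j, (1 < i)%N || (1 < j)%N -> c i j = 0) ->
  \sum_(i < N.+2) \sum_(j < N.+2) k i j * c i j =
    k 0%N 0%N * c 0%N 0%N + k 0%N 1%N * c 0%N 1%N +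
    (k 1%N 0%N * c 1%N 0%N + k 1%N 1%N * c 1%N 1%N).
Proof.
move=> c0; have row (i : nat) : \sum_(j < N.+2) k i j * c i j =
    k i 0%N * c i 0%N + k i 1%N * c i 1%N.
  rewrite !big_ord_recl /= addrA big1 ?addr0 // => j _.
  by rewrite c0 ?mulr0 // orbT.
rewrite (eq_bigr (fun i : 'I_N.+2 => k i 0%N * c i 0%N + k i 1%N * c i 1%N)); last first.
  by move=> i _; exact: row.
rewrite !big_ord_recl /= addrA big1 ?addr0 // => i _.
by rewrite !c0 ?mulr0 ?addr0.
Qed.

(** The sum of the moduli of the coefficients. *)
Definition dsum_norm N k : R := \sum_(i < N.+2) \sum_(j < N.+2) nrm (k i j).

Lemma dsum_norm_ge0 N k : 0 <= dsum_norm N k.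
Proof. by apply: sumr_ge0 => i _; apply: sumr_ge0 => j _; exact: nrm_ge0. Qed.

Lemma ler_nrm_sum m (F : 'I_m -> C) : nrm (\sum_i F i) <= \sum_i nrm (F i).
Proof.
elim/big_rec2 : _ => [|i y x _ yx]; first by rewrite nrm0.
by apply: le_trans (ler_nrmD _ _) _; rewrite lerD2l.
Qed.

Lemma dsum_le N k c (B : R) : (forall i j, nrm (c i j) <= B) ->
  nrm (\sum_(i < N.+2) \sum_(j < N.+2) k i j * c i j) <= dsum_norm N k * B.
Proof.
move=> cB; apply: le_trans (ler_nrm_sum _) _; rewrite mulr_suml; apply: ler_sum => i _.
apply: le_trans (ler_nrm_sum _) _; rewrite mulr_suml; apply: ler_sum => j _.
by rewrite nrmM ler_wpM2l ?nrm_ge0.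
Qed.

Lemma dsum_diff N k c c' : \sum_(i < N.+2) \sum_(j < N.+2) k i j * c i j -
    \sum_(i < N.+2) \sum_(j < N.+2) k i j * c' i j =
  \sum_(i < N.+2) \sum_(j < N.+2) k i j * (c i j - c' i j).
Proof.
rewrite -sumrB; apply: eq_bigr => i _; rewrite -sumrB; apply: eq_bigr => j _.
by rewrite mulrBr.
Qed.

Lemma dsum_add N k c c' : \sum_(i < N.+2) \sum_(j < N.+2) k i j * c i j +
    \sum_(i < N.+2) \sum_(j < N.+2) k i j * c' i j =
  \sum_(i < N.+2) \sum_(j < N.+2) k i j * (c i j + c' i j).
Proof.
rewrite [RHS](eq_bigr (fun i : 'I_N.+2 => \sum_(j < N.+2) k i j * c i j +
   \sum_(j < N.+2) k i j * c' i j)); first by rewrite big_split.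
move=> i _; rewrite [LHS](eq_bigr (fun j : 'I_N.+2 => k i j * c i j + k i j * c' i j)).
  by rewrite big_split.
by move=> j _; rewrite mulrDr.
Qed.

Lemma dsumE N k s t :
  dsum N k s t = \sum_(i < N.+2) \sum_(j < N.+2) k i j * (s ^+ i * t ^+ j).
Proof. by apply: eq_bigr => i _; apply: eq_bigr => j _; rewrite mulrA. Qed.

Lemma dsum_first_order N k s : nrm s <= 1 ->
  nrm (dsum N k s (conjc s) - (k 0%N 0%N + k 1%N 0%N * s + k 0%N 1%N * conjc s)) <=
    dsum_norm N k * nrm s ^+ 2.
Proof.
move=> s1; pose c i j : C := if (i + j < 2)%N then s ^+ i * conjc s ^+ j else 0.
have -> : k 0%N 0%N + k 1%N 0%N * s + k 0%N 1%N * conjc s =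
    \sum_(i < N.+2) \sum_(j < N.+2) k i j * c i j.
  rewrite dsum_low => [|i j]; last first.
    rewrite /c; case: (ltnP (i + j)) => // ij /orP[h|h]; exfalso.
      by have := leq_trans h (leq_addr j i); rewrite leqNgt ij.
    by have := leq_trans h (leq_addl i j); rewrite leqNgt ij.
  by rewrite /c /= !expr0 !expr1 !mulr1 mul1r mulr0 addr0 addrAC.
pose T i j : C := s ^+ i * conjc s ^+ j.
rewrite dsumE (dsum_diff N k T c).
apply: (@dsum_le N k (fun i j => T i j - c i j)) => i j; rewrite /c /T.
case: ltnP => ij; first by rewrite subrr nrm0 exprn_ge0 ?nrm_ge0.
rewrite subr0 nrmM !nrmX nrm_conjc -exprD.
by apply: ler_wiXn2l => //; exact: nrm_ge0.
Qed.

Lemma nrm_four (a b c d : C) : nrm a = 1 -> nrm b = 1 -> nrm c = 1 -> nrm d = 1 ->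
  nrm (a + b + (c + d)) <= 4.
Proof.
move=> a1 b1 c1 d1; have h1 := ler_nrmD (a + b) (c + d).
have h2 := ler_nrmD a b; have h3 := ler_nrmD c d.
move: h2 h3; rewrite a1 b1 c1 d1 => h2 h3; apply: le_trans h1 _.
by apply: le_trans (lerD h2 h3) _; rewrite (_ : 1 + 1 + (1 + 1) = 4) //; ring.
Qed.

(** The sum of f over the four points of modulus r on the axes. *)
Definition four_sum (f : C -> C) (r : R) : C :=
  f r%:C + f ('i * r%:C) + (f (- r%:C) + f (- ('i * r%:C))).

(** Summation over the four points isolates the coefficient k_11, to order three. *)
Lemma dsum_four N k (r : R) : 0 <= r <= 1 ->
  nrm (four_sum (fun s => dsum N k s (conjc s)) r -
     (4 * k 0%N 0%N + 4 * k 1%N 1%N * (r ^+ 2)%:C)) <= 4 * dsum_norm N k * r ^+ 3.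
Proof.
move=> /andP[r0 r1]; pose T i j : C := four_sum (fun s => s ^+ i * conjc s ^+ j) r.
have E : four_sum (fun s => dsum N k s (conjc s)) r =
    \sum_(i < N.+2) \sum_(j < N.+2) k i j * T i j.
  rewrite /four_sum !dsumE /T.
  pose P u i j : C := u ^+ i * conjc u ^+ j.
  transitivity (\sum_(i < N.+2) \sum_(j < N.+2) k i j * (P r%:C i j + P ('i * r%:C) i j) +
    \sum_(i < N.+2) \sum_(j < N.+2) k i j * (P (- r%:C) i j + P (- ('i * r%:C)) i j)).
    congr (_ + _); first exact: (dsum_add N k (P r%:C) (P ('i * r%:C))).
    exact: (dsum_add N k (P (- r%:C)) (P (- ('i * r%:C)))).
  exact: (dsum_add N k (fun i j => P r%:C i j + P ('i * r%:C) i j)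
    (fun i j => P (- r%:C) i j + P (- ('i * r%:C)) i j)).
have cr : conjc (r%:C : C) = r%:C by apply: complex_ext; rewrite /= ?oppr0.
have ci : conjc ('i * r%:C : C) = - ('i * r%:C).
  by apply: complex_ext; rewrite !cReImE /=; ring.
have cN s : conjc (- s) = - conjc s by exact: rmorphN.
have ii : 'i * 'i = -1 :> C by apply: complex_ext; rewrite !cReImE /=; ring.
(* The sum over the four points vanishes unless 4 divides i - j. *)
have TE i j : T i j = (r ^+ (i + j))%:C *
    (1 + 'i ^+ i * (- 'i) ^+ j + ((-1) ^+ i * (-1) ^+ j + (- 'i) ^+ i * 'i ^+ j)).
  rewrite /T /four_sum !cN cr ci opprK -!mulNr !exprMn rmorphXn /= exprD.
  by rewrite -[- r%:C]mulN1r !exprMn; ring.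
pose c i j : C := if (i < 2)%N && (j < 2)%N && (i + j < 3)%N then T i j else 0.
have -> : 4 * k 0%N 0%N + 4 * k 1%N 1%N * (r ^+ 2)%:C =
    \sum_(i < N.+2) \sum_(j < N.+2) k i j * c i j.
  rewrite dsum_low => [|i j]; last first.
    by rewrite /c => /orP[h|h]; rewrite [(i < 2)%N]ltnNge [(j < 2)%N]ltnNge h ?andbF.
  rewrite /c /= !TE /= !expr0 !expr1.
  have -> : 'i * - 'i = 1 :> C by rewrite mulrN ii opprK.
  have -> : - 'i * 'i = 1 :> C by rewrite mulNr ii opprK.
  ring.
rewrite E (dsum_diff N k T c) -mulrA mulrCA.
apply: (@dsum_le N k (fun i j => T i j - c i j)) => i j; rewrite /c.
have r3 : 0 <= 4 * r ^+ 3 by rewrite mulr_ge0 // exprn_ge0.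
case: ifP => ij; first by rewrite subrr nrm0.
rewrite subr0; have [ij3|ij3] := leqP 3 (i + j).
  rewrite TE nrmM nrm_real ger0_norm ?exprn_ge0 // mulrC; apply: ler_pM.
  - exact: nrm_ge0.
  - exact: exprn_ge0.
  - have ni : nrm ('i : C) = 1.
      by rewrite /nrm normc_def /= expr0n /= add0r expr1n sqrtr1.
    have h (a b : C) : nrm a = 1 -> nrm b = 1 -> nrm (a ^+ i * b ^+ j) = 1.
      by move=> a1 b1; rewrite nrmM !nrmX a1 b1 !expr1n mulr1.
    have n1 : nrm (-1 : C) = 1 by rewrite nrmN (nrm_real 1) normr1.
    have h1 := h 'i (- 'i) ni; have h2 := h (-1) (-1) n1 n1; have h3 := h (- 'i) 'i.
    rewrite nrmN ni in h1 h3; have := h1 erefl; have := h3 erefl erefl.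
    move=> {}h3 {}h1; have h0 : nrm (1 : C) = 1 by rewrite (nrm_real 1) normr1.
    exact: (nrm_four h0 h1 h2 h3).
  - by apply: ler_wiXn2l.
suff -> : T i j = 0 by rewrite nrm0.
rewrite TE; move: i j ij ij3 => [|[|[|i]]] [|[|[|j]]] //= _ _;
  rewrite ?expr0 ?expr1 ?expr2 ?mulrNN ?ii; ring.
Qed.

End DoublePowerSums.

(** * Means of double power sums on circles *)

Section CircleMeans.
Variable R : realType.
Local Notation C := (CC R).

Lemma cint_FTC (h h' : R -> C) : (forall t : R, rdiff h t (h' t)) -> ccont h' ->
  cint h' = h (2 * pi) - h 0.
Proof.
move=> dh [cr ci]; apply: complex_ext; rewrite !cReImE /=.
  apply: (circ_int_FTC (F := fun x => complex.Re (h x)) cr) => x _.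
  exact: rdiff_Re (dh x).
apply: (circ_int_FTC (F := fun x => complex.Im (h x)) ci) => x _.
exact: rdiff_Im (dh x).
Qed.

Lemma ccont_expiX m : ccont (fun t : R => expi t ^+ m : C).
Proof.
elim: m => [|m IH]; first exact: ccont_cst.
rewrite (_ : (fun t => _) = fun t => expi t * expi t ^+ m); last first.
  by apply/funext => t; rewrite exprS.
by apply: ccontM => //; exact: ccont_expi.
Qed.

Lemma rdiff_expiX m (t : R) :
  rdiff (fun x => expi x ^+ m : C) t (m%:R * 'i * expi t ^+ m).
Proof.
elim: m => [|m IH]; first by rewrite !mul0r; exact: rdiff_cst.
rewrite (_ : (fun x => _) = fun x => expi x * expi x ^+ m); last first.
  by apply/funext => x; rewrite exprS.
rewrite (_ : _ * _ = 'i * expi t * expi t ^+ m + expi t * (m%:R * 'i * expi t ^+ m)).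
  exact: rdiffM (rdiff_expi t) IH.
by rewrite exprS -natr1; ring.
Qed.

Lemma cint_expiX m : cint (fun t : R => expi t ^+ m : C) = (2 * pi)%:C *+ (m == 0%N).
Proof.
case: m => [|m].
  apply: complex_ext => /=.
    by rewrite -[LHS]/(circ_int (fun=> 1)) circ_int_cst mulr1.
  by rewrite -[LHS]/(circ_int (fun=> 0)) circ_int_cst mulr0.
rewrite /= mulr0n; have c := ccont_expiX m.+1.
have := cint_FTC (rdiff_expiX m.+1) (ccontM (ccont_cst _) c).
have e1 : expi (2 * pi) = 1 :> C.
  have := expiD2pi (0 : R); rewrite add0r => ->.
  by apply: complex_ext; rewrite /= ?cos0 ?sin0.
have e0 : expi 0 = 1 :> C by apply: complex_ext; rewrite /= ?cos0 ?sin0.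
rewrite (cintZ _ c) e0 e1 subrr => /eqP; rewrite mulf_eq0 => /orP[|/eqP //].
rewrite mulf_eq0 pnatr_eq0 /= => /eqP /(congr1 (@complex.Im R)) /= /eqP.
by rewrite oner_eq0.
Qed.

Lemma cint_conj (k : R -> C) : ccont k -> cint (fun t => conjc (k t)) = conjc (cint k).
Proof.
move=> [cr ci]; apply: complex_ext => /=.
  by congr circ_int; apply/funext => t; case: (k t).
rewrite -mulN1r -circ_intZ //.
by congr circ_int; apply/funext => t; rewrite mulN1r; case: (k t).
Qed.

Lemma conjc_expi (t : R) : expi t * conjc (expi t) = 1 :> C.
Proof.
apply: complex_ext; rewrite !cReImE /=.
  by rewrite mulrN opprK -!expr2 cos2Dsin2.
by rewrite mulrN [cos t * _]mulrC addrC subrr.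
Qed.

Lemma ccont_conj (k : R -> C) : ccont k -> ccont (fun t => conjc (k t)).
Proof.
move=> [cr ci]; split.
  by rewrite (_ : (fun t => _) = fun t => complex.Re (k t)) //; apply/funext => t; case: (k t).
rewrite (_ : (fun t => _) = fun t => - complex.Im (k t)); last first.
  by apply/funext => t; case: (k t).
by move=> t; apply: cvgN; exact: ci.
Qed.

Lemma ccont_mono i j : ccont (fun t : R => expi t ^+ i * conjc (expi t) ^+ j : C).
Proof.
apply: ccontM; first exact: ccont_expiX.
rewrite (_ : (fun t => _) = fun t => conjc (expi t ^+ j)); last first.
  by apply/funext => t; rewrite rmorphXn.
exact/ccont_conj/ccont_expiX.
Qed.

Lemma cint_mono i j : cint (fun t : R => expi t ^+ i * conjc (expi t) ^+ j : C) =
  (2 * pi)%:C *+ (i == j).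
Proof.
have low a b (t : R) : expi t ^+ (a + b) * conjc (expi t) ^+ a = expi t ^+ b :> C.
  by rewrite exprD mulrAC -exprMn conjc_expi expr1n mul1r.
have [ij|/ltnW ij] := leqP j i.
  rewrite -(subnK ij) addnC (_ : (fun t => _) = fun t => expi t ^+ (i - j)); last first.
    by apply/funext => t; exact: low.
  by rewrite cint_expiX; case: (i - j)%N => [|m]; rewrite ?addn0 ?eqxx // -{2}(addn0 j) eqn_add2l.
rewrite -(subnK ij) addnC (_ : (fun t => _) = fun t => conjc (expi t ^+ (j - i))); last first.
  apply/funext => t; rewrite -(low i (j - i)%N) rmorphM !rmorphXn /= opprK.
  by rewrite mulrC.
rewrite cint_conj ?cint_expiX; last exact: ccont_expiX.
have -> : (i == i + (j - i))%N = (j - i == 0)%N.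
  by rewrite -[X in X == _](addn0 i) eqn_add2l eq_sym.
by case: (_ == _); rewrite ?mulr1n ?mulr0n ?conjc0 //; apply: complex_ext; rewrite /= ?oppr0.
Qed.

Lemma cint_sum m (F : 'I_m -> R -> C) : (forall i, ccont (F i)) ->
  ccont (fun t => \sum_i F i t) /\ cint (fun t => \sum_i F i t) = \sum_i cint (F i).
Proof.
elim: m F => [|m IH] F cF.
  rewrite (_ : (fun t => _) = fun=> 0); last by apply/funext => t; rewrite big_ord0.
  split; first exact: ccont_cst.
  rewrite big_ord0; transitivity (cint (fun t : R => 0 * (0 : C))); last first.
    by rewrite (cintZ 0 (ccont_cst 0)) mul0r.
  by congr cint; apply/funext => t; rewrite mul0r.
rewrite (_ : (fun t => _) = fun t => F ord0 t + \sum_i F (lift ord0 i) t); last first.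
  by apply/funext => t; rewrite big_ord_recl.
have [c E] := IH (fun i => F (lift ord0 i)) (fun i => cF _).
by split; [exact: ccontD|rewrite cintD // E big_ord_recl].
Qed.

(** Only the diagonal terms of a double power sum contribute to its means on
    circles. *)
Lemma cint_dsum N (k : nat -> nat -> C) (r : R) :
  let f t := dsum N k (r%:C * expi t) (conjc (r%:C * expi t)) in
  ccont f /\ cint f = (2 * pi)%:C * \sum_(i < N.+2) k i i * (r ^+ 2)%:C ^+ i.
Proof.
move=> f; pose T (i j : nat) (t : R) : C :=
  k i j * r%:C ^+ (i + j) * (expi t ^+ i * conjc (expi t) ^+ j).
have fE : f = fun t => \sum_(i < N.+2) \sum_(j < N.+2) T i j t.
  apply/funext => t; apply: eq_bigr => i _; apply: eq_bigr => j _.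
  have -> : conjc (r%:C * expi t) = r%:C * conjc (expi t) :> C.
    by apply: complex_ext; rewrite !cReImE /=; ring.
  by rewrite /T !exprMn exprD; ring.
have cT i j : ccont (T i j) by apply: ccontM; [exact: ccont_cst|exact: ccont_mono].
have TE i j : cint (T i j) = k i j * r%:C ^+ (i + j) * ((2 * pi)%:C *+ (i == j)).
  by rewrite cintZ ?cint_mono //; exact: ccont_mono.
have row (i : 'I_N.+2) := cint_sum (fun j : 'I_N.+2 => cT i j).
have [cf fI] := cint_sum (fun i => (row i).1).
rewrite fE; split=> //; rewrite fI mulr_sumr; apply: eq_bigr => i _; rewrite (row i).2.
rewrite (bigD1 i) //= big1 => [|j ji]; last first.
  by rewrite TE (_ : (_ == _ :> nat) = false) ?mulr0 //; rewrite eq_sym; apply: negbTE.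
by rewrite addr0 TE eqxx mulr1n addnn -muln2 mulnC exprM rmorphXn /= mulrC.
Qed.

Lemma integral_circ_int (f : R -> R) : continuous f ->
  (\int[@lebesgue_measure R]_(t in `[0%R, (2 * pi)%R]) (f t)%:E = (circ_int f)%:E)%E.
Proof.
move=> cf; rewrite /circ_int /Rintegral fineK //.
exact: integrable_fin_num (circ_integrable cf).
Qed.

(** The first diagonal coefficient is a quarter of the Laplacian. *)
Lemma subharmonic_dsum_ge0 (u : C -> R) (a : C) N (k : nat -> nat -> C) :
  subharmonic u -> (forall s, (u (a + s))%:C = dsum N k s (conjc s)) ->
  0 <= complex.Re (k 1%N 1%N).
Proof.
move=> [_ mean] uE.
have u0 : (u a)%:C = k 0%N 0%N.
  rewrite -[a]addr0 uE conjc0 dsumE.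
  pose c i j : C := (0 ^+ i * 0 ^+ j).
  rewrite (_ : \sum_i _ = \sum_(i < N.+2) \sum_(j < N.+2) k i j * c i j) // dsum_low.
    by rewrite /c !expr0 !expr1 !mulr0 !mul0r !mulr0 !addr0 !mulr1.
  by move=> [|[|i]] [|[|j]] //= _; rewrite /c exprS ?mul0r ?mulr0 // [0 ^+ _.+2]exprS mul0r mulr0.
pose S : R := \sum_(i < N) nrm (k i.+2 i.+2).
have S0 : 0 <= S by apply: sumr_ge0 => i _; exact: nrm_ge0.
have ineq (r : R) : 0 < r -> r <= 1 -> 0 <= complex.Re (k 1%N 1%N) + S * r ^+ 2.
  move=> r0 r1; have mr := mean a r r0.
  have [[cr _] cI] := cint_dsum N k r.
  pose f t := u (a + r%:C * (cos t +i* sin t)).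
  have fE : f = fun t => complex.Re (dsum N k (r%:C * expi t) (conjc (r%:C * expi t))).
    by apply/funext => t; rewrite -uE.
  have cf : continuous f by rewrite fE.
  move: mr; rewrite (integral_circ_int cf).
  have := congr1 (@complex.Re R) cI; rewrite /cint /= -fE => ->.
  rewrite lee_fin cReM /= mul0r subr0 ler_pM2l ?twopi_gt0 // !big_ord_recl /=.
  rewrite expr0 mulr1 -u0 expr1 cReD /= lerDl cReD => h.
  have r2 : 0 < r ^+ 2 by rewrite exprn_gt0.
  rewrite -(pmulr_lge0 _ r2); apply: le_trans h _.
  rewrite cReM /= mulr0 subr0 mulrDl lerD2l.
  apply: le_trans (ler_norm _) _; apply: le_trans (ler_Re_nrm _) _.
  apply: le_trans (ler_nrm_sum _) _; rewrite -mulrA -expr2 mulr_suml; apply: ler_sum => i _.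
  rewrite nrmM nrmX nrm_real ger0_norm ?(ltW r2) // ler_wpM2l ?nrm_ge0 //.
  by apply: ler_wiXn2l => //; [exact: ltW|rewrite exprn_ile1 // ltW].
rewrite leNgt; apply/negP => k0; set K := complex.Re _ in k0 ineq.
pose r2 := Num.min 1 (- K / (2 * (S + 1))).
have r20 : 0 < r2 by rewrite lt_min ltr01 divr_gt0 ?oppr_gt0 // mulr_gt0 // ltr_wpDl.
have r21 : r2 <= 1 by rewrite ge_min lexx.
have := ineq (r2); rewrite r20 r21 => /(_ isT isT).
have : r2 ^+ 2 <= r2 by rewrite expr2 ler_piMr // ltW.
have : r2 * (2 * (S + 1)) <= - K by rewrite -ler_pdivlMr ?mulr_gt0 ?ltr_wpDl // ge_min lexx orbT.
move=> h1 h2; have h3 := ler_wpM2l S0 h2; lra.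
Qed.

End CircleMeans.

(** * Lipschitz and Taylor estimates *)

Section Estimates.
Variable R : realType.
Local Notation C := (CC R).

Lemma meval_lip m (p : mpoly.mpoly m C) (B : R) : exists2 L : R, 0 <= L &
  forall (x y : 'I_m -> C) (e : R), (forall i, nrm (x i) <= B) ->
    (forall i, nrm (y i) <= B) -> (forall i, nrm (x i - y i) <= e) -> 0 <= e ->
  nrm (mpoly.meval x p - mpoly.meval y p) <= L * e.
Proof.
suff [L [S [L0 S0 _ HL]]] : exists L S : R, [/\ 0 <= L, 0 <= S,
    forall x : 'I_m -> C, (forall i, nrm (x i) <= B) -> nrm (mpoly.meval x p) <= S &
    forall (x y : 'I_m -> C) (e : R), (forall i, nrm (x i) <= B) ->
      (forall i, nrm (y i) <= B) -> (forall i, nrm (x i - y i) <= e) -> 0 <= e ->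
      nrm (mpoly.meval x p - mpoly.meval y p) <= L * e].
  by exists L.
elim/mpoly_gen_ind : p => [c|i|p q|p q].
- exists 0, (nrm c); split=> //; first exact: nrm_ge0.
    by move=> x _; rewrite mpoly.mevalC.
  by move=> x y e _ _ _ _; rewrite !mpoly.mevalC subrr nrm0 mul0r.
- exists 1, `|B|; split=> //.
    by move=> x xB; rewrite mpoly.mevalXU; apply: le_trans (xB i) (ler_norm B).
  by move=> x y e _ _ h _; rewrite !mpoly.mevalXU mul1r.
- move=> [L [S [L0 S0 HS HL]]] [L' [S' [L'0 S'0 HS' HL']]].
  exists (L + L'), (S + S'); split; [exact: addr_ge0|exact: addr_ge0| |].
    move=> x xB; rewrite mpoly.mevalD; apply: le_trans (ler_nrmD _ _) _.
    by apply: lerD; [exact: HS|exact: HS'].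
  move=> x y e xB yB xy e0; rewrite !mpoly.mevalD mulrDl.
  have -> (a b c d : C) : a + b - (c + d) = a - c + (b - d) by ring.
  apply: le_trans (ler_nrmD _ _) _.
  by apply: lerD; [exact: HL|exact: HL'].
move=> [L [S [L0 S0 HS HL]]] [L' [S' [L'0 S'0 HS' HL']]].
exists (L * S' + S * L'), (S * S'); split.
- by rewrite addr_ge0 // mulr_ge0.
- exact: mulr_ge0.
- move=> x xB; rewrite mpoly.mevalM nrmM; apply: ler_pM; rewrite ?nrm_ge0 //.
    exact: HS.
  exact: HS'.
move=> x y e xB yB xy e0; rewrite !mpoly.mevalM.
have -> (a b c d : C) : a * b - c * d = (a - c) * b + c * (b - d) by ring.
apply: le_trans (ler_nrmD _ _) _; rewrite !nrmM [leRHS]mulrDl; apply: lerD.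
  rewrite mulrAC; apply: ler_pM; rewrite ?nrm_ge0 //; [exact: HL|exact: HS'].
by rewrite -mulrA; apply: ler_pM; rewrite ?nrm_ge0 //; [exact: HS|exact: HL'].
Qed.

Lemma cdiff_subsqr (F : C -> C) (c a l : C) : cdiff F a l ->
  cdiff (fun s => F s - c * s ^+ 2) a (l - c * (a *+ 2)).
Proof.
move=> dF e e0; have e2 : 0 < e / 2 by rewrite divr_gt0.
have c1 : 0 < nrm c + 1 by rewrite ltr_wpDl // nrm_ge0.
have [d d0 H] := dF _ e2.
exists (Num.min d (e / 2 / (nrm c + 1))) => [|h]; first by rewrite lt_min d0 divr_gt0.
rewrite lt_min ltr_pdivlMr // => /andP[/H h1 h2].
rewrite (_ : _ - _ = F (a + h) - F a - l * h - c * h * h); last by rewrite mulr2n; ring.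
apply: le_trans (ler_nrmB _ _) _; rewrite [e]splitr mulrDl; apply: lerD => //.
rewrite nrmM ler_wpM2r ?nrm_ge0 // nrmM; apply: ltW; apply: le_lt_trans h2.
by rewrite mulrC ler_wpM2l ?nrm_ge0 // lerDl.
Qed.

(** The second-order Taylor expansion of a holomorphic function along a line. *)
Lemma holo_taylor2 (V : normedModType C) (g : V -> C) Dg (d K : R) u :
  0 < d -> holo_lip g Dg 0 d K ->
  exists (a : C) (B e : R), [/\ 0 <= B, 0 < e & forall s, nrm s < e ->
    nrm (g (s *: u) - (g 0 + Dg u 0 * s + a * s ^+ 2)) <= B * nrm s ^+ 3].
Proof.
move=> d0 hg; have [D2 [K2 h2]] := holo_D u d0 hg.
have d4 : 0 < d / 4 by rewrite divr_gt0.
have [K3 K30 L3] := holo_D_lip u d4 h2.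
have T := holo_second h2 (ltW d4) K30 L3.
have u1 : 0 < nrm u + 1 by rewrite ltr_wpDl // nrm_ge0.
pose e := d / 16 / (nrm u + 1).
have e0 : 0 < e by rewrite !divr_gt0.
exists (D2 u 0 / 2), (K3 * nrm u), e; split=> // [|s se]; first by rewrite mulr_ge0 ?nrm_ge0.
have su : nrm s * nrm u < d / 16.
  move: se; rewrite ltr_pdivlMr // mulrDr mulr1 => se.
  by have := nrm_ge0 s; lra.
pose F (w : C) := g (w *: u) - D2 u 0 / 2 * w ^+ 2.
have h20 : D2 u 0 / 2 + D2 u 0 / 2 = D2 u 0 :> C by rewrite -splitr.
have tle (t : R) : 0 <= t <= 1 -> nrm (t%:C * s) <= nrm s.
  by move=> /andP[t0 t1]; rewrite nrmM nrm_real ger0_norm // ler_piMl // nrm_ge0.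
suff E : nrm (F s - F 0 - Dg u 0 * s) <= K3 * nrm u * nrm s ^+ 2 * nrm s.
  move: E; rewrite /F scale0r expr0n mulr0 subr0.
  rewrite (_ : K3 * nrm u * nrm s ^+ 3 = K3 * nrm u * nrm s ^+ 2 * nrm s); last by ring.
  by rewrite (_ : g (s *: u) - _ - _ - _ = g (s *: u) - (g 0 + Dg u 0 * s + D2 u 0 / 2 * s ^+ 2)) //; ring.
apply: (@complex_MVT R F (fun w => Dg u (w *: u) - D2 u 0 / 2 * (w *+ 2))).
- move=> t /tle t01; apply: cdiff_subsqr.
  have := @holo_line _ _ g Dg 0 d K 0 u (t%:C * s) hg.
  rewrite add0r subr0 nrmZ (_ : (fun s => _) = fun w => g (w *: u)); last first.
    by apply/funext => w; rewrite add0r.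
  apply; apply: le_lt_trans (ler_wpM2r (nrm_ge0 _) t01) _.
  by apply: lt_trans su _; rewrite ltr_pdivrMr // ltr_pMr // ltr1n.
- move=> t /tle t01; set w := t%:C * s in t01 *.
  have := T 0 w; rewrite subrr nrm0 !add0r.
  have -> : D2 u 0 / 2 * (w *+ 2) = D2 u 0 * w.
    by rewrite mulr2n mulrDr -mulrDl h20.
  have -> (a b c : C) : a - c - b = a - b - c by ring.
  move=> h; apply: le_trans (h _) _.
    apply: le_lt_trans (ler_wpM2r (nrm_ge0 _) t01) _.
    by apply: lt_le_trans su _; rewrite -mulrA ler_pM2l //; lra.
  rewrite expr2 mulrA; apply: ler_pM; rewrite ?mulr_ge0 ?nrm_ge0 //.
  by apply: ler_pM; rewrite ?mulr_ge0 ?nrm_ge0.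
Qed.

End Estimates.

(** * The Levi form on the tangent spaces of level sets *)

Section SecondDifferences.
Variables (R : realType) (m : nat).
Local Notation C := (CC R).
Variables (f : 'rV[C]_m -> R) (d : R).
Hypothesis d0 : 0 < d.
Hypothesis f2 : C2_on [set x | nrm x < d] f.

Lemma is_derive_line (F : 'rV[C]_m -> R) u (t : R) : rderivable F (t%:C *: u) u ->
  is_derive t 1 (fun t : R => F (t%:C *: u)) (rderive u F (t%:C *: u)).
Proof.
move=> dF; have h0 : is_derive (0 : R) 1 (real_line F (t%:C *: u) u) (rderive u F (t%:C *: u)).
  exact: (DeriveDef dF (esym (derive1E _ _))).
apply/is_derive_epsP => e e0; have [d' d'0 H] := (is_derive_epsP _ _ _).1 h0 e e0.
exists d' => // h /H; rewrite add0r /real_line scale0r addr0 -scalerDl.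
by rewrite (rmorphD (real_complex R)).
Qed.

(** The symmetric second difference of a twice differentiable function. *)
Lemma second_difference u (e : R) : 0 < e -> exists2 d' : R, 0 < d' &
  forall t : R, 0 < t -> t < d' ->
    `|f (t%:C *: u) + f ((- t)%:C *: u) - (2 * f 0 + rderive u (rderive u f) 0 * t ^+ 2)|
      <= e * t ^+ 2.
Proof.
move=> e0; set D := rderive u (rderive u f) 0.
pose q (t : R) := rderive u f (t%:C *: u).
have u1 : 0 < nrm u + 1 by rewrite ltr_wpDl // nrm_ge0.
have inD (t : R) : `|t| < d / (nrm u + 1) -> nrm (t%:C *: u) < d.
  rewrite ltr_pdivlMr // => h; rewrite nrmZ nrm_real; apply: le_lt_trans h.
  by rewrite ler_wpM2l // lerDl.
have dq : is_derive (0 : R) 1 q D.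
  have n0 : nrm (0 : 'rV[C]_m) < d by rewrite nrm0.
  have := @is_derive_line (rderive u f) u 0; rewrite scale0r; apply.
  exact: ((f2.2 u u 0 n0).1).
have e2 : 0 < e / 2 by rewrite divr_gt0.
have [d1 d10 H1] := (is_derive_epsP _ _ _).1 dq _ e2.
exists (Num.min d1 (d / (nrm u + 1))) => [|t t0]; first by rewrite lt_min d10 divr_gt0.
rewrite lt_min => /andP[t1 t2].
pose h (t : R) := f (t%:C *: u).
have dh (x : R) : `|x| < d / (nrm u + 1) -> is_derive x 1 h (q x).
  by move=> xd; apply: is_derive_line; apply: (f2.1 u _ _).1; exact: inD.
pose K (x : R) := h x + h (- x) - D * x ^+ 2.
have dK x : 0 <= x <= t -> is_derive x 1 K (q x - q (- x) - D * (2 * x)).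
  move=> /andP[x0 xt]; have xd : `|x| < d / (nrm u + 1).
    by rewrite ger0_norm //; exact: le_lt_trans xt t2.
  have xd' : `|- x| < d / (nrm u + 1) by rewrite normrN.
  have d1' := dh x xd; have d2' := dh (- x) xd'.
  have d3 : is_derive x 1 (fun y => h (- y)) (- q (- x)).
    apply/is_derive_epsP => e' e'0.
    have [d' d'0 H] := (is_derive_epsP _ _ _).1 d2' e' e'0.
    exists d' => // y yd; have := H (- y); rewrite normrN => /(_ yd).
    by rewrite opprD mulrN mulNr.
  have d4 : is_derive x 1 (fun y => D * y ^+ 2) (D * (2 * x)).
    apply/is_derive_epsP => e' e'0; have D1 : 0 < `|D| + 1 by rewrite ltr_wpDl.
    exists (e' / (`|D| + 1)) => [|y]; first exact: divr_gt0.
    rewrite ltr_pdivlMr // => yd.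
    rewrite (_ : _ - _ = D * y * y); last by ring.
    rewrite normrM ler_wpM2r // normrM; apply: ltW; apply: le_lt_trans yd.
    by rewrite mulrC ler_wpM2l // lerDl.
  rewrite (_ : K = (h \+ (fun y => h (- y))) \- (fun y => D * y ^+ 2)) //.
  exact: (is_deriveB (is_deriveD d1' d3) d4).
have [c /andP[c0 ct] E] := real_MVT (ltW t0) dK.
have E' : K t - K 0 = f (t%:C *: u) + f ((- t)%:C *: u) - (2 * f 0 + D * t ^+ 2).
  by rewrite /K /h oppr0 scale0r; ring.
rewrite -E' E subr0 normrM (gtr0_norm t0) expr2 mulrA ler_wpM2r ?(ltW t0) //.
have hc : `|c| < d1 by rewrite ger0_norm //; exact: le_lt_trans ct t1.
have hc' : `|- c| < d1 by rewrite normrN.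
have := H1 _ hc; have := H1 _ hc'; rewrite !add0r normrN.
rewrite (ger0_norm c0) => a1 a2.
have idt (a1' a2' a3 a4 x : R) :
  a1' - a2' - a4 * (2 * x) = (a1' - a3 - a4 * x) - (a2' - a3 - a4 * - x) by ring.
rewrite (idt _ _ (q 0)).
apply: le_trans (ler_normB _ _) _; apply: le_trans (lerD a2 a1) _.
by rewrite -mulrDl -splitr ler_wpM2l // ltW.
Qed.

End SecondDifferences.

Section LeviTangent.
Variable R : realType.
Local Notation C := (CC R).
Variables (n : nat) (p : 'I_n).
Variables (G : 'rV[C]_n -> C) (z0 : 'rV[C]_n) (r M : R).
Hypothesis dG : forall z, differentiable G z.
Hypothesis r0 : 0 < r.
Hypothesis hG : holo_lip G (fun b z => 'd G z b) z0 r M.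
Hypothesis c00 : 'd G z0 (delta_mx 0 p) != 0.
Variable U : set 'rV[C]_n.
Hypothesis ballU : forall z, nrm (z - z0) < r -> U z.
Variables (P : 'rV[C]_n -> R) (q : mpoly.mpoly (n + n) C).
Hypothesis qP : represents q P.
Hypothesis phP : pluriharmonic_along_level_sets U G P.

(** The value at (v, w) of the Levi form of q at z, which is antilinear in w. *)
Definition levi n (q : mpoly.mpoly (n + n) C) (z v w : 'rV[C]_n) : C :=
  \sum_(j < n) \sum_(l < n) v 0 j * conjc (w 0 l) * bieval z (map_mx (@conjc R) z)
     (mpoly.mderiv (rshift n l) (mpoly.mderiv (lshift n j) q)).

(** Where the Laplacian vanishes, the symmetric second difference over the four
    points is of smaller order than the square of the radius. *)
Lemma laplacian_four m (f : 'rV[C]_m -> R) (d : R) u (e : R) : 0 < d ->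
  pluriharmonic_on [set x | nrm x < d] f -> 0 < e ->
  exists2 d' : R, 0 < d' & forall t : R, 0 < t -> t < d' ->
    nrm (four_sum (fun s => (f (s *: u))%:C) t - 4 * (f 0)%:C) <= e * t ^+ 2.
Proof.
move=> d0 [f2 lap] e0; have e2 : 0 < e / 2 by rewrite divr_gt0.
have [d1 d10 H1] := second_difference d0 f2 u e2.
have [d2 d20 H2] := second_difference d0 f2 ('i *: u) e2.
exists (Num.min d1 d2) => [|t t0]; first by rewrite lt_min d10.
rewrite lt_min => /andP[t1 t2]; have {}H1 := H1 t t0 t1; have {}H2 := H2 t t0 t2.
have n0 : nrm (0 : 'rV[C]_m) < d by rewrite nrm0.
have := lap 0 u n0; rewrite /line_laplacian => l0.
rewrite !scalerA in H2.
have idt (a1 a2 a3 a4 b D T : R) : a1%:C + a2%:C + (a3%:C + a4%:C) - 4 * b%:C =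
    (a1 + a3 - (2 * b + D * T) + (a2 + a4 - (2 * b + - D * T)))%:C :> C.
  by apply: complex_ext; rewrite !cReImE /=; ring.
have fE : four_sum (fun s => (f (s *: u))%:C) t - 4 * (f 0)%:C =
    (f (t%:C *: u) + f ((- t)%:C *: u) - (2 * f 0 + rderive u (rderive u f) 0 * t ^+ 2) +
     (f ((t%:C * 'i) *: u) + f (((- t)%:C * 'i) *: u) - (2 * f 0 +
        rderive ('i *: u) (rderive ('i *: u) f) 0 * t ^+ 2)))%:C.
  rewrite /four_sum [t%:C * 'i]mulrC [(- t)%:C * 'i]mulrC rmorphN mulrN.
  have -> : rderive ('i *: u) (rderive ('i *: u) f) 0 = - rderive u (rderive u f) 0.
    by apply/eqP; rewrite -addr_eq0 addrC; apply/eqP.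
  exact: idt.
rewrite fE nrm_real; apply: le_trans (ler_normD _ _) _.
have -> : e * t ^+ 2 = e / 2 * t ^+ 2 + e / 2 * t ^+ 2 by rewrite -mulrDl -splitr.
exact: (lerD H1 H2).
Qed.

Lemma bieval_conj_lip (B : R) : exists2 L : R, 0 <= L &
  forall (x y : 'rV[C]_n) (e : R), (forall j, nrm (x 0 j) <= B) ->
    (forall j, nrm (y 0 j) <= B) -> (forall j, nrm (x 0 j - y 0 j) <= e) -> 0 <= e ->
  nrm (bieval x (map_mx (@conjc R) x) q - bieval y (map_mx (@conjc R) y) q) <= L * e.
Proof.
have [L L0 HL] := meval_lip q B; exists L => // x y e xB yB xy e0; apply: HL => // i.
- rewrite -(fintype.splitK i); case: (fintype.split i) => j /=; rewrite ?row_mxEl ?row_mxEr //.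
  by rewrite mxE nrm_conjc.
- rewrite -(fintype.splitK i); case: (fintype.split i) => j /=; rewrite ?row_mxEl ?row_mxEr //.
  by rewrite mxE nrm_conjc.
rewrite -(fintype.splitK i); case: (fintype.split i) => j /=; rewrite ?row_mxEl ?row_mxEr //.
by rewrite !mxE -rmorphB nrm_conjc.
Qed.

Lemma four_sum_diff_le (F F' : C -> C) (t D : R) : 0 <= t ->
  (forall s, nrm s = t -> nrm (F s - F' s) <= D) ->
  nrm (four_sum F t - four_sum F' t) <= 4 * D.
Proof.
move=> t0 H; rewrite /four_sum.
have nt : nrm (t%:C : C) = t by rewrite nrm_real ger0_norm.
have ni : nrm ('i * t%:C : C) = t.
  rewrite nrmM nt; have -> : nrm ('i : C) = 1.
    by rewrite /nrm normc_def /= expr0n /= add0r expr1n sqrtr1.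
  by rewrite mul1r.
have h1 := H _ nt; have h2 := H _ ni.
have h3 : nrm (F (- t%:C) - F' (- t%:C)) <= D by apply: H; rewrite nrmN.
have h4 : nrm (F (- ('i * t%:C)) - F' (- ('i * t%:C))) <= D by apply: H; rewrite nrmN.
have idt (a1 a2 a3 a4 b1 b2 b3 b4 : C) : a1 + a2 + (a3 + a4) - (b1 + b2 + (b3 + b4)) =
  (a1 - b1) + (a2 - b2) + ((a3 - b3) + (a4 - b4)) by ring.
rewrite idt.
apply: le_trans (ler_nrmD _ _) _.
rewrite (_ : 4 * D = (D + D) + (D + D)); last by ring.
by apply: lerD; apply: le_trans (ler_nrmD _ _) _; exact: lerD.
Qed.

(** The Levi form of P vanishes on the complex tangent space of a level set of
    G.  A chart of the level set agrees with a quadratic polynomial curve up to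
    order three, and the symmetric second differences of P along the former are
    governed by the vanishing Laplacian, along the latter by the Levi form. *)
Lemma levi_tangent u :
  let v := u *m hyper_mx R p -
    ('d G z0 (u *m hyper_mx R p) / 'd G z0 (delta_mx 0 p)) *: delta_mx 0 p in
  levi q z0 v v = 0.
Proof.
have [g [d [K [d0 g0 hg par]]]] := level_set_chart dG r0 hG c00 ballU.
pose phi x : 'rV[C]_n := z0 + (x *m hyper_mx R p + g x *: delta_mx 0 p).
have lap : pluriharmonic_on [set x | nrm x < d] (P \o phi) := phP par.
have phi0 : phi 0 = z0 by rewrite /phi g0 mul0mx scale0r !addr0.
have [a2 [B [e1 [B0 e10 T]]]] := holo_taylor2 u d0 hg.
pose a1 : C := - ('d G z0 (u *m hyper_mx R p) / 'd G z0 (delta_mx 0 p)).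
have {}T s : nrm s < e1 -> nrm (g (s *: u) - (0 + a1 * s + a2 * s ^+ 2)) <= B * nrm s ^+ 3.
  by move=> /T; rewrite -/(phi 0) phi0 g0.
move=> v; have vE j : v 0 j = (u *m hyper_mx R p) 0 j + a1 * (delta_mx 0 p : 'rV[C]_n) 0 j.
  by rewrite /v /a1 !mxE mulNr.
pose ep : 'rV[C]_n := delta_mx 0 p.
have epE j : ep 0 j = (j == p)%:R by rewrite mxE eqxx.
(* The quadratic curve zeta(s) = z0 + s v + a2 s^2 e_p and its conjugate. *)
pose co (F : C -> C) j : {poly C} :=
  (F (z0 0 j))%:P + F (v 0 j) *: 'X + F (a2 * ep 0 j) *: 'X^2.
have co0 F j : (co F j)`_0 = F (z0 0 j).
  by rewrite /co !coefD !coefZ coefC coefX coefXn /= !mulr0 !addr0.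
have co1 F j : (co F j)`_1 = F (v 0 j).
  by rewrite /co !coefD !coefZ coefC coefX coefXn /= mulr1 mulr0 addr0 add0r.
have coE F j s : (co F j).[s] = F (z0 0 j) + F (v 0 j) * s + F (a2 * ep 0 j) * s ^+ 2.
  by rewrite /co !hornerE.
have [N [k [kE k00 _ _ k11]]] := bieval_expansion (co id) (co (@conjc R)) q.
have LE : levi q z0 v v = k 1%N 1%N.
  rewrite k11; apply: eq_bigr => j _; apply: eq_bigr => l _; rewrite !co1; congr (_ * _).
  by congr bieval; apply/rowP => i; rewrite !mxE co0.
have k00' : k 0%N 0%N = (P z0)%:C.
  rewrite k00 qP /with_conj -/(bieval _ _ _).
  by congr bieval; apply/rowP => i; rewrite !mxE co0.
rewrite LE; pose zeta s : 'rV[C]_n := \row_j (co id j).[s].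
have zE s : bieval (zeta s) (map_mx (@conjc R) (zeta s)) q = dsum N k s (conjc s).
  rewrite /dsum -kE; congr bieval; apply/rowP => j; rewrite !mxE !coE /=.
  by rewrite !expr2 !(rmorphD (@conjc R)) !(rmorphM (@conjc R)).
have close s j : nrm s < e1 -> nrm (phi (s *: u) 0 j - zeta s 0 j) <= B * nrm s ^+ 3.
  move=> /T h; have -> : phi (s *: u) 0 j - zeta s 0 j =
      (g (s *: u) - (0 + a1 * s + a2 * s ^+ 2)) * ep 0 j.
    have -> : phi (s *: u) 0 j = z0 0 j + (s * (u *m hyper_mx R p) 0 j + g (s *: u) * ep 0 j).
      rewrite /phi -scalemxAl mxE [X in _ + X]mxE [X in _ + (X + _)]mxE.
      by rewrite [X in _ + (_ + X)]mxE.
    have -> : zeta s 0 j = (co id j).[s] by rewrite mxE.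
    by rewrite coE vE -/ep; ring.
  rewrite nrmM; apply: le_trans h; rewrite ler_piMr ?nrm_ge0 //.
  rewrite /ep mxE eqxx /=; case: (_ == _); last by rewrite nrm0.
  by rewrite (nrm_real 1) normr1.
pose B1 := nrm z0 + nrm v + nrm a2 + B.
have [L L0 HL] := bieval_conj_lip B1.
have u1 : 0 < nrm u + 1 by rewrite ltr_wpDl // nrm_ge0.
pose e2 := Num.min (Num.min 1 e1) (d / (nrm u + 1)).
have e20 : 0 < e2 by rewrite !lt_min ltr01 e10 divr_gt0.
pose f x := P (phi x).
have approx s : nrm s < e2 -> nrm ((f (s *: u))%:C - dsum N k s (conjc s)) <= L * B * nrm s ^+ 3.
  rewrite !lt_min => /andP[/andP[s1 se] sd]; rewrite /f qP /with_conj -/(bieval _ _ _) -zE.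
  have s3 : nrm s ^+ 3 <= 1 by rewrite exprn_ile1 ?nrm_ge0 // ltW.
  have Bs : 0 <= B * nrm s ^+ 3 by rewrite mulr_ge0 // exprn_ge0 ?nrm_ge0.
  have Bs1 : B * nrm s ^+ 3 <= B by rewrite ler_piMr.
  have zB j : nrm (zeta s 0 j) <= nrm z0 + nrm v + nrm a2.
    rewrite mxE coE; apply: le_trans (ler_nrmD _ _) _; apply: lerD.
      apply: le_trans (ler_nrmD _ _) _; apply: lerD; first exact: nrm_coord.
      rewrite nrmM -[leRHS]mulr1; apply: ler_pM; rewrite ?nrm_ge0 ?(ltW s1) //.
      exact: nrm_coord.
    rewrite nrmM nrmX -[leRHS]mulr1; apply: ler_pM; rewrite ?exprn_ge0 ?nrm_ge0 //.
      rewrite -[leRHS]mulr1 nrmM ler_wpM2l ?nrm_ge0 // epE.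
      by case: (_ == _); rewrite ?nrm0 // (nrm_real 1) normr1.
    by rewrite exprn_ile1 ?nrm_ge0 // ltW.
  rewrite -mulrA; apply: HL => // j.
  - have := ler_nrm_dist (phi (s *: u) 0 j) (zeta s 0 j) 0; rewrite !subr0.
    move=> /le_trans; apply; rewrite addrC; apply: lerD; first exact: zB.
    exact: le_trans (close s j se) Bs1.
  - by apply: le_trans (zB j) _; rewrite lerDl.
  - exact: close.
have e21 : e2 <= 1 by rewrite /e2 !ge_min lexx.
clearbody e2.
apply: nrm_eq0; apply/eqP; rewrite eq_le nrm_ge0 andbT; apply/ler_addgt0Pr => e e0.
rewrite add0r; set S := dsum_norm N k.
have [d' d'0 Hd] := laplacian_four u d0 lap e0.
have S0 : 0 <= S := dsum_norm_ge0 N k.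
pose A := L * B + S.
have A0 : 0 <= A by rewrite addr_ge0 // mulr_ge0.
have A1 : 0 < A + 1 by rewrite ltr_wpDl.
pose t := Num.min (Num.min e2 d') (e / (2 * (A + 1))) / 2.
have m0 : 0 < Num.min (Num.min e2 d') (e / (2 * (A + 1))).
  by rewrite !lt_min e20 d'0 divr_gt0 // mulr_gt0.
have t0 : 0 < t by rewrite divr_gt0.
have : t < Num.min (Num.min e2 d') (e / (2 * (A + 1))) by rewrite ltr_pdivrMr // ltr_pMr // ltr1n.
rewrite !lt_min => /andP[/andP[te td] tA].
have t1 : t <= 1.
  by apply: ltW; exact: lt_le_trans te e21.
have h1 := Hd t t0 td.
have t01 : 0 <= t <= 1 by rewrite ltW.
have h2 := dsum_four N k t01.
have h3 : nrm (four_sum (fun s => (f (s *: u))%:C) t -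
    four_sum (fun s => dsum N k s (conjc s)) t) <= 4 * (L * B * t ^+ 3).
  apply: four_sum_diff_le; first exact: ltW.
  by move=> s st; have := approx s; rewrite st; apply.
have f0 : (f 0)%:C = k 0%N 0%N by rewrite /f phi0 k00'.
rewrite f0 in h1; rewrite -/S in h2.
move: h1 h2 h3; set X := four_sum _ t; set Y := four_sum _ t => h1 h2 h3.
have T2 : 0 < t ^+ 2 by rewrite exprn_gt0.
have := ler_nrm_dist (Y - 4 * k 0%N 0%N) (X - 4 * k 0%N 0%N) 0.
have -> : Y - 4 * k 0%N 0%N - (X - 4 * k 0%N 0%N) = Y - X by ring.
rewrite (nrmC Y X) !subr0 => h4.
have := ler_nrm_dist (4 * k 1%N 1%N * (t ^+ 2)%:C) (Y - 4 * k 0%N 0%N) 0.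
have -> : 4 * k 1%N 1%N * (t ^+ 2)%:C - (Y - 4 * k 0%N 0%N) =
   - (Y - (4 * k 0%N 0%N + 4 * k 1%N 1%N * (t ^+ 2)%:C)) by ring.
have n4 : nrm (4 : C) = 4.
  by have := nrm_real (4 : R); rewrite (rmorph_nat (real_complex R)) ger0_norm.
rewrite nrmN !subr0 !nrmM nrm_real (gtr0_norm T2) n4 => h5.
have h6 : 4 * nrm (k 1%N 1%N) * t ^+ 2 <= (e + 4 * A * t) * t ^+ 2.
  have -> : (e + 4 * A * t) * t ^+ 2 =
    4 * S * t ^+ 3 + (4 * (L * B * t ^+ 3) + e * t ^+ 2) by rewrite /A; ring.
  by apply: le_trans h5 _; apply: lerD => //; apply: le_trans h4 _; apply: lerD.
rewrite ler_pM2r // in h6; move: tA; rewrite ltr_pdivlMr ?mulr_gt0 // => tA.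
by lra.
Qed.

End LeviTangent.

(** * The kernel of the Levi form *)

Section LineExpansion.
Variables (R : realType) (n : nat).
Local Notation C := (CC R).
Variable q : mpoly.mpoly (n + n) C.

(** The expansion of q(z + s b, conj (z + s b)) in s and conj s. *)
Lemma line_expansion (z b : 'rV[C]_n) : exists N (k : nat -> nat -> C),
  [/\ forall s, bieval (z + s *: b) (map_mx (@conjc R) (z + s *: b)) q = dsum N k s (conjc s),
      k 0%N 0%N = bieval z (map_mx (@conjc R) z) q,
      k 0%N 1%N = \sum_j conjc (b 0 j) *
        bieval z (map_mx (@conjc R) z) (mpoly.mderiv (rshift n j) q) &
      k 1%N 1%N = levi q z b b].
Proof.
pose co (F : C -> C) j : {poly C} := (F (z 0 j))%:P + F (b 0 j) *: 'X.
have co0 F j : (co F j)`_0 = F (z 0 j).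
  by rewrite /co !coefD !coefZ coefC coefX /= mulr0 addr0.
have co1 F j : (co F j)`_1 = F (b 0 j).
  by rewrite /co !coefD !coefZ coefC coefX /= mulr1 add0r.
have coE F j s : (co F j).[s] = F (z 0 j) + F (b 0 j) * s by rewrite /co !hornerE.
have rowE f : bieval (\row_j (co id j)`_0) (\row_j (co (@conjc R) j)`_0) f =
    bieval z (map_mx (@conjc R) z) f.
  by congr bieval; apply/rowP => i; rewrite !mxE co0.
have [N [k [kE k00 _ k01 k11]]] := bieval_expansion (co id) (co (@conjc R)) q.
exists N, k; split=> [s|||].
- rewrite /dsum -kE; congr bieval; apply/rowP => j.
    by rewrite !mxE coE mulrC.
  by rewrite !mxE coE (rmorphD (@conjc R)) (rmorphM (@conjc R)) mulrC.
- by rewrite k00 rowE.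
- by rewrite k01; apply: eq_bigr => j _; rewrite co1 rowE.
rewrite k11; apply: eq_bigr => j _; apply: eq_bigr => l _; rewrite !co1; congr (_ * _).
exact: rowE.
Qed.

End LineExpansion.

Section LeviKernel.
Variables (R : realType) (n : nat).
Local Notation C := (CC R).
Variables (q : mpoly.mpoly (n + n) C) (P : 'rV[C]_n -> R).
Hypothesis qP : represents q P.
Implicit Types (z b v w : 'rV[C]_n).

Lemma levi_expansion z b : exists N (k : nat -> nat -> C),
  [/\ forall s, (P (z + s *: b))%:C = dsum N k s (conjc s),
      (P z)%:C = k 0%N 0%N & k 1%N 1%N = levi q z b b].
Proof.
have [N [k [kE k00 _ k11]]] := line_expansion q z b; exists N, k; split=> //.
  by move=> s; rewrite qP -kE.
by rewrite qP k00.
Qed.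

(** A real-valued P has a real Levi form. *)
Lemma levi_real z b : complex.Im (levi q z b b) = 0.
Proof.
have [N [k [kE k00 <-]]] := levi_expansion z b.
apply/eqP; rewrite -normr_eq0 eq_le normr_ge0 andbT; apply/ler_addgt0Pr => e e0.
rewrite add0r; have S0 := dsum_norm_ge0 N k; set S := dsum_norm N k in S0 *.
have S1 : 0 < S + 1 by rewrite ltr_wpDl.
pose t := Num.min 1 (e / (S + 1)).
have t0 : 0 < t by rewrite lt_min ltr01 divr_gt0.
have tS : t * (S + 1) <= e by rewrite -ler_pdivlMr // ge_min lexx orbT.
have t01 : 0 <= t <= 1 by rewrite ltW // ge_min lexx.
have := le_trans (ler_Im_nrm _) (dsum_four N k t01).
have -> : (fun s => dsum N k s (conjc s)) = fun s => (P (z + s *: b))%:C.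
  by apply/funext => s; rewrite kE.
rewrite /four_sum -k00.
have idt (a1 a2 a3 a4 x y : R) (u : C) : complex.Im (a1%:C + a2%:C + (a3%:C + a4%:C) -
    (4 * x%:C + 4 * u * y%:C)) = - (4 * complex.Im u * y).
  by rewrite !cReImE /=; ring.
rewrite idt.
have t2 : 0 < 4 * t ^+ 2 by rewrite mulr_gt0 // exprn_gt0.
rewrite normrN mulrAC mulrC normrM (gtr0_norm t2) -/S.
have -> : 4 * S * t ^+ 3 = S * t * (4 * t ^+ 2) by ring.
by rewrite ler_pM2r // => h; lra.
Qed.

Lemma leviDZl z v w b (t : C) : levi q z (v + t *: w) b = levi q z v b + t * levi q z w b.
Proof.
rewrite /levi mulr_sumr -big_split; apply: eq_bigr => j _ /=.
rewrite mulr_sumr -big_split; apply: eq_bigr => l _ /=.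
by rewrite !mxE; ring.
Qed.

Lemma leviDZr z v w b (t : C) :
  levi q z b (v + t *: w) = levi q z b v + conjc t * levi q z b w.
Proof.
rewrite /levi mulr_sumr -big_split; apply: eq_bigr => j _ /=.
rewrite mulr_sumr -big_split; apply: eq_bigr => l _ /=.
by rewrite !mxE (rmorphD (@conjc R)) (rmorphM (@conjc R)); ring.
Qed.

Hypothesis pshP : plurisubharmonic P.

Lemma levi_ge0 z b : 0 <= complex.Re (levi q z b b).
Proof.
have [N [k [kE _ <-]]] := levi_expansion z b.
apply: (subharmonic_dsum_ge0 (u := fun s => P (z + s *: b)) (a := 0) (N := N)).
  exact: pshP.2.
by move=> s; rewrite add0r.
Qed.

Lemma affine_quadratic_eq0 (x e : R) :
  0 <= e -> (forall t : R, 0 <= t * x + t ^+ 2 * e) -> x = 0.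
Proof.
move=> e0 H; have e1 : 0 < e + 1 by rewrite ltr_wpDl.
have := H (- x / (e + 1)).
have -> : - x / (e + 1) * x + (- x / (e + 1)) ^+ 2 * e = - (x / (e + 1)) ^+ 2.
  by field; rewrite gt_eqF.
rewrite oppr_ge0 => h; have /eqP : (x / (e + 1)) ^+ 2 == 0 by rewrite eq_le h sqr_ge0.
by move/eqP; rewrite sqrf_eq0 mulf_eq0 invr_eq0 (gt_eqF e1) orbF => /eqP.
Qed.

(** The Levi form is positive semidefinite, so its isotropic vectors lie in its
    kernel. *)
Lemma levi_isotropic z v w : levi q z v v = 0 -> levi q z v w = 0.
Proof.
move=> v0; set A := levi q z v w; pose B := levi q z w v; pose E := levi q z w w.
(* Nonnegativity at v + t w for small t of either sign, real or imaginary. *)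
have DE (t : C) : levi q z (v + t *: w) (v + t *: w) = conjc t * A + t * B + t * conjc t * E.
  by rewrite leviDZl !leviDZr v0 /A /B /E; ring.
have E0 : 0 <= complex.Re E by exact: levi_ge0.
have Ei : complex.Im E = 0 by exact: levi_real.
have re (t : C) : 0 <= complex.Re (conjc t * A + t * B + t * conjc t * E).
  by rewrite -DE levi_ge0.
have im (t : C) : complex.Im (conjc t * A + t * B + t * conjc t * E) = 0.
  by rewrite -DE levi_real.
have r1 : complex.Re A + complex.Re B = 0.
  apply: (affine_quadratic_eq0 E0) => t.
  suff -> : t * (complex.Re A + complex.Re B) + t ^+ 2 * complex.Re E =
      complex.Re (conjc t%:C * A + t%:C * B + t%:C * conjc t%:C * E) by [].
  by rewrite !cReImE /= Ei; ring.
have r2 : complex.Im A - complex.Im B = 0.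
  apply: (affine_quadratic_eq0 E0) => t; pose i t : C := 'i * t%:C.
  suff -> : t * (complex.Im A - complex.Im B) + t ^+ 2 * complex.Re E =
      complex.Re (conjc (i t) * A + i t * B + i t * conjc (i t) * E) by [].
  by rewrite /i !cReImE /= Ei; ring.
have r3 : complex.Im A + complex.Im B = 0.
  by rewrite -[RHS](im 1) !cReImE /= Ei; ring.
have r4 : complex.Re B - complex.Re A = 0.
  by rewrite -[RHS](im 'i) !cReImE /= Ei; ring.
by apply: complex_ext => /=; lra.
Qed.

Lemma levi_delta z v l : levi q z v (delta_mx 0 l) = \sum_j v 0 j *
  bieval z (map_mx (@conjc R) z) (mpoly.mderiv (rshift n l) (mpoly.mderiv (lshift n j) q)).
Proof.
apply: eq_bigr => j _; rewrite (bigD1 l) //= big1 ?addr0 => [|i il].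
  by rewrite !mxE !eqxx conjc1 mulr1.
by rewrite !mxE eqxx (negbTE il) (_ : conjc _ = 0) ?mulr0 ?mul0r //; exact: conjc0.
Qed.

End LeviKernel.

Section LeviRank.
Variables (R : realType) (n : nat) (p : 'I_n).
Local Notation C := (CC R).
Variables (q : mpoly.mpoly (n + n) C) (P : 'rV[C]_n -> R).
Hypothesis qP : represents q P.
Hypothesis pshP : plurisubharmonic P.
Variables (G : 'rV[C]_n -> C) (z0 : 'rV[C]_n) (r M : R).
Hypothesis dG : forall z, differentiable G z.
Hypothesis r0 : 0 < r.
Hypothesis hG : holo_lip G (fun b z => 'd G z b) z0 r M.
Variable U : set 'rV[C]_n.
Hypothesis ballU : forall z, nrm (z - z0) < r -> U z.
Hypothesis phP : pluriharmonic_along_level_sets U G P.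

Lemma tangent_sum (F : 'I_n -> C) k (a : C) :
  \sum_j (delta_mx 0 (lift p k) - a *: delta_mx 0 p : 'rV[C]_n) 0 j * F j =
    F (lift p k) - a * F p.
Proof.
rewrite (bigD1 p) //= (bigD1 (lift p k)) /=; last by rewrite eq_sym neq_lift.
rewrite big1 ?addr0 => [|i /andP[ip ik]]; last first.
  by rewrite !mxE (negbTE ip) (negbTE ik) andbF mulr0 subr0 mul0r.
rewrite !mxE !eqxx (negbTE (neq_lift _ _)) [lift p k == p]eq_sym (negbTE (neq_lift _ _)).
by rewrite /= mulr1 mulr0 sub0r subr0 mul1r addrC mulNr.
Qed.

(** The rows of the Levi matrix are proportional to the gradient of G. *)
Lemma levi_rank z : nrm (z - z0) < r -> 'd G z (delta_mx 0 p) != 0 -> forall j l,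
  'd G z (delta_mx 0 p) * bieval z (map_mx (@conjc R) z)
     (mpoly.mderiv (rshift n l) (mpoly.mderiv (lshift n j) q)) =
  'd G z (delta_mx 0 j) * bieval z (map_mx (@conjc R) z)
     (mpoly.mderiv (rshift n l) (mpoly.mderiv (lshift n p) q)).
Proof.
move=> zr c0 j l.
case: (unliftP p j) => [k ->|-> //].
pose r' := r - nrm (z - z0); have r'0 : 0 < r' by rewrite subr_gt0.
have inr y : nrm (y - z) < r' -> nrm (y - z0) < r.
  by rewrite /r' => h; have := ler_nrm_dist y z z0; lra.
have hG' : holo_lip G (fun b z => 'd G z b) z r' M.
  split=> [y b /inr|y y' /inr h /inr h']; first exact: hG.1.
  exact: hG.2.
have ballU' y : nrm (y - z) < r' -> U y by move=> /inr /ballU.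
have := levi_tangent dG r'0 hG' c0 ballU' qP phP (delta_mx 0 k).
have -> : delta_mx 0 k *m hyper_mx R p = delta_mx 0 (lift p k) :> 'rV[C]_n.
  by apply/rowP => i; rewrite -rowE !mxE eqxx.
set a := 'd G z (delta_mx 0 (lift p k)); set c := 'd G z (delta_mx 0 p) in c0 *.
move=> L0; have := levi_isotropic qP pshP (delta_mx 0 l) L0; rewrite levi_delta.
rewrite (tangent_sum (fun j => bieval z (map_mx (@conjc R) z)
  (mpoly.mderiv (rshift n l) (mpoly.mderiv (lshift n j) q)))).
set X := bieval _ _ _; set Y := bieval _ _ _ => /eqP.
by rewrite subr_eq0 => /eqP ->; rewrite mulrA mulrCA mulfV ?mulr1.
Qed.

End LeviRank.

(** * First-order expansions in a complex variable and its conjugate *)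

Section FirstOrder.
Variable R : realType.
Local Notation C := (CC R).
Implicit Types F : C -> C.

(** F has the first-order expansion a + b s + c (conj s) at s = 0. *)
Definition first_order F a b c := forall e : R, 0 < e -> exists2 d : R, 0 < d &
  forall s, nrm s < d -> nrm (F s - (a + b * s + c * conjc s)) <= e * nrm s.

Lemma first_order_cdiff F l : cdiff F 0 l -> first_order F (F 0) l 0.
Proof.
move=> dF e e0; have [d d0 H] := dF e e0; exists d => // s /H.
by rewrite add0r mul0r addr0 opprD addrA.
Qed.

Lemma first_order_dsum N k : first_order (fun s => dsum N k s (conjc s))
  (k 0%N 0%N) (k 1%N 0%N) (k 0%N 1%N).
Proof.
move=> e e0; have S0 := dsum_norm_ge0 N k; set S := dsum_norm N k in S0 *.
have S1 : 0 < S + 1 by rewrite ltr_wpDl.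
exists (Num.min 1 (e / (S + 1))) => [|s]; first by rewrite lt_min ltr01 divr_gt0.
rewrite lt_min ltr_pdivlMr // => /andP[/ltW s1 s2].
apply: le_trans (dsum_first_order _ _ s1) _; rewrite expr2 mulrA -/S.
rewrite ler_wpM2r ?nrm_ge0 //; apply: ltW; apply: le_lt_trans s2.
by rewrite mulrC ler_wpM2l ?nrm_ge0 // lerDl.
Qed.

Lemma first_order_lin_le (b c s : C) : nrm (b * s + c * conjc s) <= (nrm b + nrm c) * nrm s.
Proof. by apply: le_trans (ler_nrmD _ _) _; rewrite !nrmM nrm_conjc mulrDl. Qed.

Lemma first_orderM F1 F2 a1 b1 c1 a2 b2 c2 :
  first_order F1 a1 b1 c1 -> first_order F2 a2 b2 c2 ->
  first_order (fun s => F1 s * F2 s) (a1 * a2) (a1 * b2 + b1 * a2) (a1 * c2 + c1 * a2).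
Proof.
move=> H1 H2 e e0.
pose A1 := nrm a1 + (nrm b1 + nrm c1); pose A2 := nrm a2 + (nrm b2 + nrm c2).
have A10 : 0 <= A1 by rewrite !addr_ge0 // nrm_ge0.
have A20 : 0 <= A2 by rewrite !addr_ge0 // nrm_ge0.
have L1 : nrm b1 + nrm c1 <= A1 by rewrite lerDr nrm_ge0.
have L2 : nrm b2 + nrm c2 <= A2 by rewrite lerDr nrm_ge0.
pose B := A1 + A2 + 1 + A1 * A2; have B0 : 0 < B.
  by rewrite ltr_pwDl ?mulr_ge0 // ltr_wpDl // addr_ge0.
pose e' := Num.min 1 (e / B).
have e'0 : 0 < e' by rewrite lt_min ltr01 divr_gt0.
have e'1 : e' <= 1 by rewrite ge_min lexx.
have e'B : e' * B <= e by rewrite -ler_pdivlMr // ge_min lexx orbT.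
clearbody e'.
have [d1 d10 {}H1] := H1 e' e'0; have [d2 d20 {}H2] := H2 e' e'0.
exists (Num.min e' (Num.min d1 d2)) => [|s]; first by rewrite !lt_min e'0 d10.
rewrite !lt_min => /and3P[/ltW se /H1 h1 /H2 h2].
have s1 : nrm s <= 1 by exact: le_trans se e'1.
pose l1 := b1 * s + c1 * conjc s; pose l2 := b2 * s + c2 * conjc s.
have l1s : nrm l1 <= A1 * nrm s.
  by apply: le_trans (first_order_lin_le _ _ _) _; rewrite ler_wpM2r ?nrm_ge0.
have l2s : nrm l2 <= A2 * nrm s.
  by apply: le_trans (first_order_lin_le _ _ _) _; rewrite ler_wpM2r ?nrm_ge0.
have T1 : nrm (a1 + l1) <= A1.
  apply: le_trans (ler_nrmD _ _) _; rewrite lerD2l.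
  apply: le_trans (first_order_lin_le _ _ _) _.
  by rewrite ler_piMr // addr_ge0 // nrm_ge0.
have T2 : nrm (a2 + l2) <= A2.
  apply: le_trans (ler_nrmD _ _) _; rewrite lerD2l.
  apply: le_trans (first_order_lin_le _ _ _) _.
  by rewrite ler_piMr // addr_ge0 // nrm_ge0.
rewrite -addrA -/l1 in h1; rewrite -addrA -/l2 in h2.
have F2b : nrm (F2 s) <= A2 + 1.
  have := ler_nrm_dist (F2 s) (a2 + l2) 0; rewrite !subr0 => h.
  apply: le_trans h _; rewrite addrC; apply: lerD => //; apply: le_trans h2 _.
  by rewrite mulr_ile1 ?nrm_ge0 // ltW.
have -> : F1 s * F2 s - (a1 * a2 + (a1 * b2 + b1 * a2) * s + (a1 * c2 + c1 * a2) * conjc s) =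
    (F1 s - (a1 + l1)) * F2 s + ((a1 + l1) * (F2 s - (a2 + l2)) + l1 * l2).
  by rewrite /l1 /l2; ring.
apply: (@le_trans _ _ (e' * B * nrm s)); last by rewrite ler_wpM2r ?nrm_ge0.
have -> : e' * B * nrm s = e' * nrm s * (A2 + 1) + (A1 * (e' * nrm s) + A1 * A2 * (e' * nrm s)).
  by rewrite /B; ring.
apply: le_trans (ler_nrmD _ _) _; rewrite nrmM; apply: lerD.
  by apply: ler_pM; rewrite ?nrm_ge0.
apply: le_trans (ler_nrmD _ _) _; rewrite !nrmM; apply: lerD.
  by apply: ler_pM; rewrite ?nrm_ge0.
apply: (@le_trans _ _ (A1 * nrm s * (A2 * nrm s))); first by apply: ler_pM; rewrite ?nrm_ge0.
rewrite mulrACA ler_wpM2l ?mulr_ge0 // ler_wpM2r ?nrm_ge0 //.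
Qed.

(** The coefficient of conj s in a first-order expansion is unique. *)
Lemma first_order_inj F F' (d : R) a b c a' b' c' : 0 < d ->
  (forall s, nrm s < d -> F s = F' s) ->
  first_order F a b c -> first_order F' a' b' c' -> c = c'.
Proof.
move=> d0 FE H H'.
have key (e : R) : 0 < e -> exists2 d' : R, 0 < d' & forall s, nrm s < d' ->
    nrm ((a - a') + (b - b') * s + (c - c') * conjc s) <= e * nrm s.
  move=> e0; have e2 : 0 < e / 2 by rewrite divr_gt0.
  have [d1 d10 h1] := H _ e2; have [d2 d20 h2] := H' _ e2.
  exists (Num.min d (Num.min d1 d2)) => [|s]; first by rewrite !lt_min d0 d10.
  rewrite !lt_min => /and3P[/FE E /h1 k1 /h2 k2]; rewrite E in k1.
  have -> : (a - a') + (b - b') * s + (c - c') * conjc s =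
    (F' s - (a' + b' * s + c' * conjc s)) - (F' s - (a + b * s + c * conjc s)) by ring.
  apply: le_trans (ler_nrmB _ _) _.
  by rewrite [e]splitr mulrDl; apply: lerD.
have aa : a - a' = 0.
  have [d' d'0 h] := key 1 ltr01; have := h 0; rewrite nrm0 => /(_ d'0).
  rewrite conjc0 !mulr0 !addr0 => h0; apply: nrm_eq0; apply/eqP.
  by rewrite eq_le h0 nrm_ge0.
apply/eqP; rewrite -subr_eq0; apply/eqP.
apply: nrm_eq0; apply/eqP; rewrite eq_le nrm_ge0 andbT; apply/ler_addgt0Pr => e e0.
rewrite add0r; have [d' d'0 h] := key e e0; rewrite aa in h.
pose t := d' / 2; have t0 : 0 < t by rewrite divr_gt0.
have td : t < d' by rewrite ltr_pdivrMr // ltr_pMr // ltr1n.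
have nt : nrm (t%:C : C) = t by rewrite nrm_real gtr0_norm.
have ni : nrm ('i * t%:C : C) = t.
  rewrite nrmM nt; have -> : nrm ('i : C) = 1.
    by rewrite /nrm normc_def /= expr0n /= add0r expr1n sqrtr1.
  by rewrite mul1r.
have := h t%:C; have := h ('i * t%:C); rewrite ni nt td => /(_ isT) h1 /(_ isT) h2.
pose X : C := 0 + (b - b') * t%:C + (c - c') * conjc t%:C.
pose Y : C := 0 + (b - b') * ('i * t%:C) + (c - c') * conjc ('i * t%:C).
have ii : 'i * 'i = -1 :> C by apply: complex_ext; rewrite !cReImE /=; ring.
have XY : 2 * (c - c') * t%:C = X + 'i * Y.
  rewrite /X /Y.
  have -> : conjc (t%:C : C) = t%:C by apply: complex_ext; rewrite /= ?oppr0.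
  have -> : conjc ('i * t%:C : C) = - ('i * t%:C).
    by apply: complex_ext; rewrite !cReImE /=; ring.
  transitivity ((1 + 'i * 'i) * (b - b') * t%:C + (1 - 'i * 'i) * (c - c') * t%:C).
    by rewrite ii; ring.
  by ring.
have ni1 : nrm ('i : C) = 1 by rewrite /nrm normc_def /= expr0n /= add0r expr1n sqrtr1.
have n2 : nrm (2 : C) = 2.
  by have := nrm_real (2 : R); rewrite (rmorph_nat (real_complex R)) ger0_norm.
have := congr1 (fun x : C => nrm x) XY; rewrite /= !nrmM nt n2 => h3.
have := ler_nrmD X ('i * Y); rewrite -h3 nrmM ni1 mul1r => h4.
have h5 : nrm (c - c') * (2 * t) <= e * (2 * t) by move: h4 h1 h2; rewrite -/X -/Y; lra.
by rewrite ler_pM2r ?mulr_gt0 // in h5.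
Qed.

End FirstOrder.

(** * From proportional Levi rows to parallel gradients *)

Section LeftEvaluation.
Variables (n : nat) (K : comNzRingType).

(** Fixing the right variables leaves a polynomial in the left ones. *)
Lemma left_evaluation (w : 'rV[K]_n) f : exists g : mpoly.mpoly n K,
  forall z : 'rV[K]_n, mpoly.meval (z 0) g = bieval z w f.
Proof.
exists (mpoly.mmap (@mpoly.mpolyC n K) (fun i => match fintype.split i with
    | inl j => mpoly.mpolyX _ (mpoly.mnm1 j) | inr j => mpoly.mpolyC n (w 0 j) end) f) => z.
elim/mpoly_bi_ind: f => [c|j|j|f g IHf IHg|f g IHf IHg].
- by rewrite mpoly.mmapC mpoly.mevalC bievalC.
- rewrite mpoly.mmapX mpoly.mmap1U bievalXl.
  by rewrite (fintype.unsplitK (inl j)) mpoly.mevalXU.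
- rewrite mpoly.mmapX mpoly.mmap1U bievalXr.
  by rewrite (fintype.unsplitK (inr j)) mpoly.mevalC.
- rewrite mpoly.mmapD mpoly.mevalD bievalD.
  by congr (_ + _); [exact: IHf|exact: IHg].
- rewrite rmorphM mpoly.mevalM bievalM.
  by congr (_ * _); [exact: IHf|exact: IHg].
Qed.


End LeftEvaluation.

Section ParallelGradients.
Variables (R : realType) (n : nat) (p : 'I_n).
Local Notation C := (CC R).
Variables (G : 'rV[C]_n -> C) (z0 : 'rV[C]_n) (r M d : R).
Hypothesis r0 : 0 < r.
Hypothesis hG : holo_lip G (fun b z => 'd G z b) z0 r M.
Hypothesis dr : d <= r / 4.
Local Notation Gd j z := ('d G z (delta_mx 0 j)).
Local Notation cj z := (map_mx (@conjc R) z).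

(** The relation G_p q1 = G_j q2 at the points (z, conj z) of the ball, G_i being
    the derivative of G in the i-th direction. *)
Definition gradient_relation j (q1 q2 : mpoly.mpoly (n + n) C) := forall z,
  nrm (z - z0) < d -> Gd p z * bieval z (cj z) q1 = Gd j z * bieval z (cj z) q2.

(** As the derivatives of G are holomorphic, such a relation can be
    differentiated with respect to the conjugate variables. *)
Lemma gradient_relation_mderiv j m q1 q2 : gradient_relation j q1 q2 ->
  gradient_relation j (mpoly.mderiv (rshift n m) q1) (mpoly.mderiv (rshift n m) q2).
Proof.
move=> H z zd; pose b : 'rV[C]_n := delta_mx 0 m.
have [Dp [Kp hp]] := holo_D (delta_mx 0 p) r0 hG.
have [Dj [Kj hj]] := holo_D (delta_mx 0 j) r0 hG.
have zr : nrm (z - z0) < r / 4 by exact: lt_le_trans zd dr.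
have fG i D K : holo_lip (fun z => 'd G z (delta_mx 0 i)) D z0 (r / 4) K ->
    exists l, first_order (fun s => Gd i (z + s *: b)) (Gd i z) l 0.
  move=> h; exists (D b z); have := first_order_cdiff (h.1 z b zr).
  by rewrite scale0r addr0.
have [lp fp] := fG p _ _ hp; have [lj fj] := fG j _ _ hj.
have fq f : exists l, first_order (fun s => bieval (z + s *: b) (cj (z + s *: b)) f)
    (bieval z (cj z) f) l (bieval z (cj z) (mpoly.mderiv (rshift n m) f)).
  have [N [k [kE k00 k01 _]]] := line_expansion f z b; exists (k 1%N 0%N).
  have -> : (fun s => bieval (z + s *: b) (cj (z + s *: b)) f) =
    fun s => dsum N k s (conjc s) by apply/funext.
  rewrite -k00; have <- : k 0%N 1%N = bieval z (cj z) (mpoly.mderiv (rshift n m) f).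
    rewrite k01 (bigD1 m) //= big1 ?addr0 => [|i im].
      by rewrite mxE !eqxx (_ : conjc _ = 1) ?mul1r //; exact: conjc1.
    by rewrite mxE (negbTE im) andbF (_ : conjc _ = 0) ?mul0r //; exact: conjc0.
  exact: first_order_dsum.
have [l1 f1] := fq q1; have [l2 f2] := fq q2.
have d0 : 0 < d - nrm (z - z0) by rewrite subr_gt0.
have := first_order_inj d0 _ (first_orderM fp f1) (first_orderM fj f2).
rewrite !mul0r !addr0; apply=> s sd; apply: H.
apply: le_lt_trans (ler_nrm_shift _ _ _) _.
by have := nrm_delta_le m s; rewrite -/b; move: sd; lra.
Qed.

Variable q : mpoly.mpoly (n + n) C.
Hypothesis q_noharm : no_pluriharmonic_terms q.
Hypothesis rel : forall j l, gradient_relation j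
  (mpoly.mderiv (rshift n l) (mpoly.mderiv (lshift n j) q))
  (mpoly.mderiv (rshift n l) (mpoly.mderiv (lshift n p) q)).

(** The relation between the derivatives at (z, conj z) extends to (z, w). *)
Lemma gradient_relation_bieval (z w : 'rV[C]_n) j : nrm (z - z0) < d ->
  Gd p z * bieval z w (mpoly.mderiv (lshift n j) q) =
  Gd j z * bieval z w (mpoly.mderiv (lshift n p) q).
Proof.
move=> zd; pose comb f1 f2 : mpoly.mpoly (n + n) C := Gd p z *: f1 - Gd j z *: f2.
have combE y f1 f2 : bieval z y (comb f1 f2) = Gd p z * bieval z y f1 - Gd j z * bieval z y f2.
  by rewrite /comb bievalB !bievalZ.
have combD l f1 f2 : mpoly.mderiv (rshift n l) (comb f1 f2) =
    comb (mpoly.mderiv (rshift n l) f1) (mpoly.mderiv (rshift n l) f2).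
  by rewrite /comb mpoly.mderivB !mpoly.mderivZ.
(* The combinations G_p(z) q1 - G_j(z) q2, for a fixed z, form a class closed
   under differentiation and vanishing at (z, conj z). *)
pose Cl f := exists f1 f2, gradient_relation j f1 f2 /\ f = comb f1 f2.
have CD f l : Cl f -> Cl (mpoly.mderiv (rshift n l) f).
  move=> [f1 [f2 [h ->]]]; exists (mpoly.mderiv (rshift n l) f1), (mpoly.mderiv (rshift n l) f2).
  by split; [exact: gradient_relation_mderiv|exact: combD].
have C0 f : Cl f -> bieval z (cj z) f = 0.
  by move=> [f1 [f2 [h ->]]]; rewrite combE (h z zd) subrr.
pose f := comb (mpoly.mderiv (lshift n j) q) (mpoly.mderiv (lshift n p) q).
have f0 l y : bieval z y (mpoly.mderiv (rshift n l) f) = 0.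
  apply: (bieval_taylor_eq0 CD C0); rewrite combD.
  by do 2!eexists; split; last reflexivity; exact: rel.
have := bieval_const_right f0 w; rewrite !combE.
have h m : mpoly.mcoeff m q != 0 -> (0 < \sum_(i < n) m (rshift n i))%N.
  by move=> /q_noharm[].
by rewrite !(bieval_mderiv_r0 _ _ h) !mulr0 subr0 => /eqP; rewrite subr_eq0 => /eqP.
Qed.

Hypothesis d0 : 0 < d.
Hypothesis Gp0 : forall z, nrm (z - z0) < d -> Gd p z != 0.

Lemma parallel_left_gradients (z w w' : 'rV[C]_n) i j :
  bieval z w (mpoly.mderiv (lshift n i) q) * bieval z w' (mpoly.mderiv (lshift n j) q) =
  bieval z w (mpoly.mderiv (lshift n j) q) * bieval z w' (mpoly.mderiv (lshift n i) q).
Proof.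
pose Q i := mpoly.mderiv (lshift n i) q.
have [g1 g1E] := left_evaluation w (Q i); have [g2 g2E] := left_evaluation w' (Q j).
have [g3 g3E] := left_evaluation w (Q j); have [g4 g4E] := left_evaluation w' (Q i).
pose F := g1 * g2 - g3 * g4.
have FE (y : 'rV[C]_n) : mpoly.meval (y 0) F =
    bieval y w (Q i) * bieval y w' (Q j) - bieval y w (Q j) * bieval y w' (Q i).
  by rewrite mpoly.mevalB !mpoly.mevalM g1E g2E g3E g4E.
suff F0 : F = 0.
  by apply/eqP; rewrite -subr_eq0 -[_ - _]FE F0 mpoly.meval0.
apply: (@mpoly_identity _ _ _ z0) => v.
have v1 : 0 < nrm v + 1 by rewrite ltr_wpDl // nrm_ge0.
pose u (k : nat) : C := (d / 2 / (nrm v + 1) / k.+1%:R)%:C.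
have c0 : d / 2 / (nrm v + 1) != 0 by rewrite gt_eqF // !divr_gt0.
exists u; split=> [k l /(congr1 (@complex.Re R)) /=|k].
  by move=> /(mulfI c0) /invr_inj /eqP; rewrite eqr_nat eqSS => /eqP.
have near : nrm (z0 + u k *: v - z0) < d.
  rewrite addrC addKr nrmZ nrm_real.
  have k0 : 0 < k.+1%:R :> R by rewrite ltr0Sn.
  rewrite gtr0_norm ?divr_gt0 //.
  have k1 : 1 <= k.+1%:R :> R by rewrite ler1n.
  have : d / 2 / (nrm v + 1) / k.+1%:R <= d / 2 / (nrm v + 1).
    by rewrite ler_pdivrMr // ler_peMr // ltW // !divr_gt0.
  move=> h; apply: le_lt_trans (ler_wpM2r (nrm_ge0 v) h) _.
  rewrite mulrAC ltr_pdivrMr //; have := nrm_ge0 v; have := d0.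
  by move=> h1 h2; have := mulr_ge0 (ltW h1) h2; lra.
set y := z0 + _ in near *; have g0 := Gp0 near.
(* Near z0 every Q_l is the multiple (G_l / G_p)(z) of Q_p. *)
have gE x l : bieval y x (Q l) = Gd l y / Gd p y * bieval y x (Q p).
  by rewrite mulrAC -(gradient_relation_bieval x l near) mulrAC mulfV // mul1r.
rewrite FE (gE w i) (gE w j) (gE w' i) (gE w' j); ring.
Qed.

End ParallelGradients.

(** * Subharmonic power sums *)

Section PowerSums.
Variables (R : realType) (m : nat).
Local Notation C := (CC R).
Implicit Types (a w : C) (c : 'I_m -> C) (k l : 'I_m -> nat).

(** The sum of the terms c_b w^(k_b) (conj w)^(l_b). *)
Definition power_sum c k l w : C := \sum_b c b * w ^+ k b * conjc w ^+ l b.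

(** The coefficients of the expansion of a power sum about a. *)
Definition power_coef c k l a i j : C :=
  \sum_b c b * (a ^+ (k b - i) *+ 'C(k b, i)) * (conjc a ^+ (l b - j) *+ 'C(l b, j)).

Lemma exprD_wide (x y : C) d N : (d <= N)%N ->
  (x + y) ^+ d = \sum_(i < N.+2) (x ^+ (d - i) *+ 'C(d, i)) * y ^+ i.
Proof.
move=> dN; rewrite exprDn.
pose F i := (x ^+ (d - i) *+ 'C(d, i)) * y ^+ i.
rewrite (eq_bigr (fun i : 'I_d.+1 => F i)); last by move=> i _; rewrite /F mulrnAl.
rewrite -[RHS](big_mkord xpredT F) (@big_cat_nat _ _ _ d.+1) //=; last by rewrite ltnS leqW.
rewrite big_mkord -[LHS]addr0; congr (_ + _).
rewrite big_nat_cond big1 // => i /andP[/andP[di _] _].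
by rewrite /F bin_small // mulr0n mul0r.
Qed.

Lemma power_sum_dsum c k l N a w : (forall b, (k b <= N)%N) -> (forall b, (l b <= N)%N) ->
  power_sum c k l (a + w) = dsum N (power_coef c k l a) w (conjc w).
Proof.
move=> kN lN; rewrite /dsum.
transitivity (\sum_(i < N.+2) \sum_(j < N.+2) \sum_b
   c b * (a ^+ (k b - i) *+ 'C(k b, i)) * (conjc a ^+ (l b - j) *+ 'C(l b, j)) *
     w ^+ i * conjc w ^+ j); last first.
  by apply: eq_bigr => i _; apply: eq_bigr => j _; rewrite /power_coef -mulrA mulr_suml;
     apply: eq_bigr => b _; rewrite mulrA.
rewrite (eq_bigr (fun i : 'I_N.+2 => \sum_b \sum_(j < N.+2)
   c b * (a ^+ (k b - i) *+ 'C(k b, i)) * (conjc a ^+ (l b - j) *+ 'C(l b, j)) *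
     w ^+ i * conjc w ^+ j)); last by move=> i _; rewrite exchange_big.
rewrite exchange_big; apply: eq_bigr => b _.
rewrite (rmorphD (@conjc R)) (exprD_wide _ _ (kN b)) (exprD_wide _ _ (lN b)).
rewrite -mulrA mulr_suml mulr_sumr; apply: eq_bigr => i _.
by rewrite !mulr_sumr; apply: eq_bigr => j _; ring.
Qed.

(** The mixed second derivative of a power sum. *)
Definition power_levi c k l :=
  power_sum (fun b => c b * (k b)%:R * (l b)%:R) (fun b => (k b).-1) (fun b => (l b).-1).

Lemma power_levi_coef c k l a i j :
  power_coef (fun b => c b * (k b)%:R * (l b)%:R) (fun b => (k b).-1) (fun b => (l b).-1) a i j =
  i.+1%:R * j.+1%:R * power_coef c k l a i.+1 j.+1.
Proof.
rewrite /power_coef mulr_sumr; apply: eq_bigr => b _.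
have bin (x : C) d r : d%:R * (x ^+ (d.-1 - r) *+ 'C(d.-1, r)) =
    r.+1%:R * (x ^+ (d - r.+1) *+ 'C(d, r.+1)).
  rewrite -!(mulr_natl (x ^+ _)) !mulrA -!natrM mul_bin_diag; congr (_ * x ^+ _).
  by rewrite subnS -predn_sub -!subn1 subnAC.
transitivity (c b * ((k b)%:R * (a ^+ ((k b).-1 - i) *+ 'C((k b).-1, i))) *
   ((l b)%:R * (conjc a ^+ ((l b).-1 - j) *+ 'C((l b).-1, j)))); first by ring.
by rewrite !bin; ring.
Qed.

Variables (c : 'I_m -> C) (k l : 'I_m -> nat) (s : C -> R).
Hypothesis sE : forall w, (s w)%:C = power_sum c k l w.
Hypothesis levi0 : forall w, 0 <= complex.Re (power_levi c k l w).

Let N := \sum_b (k b + l b).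
Let kN b : (k b <= N)%N.
Proof. by rewrite /N (bigD1 b) //=; exact: leq_trans (leq_addr _ _) (leq_addr _ _). Qed.
Let lN b : (l b <= N)%N.
Proof. by rewrite /N (bigD1 b) //=; exact: leq_trans (leq_addl _ _) (leq_addr _ _). Qed.
Let kN' b : ((k b).-1 <= N)%N.
Proof. exact: leq_trans (leq_pred _) (kN b). Qed.
Let lN' b : ((l b).-1 <= N)%N.
Proof. exact: leq_trans (leq_pred _) (lN b). Qed.

Let sD a w : (s (a + w))%:C = dsum N (power_coef c k l a) w (conjc w).
Proof. by rewrite sE (power_sum_dsum _ _ _ kN lN). Qed.

Let k00 a : (s a)%:C = power_coef c k l a 0 0.
Proof.
by rewrite sE; apply: eq_bigr => b _; rewrite !subn0 !bin0 !mulr1n.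
Qed.

Let s_continuous a (e : R) : 0 < e -> exists2 d : R, 0 < d &
  forall w, nrm w < d -> `|s (a + w) - s a| < e.
Proof.
move=> e0; have S0 := dsum_norm_ge0 N (power_coef c k l a).
set S := dsum_norm _ _ in S0; set K := power_coef c k l a in S S0.
pose L := S + nrm (K 1%N 0%N) + nrm (K 0%N 1%N).
have L0 : 0 <= L by rewrite !addr_ge0 // nrm_ge0.
have L1 : 0 < L + 1 by rewrite ltr_wpDl.
exists (Num.min 1 (e / (L + 1))) => [|w]; first by rewrite lt_min ltr01 divr_gt0.
rewrite lt_min ltr_pdivlMr // => /andP[/ltW w1 we].
rewrite -nrm_real rmorphB /= sD k00 -/K.
apply: le_lt_trans we; have := dsum_first_order N K w1.
set X := dsum _ _ _ _ => h.
have -> : X - K 0%N 0%N = (X - (K 0%N 0%N + K 1%N 0%N * w + K 0%N 1%N * conjc w)) +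
   (K 1%N 0%N * w + K 0%N 1%N * conjc w) by ring.
apply: le_trans (ler_nrmD _ _) _; apply: le_trans (lerD h (first_order_lin_le _ _ _)) _.
have : S * nrm w ^+ 2 <= S * nrm w.
  by rewrite ler_wpM2l // expr2 ler_piMl ?nrm_ge0.
by rewrite -/S /L; have := nrm_ge0 w; lra.
Qed.

Let s_mean_ge a (x : R) : 0 < x ->
  complex.Re (power_coef c k l a 0 0) <=
    complex.Re (\sum_(i < N.+2) power_coef c k l a i i * (x ^+ 2)%:C ^+ i).
Proof.
move=> x0; pose D i : R := complex.Re (power_coef c k l a i i).
pose p : {poly R} := \poly_(i < N.+2) D i.
have ReE (F : nat -> C) (y : R) : complex.Re (\sum_(i < N.+2) F i * y%:C ^+ i) =
    \sum_(i < N.+2) complex.Re (F i) * y ^+ i.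
  rewrite (big_morph (@complex.Re R) (@cReD R) (erefl : complex.Re (0 : C) = 0)) /=; apply: eq_bigr => i _.
  by rewrite -rmorphXn cReM /= mulr0 subr0.
have pE (y : R) : p.[y] = \sum_(i < N.+2) D i * y ^+ i by rewrite horner_poly.
have D0 i : (N < i)%N -> D i = 0.
  move=> Ni; rewrite /D /power_coef big1 // => b _.
  by rewrite bin_small ?mulr0n ?mulr0 ?mul0r //; exact: leq_ltn_trans (kN b) Ni.
(* p is the mean as a function of the squared radius; u = x p' has derivative the
   mean of the mixed second derivative. *)
pose u : {poly R} := 'X * p^`().
have uE (y : R) : (u^`()).[y] = \sum_(i < N.+2) i.+1%:R * i.+1%:R * D i.+1 * y ^+ i.
  have -> : u^`() = \poly_(i < N.+2) (i.+1%:R * i.+1%:R * D i.+1).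
    apply/polyP => i; rewrite coef_deriv coefXM /= coef_deriv !coef_poly.
    case: (ltnP i.+1 N.+2) => h.
      by rewrite (ltnW h) -mulrA !mulr_natl.
    by rewrite (D0 i.+1 (ltnW h)) mulr0 !mul0rn; case: ifP.
  by rewrite horner_poly.
have u'0 (y : R) : 0 <= y -> 0 <= (u^`()).[y].
  move=> y0; pose r := Num.sqrt y; have rE : r ^+ 2 = y by rewrite sqr_sqrtr.
  pose K2 := power_coef (fun b => c b * (k b)%:R * (l b)%:R)
     (fun b => (k b).-1) (fun b => (l b).-1) a.
  have [[cr _] cI] := cint_dsum N K2 r.
  rewrite uE; have := congr1 (@complex.Re R) cI; rewrite cReM /= mul0r subr0 rE (ReE (fun i => K2 i i)).
  rewrite (eq_bigr (fun i : 'I_N.+2 => i.+1%:R * i.+1%:R * D i.+1 * y ^+ i)); last first.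
    move=> i _; rewrite /K2 power_levi_coef /D -natrM -(rmorph_nat (real_complex R)).
    by rewrite cReM /= mul0r subr0 natrM.
  move=> E; rewrite -(pmulr_rge0 _ (twopi_gt0 R)); rewrite -E.
  have c0 : circ_int (fun=> 0 : R) = 0 by rewrite circ_int_cst mulr0.
  rewrite -[leLHS]c0; apply: le_circ_int; [by move=> t; exact: cst_continuous|exact: cr|] => t.
  by rewrite /K2 -(power_sum_dsum _ _ _ kN' lN'); exact: levi0.
have mvt (q : {poly R}) (y : R) : 0 <= y -> (forall t, 0 <= t -> 0 <= (q^`()).[t]) ->
    q.[0] <= q.[y].
  move=> y0 q'0; have [z /andP[z0 zy] E] := @real_MVT R (horner q) (horner q^`()) 0 y y0
    (fun t _ => is_derive_poly q t).
  by rewrite -subr_ge0 E subr0 mulr_ge0 // q'0.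
have p'0 (t : R) : 0 <= t -> 0 <= (p^`()).[t].
  move=> t0; have [->|t1] := eqVneq t 0.
    have := u'0 0 (lexx _); rewrite /u derivM derivX mul1r hornerD [('X * _).[0]](_ : _ = 0) ?addr0 //.
    by rewrite hornerM hornerX mul0r.
  have tp : 0 < t by rewrite lt_neqAle eq_sym t1.
  have := mvt u t t0 u'0; rewrite /u !hornerM !hornerX mul0r.
  by rewrite pmulr_rge0.
have := mvt p (x ^+ 2) (sqr_ge0 _) p'0.
by rewrite (ReE (fun i => power_coef c k l a i i)) -pE horner_coef0 coef_poly.
Qed.

(** A real power sum with nonnegative mixed second derivative is subharmonic:
    its means on the circles about a point, as functions p of the squared radius
    x, satisfy (x p')' >= 0. *)
Lemma subharmonic_power_sum : subharmonic s.
Proof.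
split=> [x b xb|a r r_gt0].
  have e0 : 0 < b - s x by rewrite subr_gt0.
  have [d d0 H] := s_continuous x e0.
  apply/nbhs_nrmP; exists d => // y /H; rewrite (_ : x + (y - x) = y); last by ring.
  by move=> h; have := le_lt_trans (ler_norm (s y - s x)) h; lra.
have [[cr _] cI] := cint_dsum N (power_coef c k l a) r.
pose f t := s (a + r%:C * (cos t +i* sin t)).
have fE : f = fun t => complex.Re (dsum N (power_coef c k l a) (r%:C * expi t) (conjc (r%:C * expi t))).
  by apply/funext => t; rewrite -sD.
have cf : continuous f by rewrite fE.
have := congr1 (@complex.Re R) cI; rewrite /cint cReM /= -fE mul0r subr0 => E.
rewrite (integral_circ_int cf) lee_fin E ler_pM2l ?twopi_gt0 //.
have -> : s a = complex.Re (power_coef c k l a 0 0) by rewrite -k00.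
exact: s_mean_ge.
Qed.

End PowerSums.

(** * The factorization *)

Lemma complex_root (R : realType) (y : CC R) e : (0 < e)%N -> exists t : CC R, t ^+ e = y.
Proof. by move=> e0; exists (e.-root (y : R[i])); exact: rootCK. Qed.

Lemma homog_meval n (K : comNzRingType) d (h : mpoly.mpoly n K) (a : K) (z : 'rV[K]_n) :
  h \is @mpoly.ishomog1 n K d mpoly.mdeg ->
  mpoly.meval ((a *: z) 0) h = a ^+ d * mpoly.meval (z 0) h.
Proof.
move=> /mpoly.dhomogP hh; rewrite !mpoly.mevalE mulr_sumr big_seq [RHS]big_seq.
apply: eq_bigr => m /hh md.
have -> : \prod_i (a *: z) 0 i ^+ mpoly.fun_of_multinom m i =
    a ^+ d * \prod_i z 0 i ^+ mpoly.fun_of_multinom m i.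
  have -> : d = (\sum_i mpoly.fun_of_multinom m i)%N by rewrite -[LHS]md; exact: mpoly.mdegE.
  rewrite -prodrXr -big_split; apply: eq_bigr => i _.
  by rewrite mxE exprMn.
by rewrite mulrCA.
Qed.

Lemma gradient_neq0 (R : realType) n (G : 'rV[CC R]_n -> CC R) z v :
  'd G z v != 0 -> exists p, 'd G z (delta_mx 0 p) != 0.
Proof.
move=> Gv; apply: contrapT => H; move/negP: Gv; apply; apply/eqP.
rewrite [v]row_sum_delta linear_sum big1 // => j _.
have Gj : 'd G z (delta_mx 0 j) = 0.
  by apply/eqP/negPn/negP => h; apply: H; exists j.
by rewrite linearZ /= Gj; exact: mulr0.
Qed.

Section PowerSumPolynomial.
Variables (R : realType) (m d : nat).
Local Notation C := (CC R).
Variables (c : 'I_m -> C) (k l : 'I_m -> nat).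
Hypothesis kl : forall b, c b != 0 -> [/\ (0 < k b)%N, (0 < l b)%N & (k b + l b)%N = d].

Let mono b : mpoly.multinom (1 + 1) :=
  mpoly.mnm_add (mpoly.mnm_muln (mpoly.mnm1 (lshift 1 0)) (k b))
                (mpoly.mnm_muln (mpoly.mnm1 (rshift 1 0)) (l b)).

Let ps : mpoly.mpoly (1 + 1) C := \sum_b c b *: mpoly.mpolyX _ (mono b).

Let ps_coef mu : mpoly.mcoeff mu ps != 0 -> exists2 b, c b != 0 & mu = mono b.
Proof.
move=> h; apply: contrapT => H; move/negP: h; apply; apply/eqP.
rewrite /ps raddf_sum big1 // => b _ /=; rewrite mpoly.mcoeffZ mpoly.mcoeffX.
have [->|cb] := eqVneq (c b) 0; first by rewrite mul0r.
have [mE|_] := eqVneq (mono b) mu; last by rewrite mulr0.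
by case: H; exists b.
Qed.

Let mono_l b : mono b (lshift 1 0) = k b.
Proof. by rewrite mpoly.mnmDE !mpoly.mulmnE !mpoly.mnm1E /= mul1n mul0n addn0. Qed.
Let mono_r b : mono b (rshift 1 0) = l b.
Proof. by rewrite mpoly.mnmDE !mpoly.mulmnE !mpoly.mnm1E /= mul1n mul0n. Qed.

(** A real-valued power sum with mixed terms of one degree is represented by a
    homogeneous polynomial without harmonic terms. *)
Lemma power_sum_poly (s : C -> R) : (forall w, (s w)%:C = power_sum c k l w) ->
  homogeneous_poly_without_pluriharmonic_terms (fun w : 'rV[C]_1 => s (w 0 0)).
Proof.
move=> sE; exists d, ps; split.
- move=> z; rewrite sE /ps; transitivity (\sum_b mpoly.meval (with_conj z)
      (c b *: mpoly.mpolyX _ (mono b))); last by rewrite raddf_sum.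
  apply: eq_bigr => b _; rewrite mpoly.mevalZ mpoly.mevalX.
  rewrite big_split_ord /= !big_ord1 mono_l mono_r /with_conj row_mxEl row_mxEr mxE.
  by rewrite mulrA.
- apply/mpoly.dhomogP => mu; rewrite mpoly.mcoeff_msupp => /ps_coef[b cb ->].
  have [_ _ klE] := kl cb; rewrite -[RHS]klE; transitivity (mpoly.mdeg (mono b)); first by [].
  by rewrite /mono mpoly.mdegD !mpoly.mdegMn !mpoly.mdeg1 !mul1n.
move=> mu /ps_coef[b cb ->]; rewrite !big_ord1 mono_l mono_r.
by have [] := kl cb.
Qed.

End PowerSumPolynomial.

Section LeviOfPowerSum.
Variables (R : realType) (m d : nat).
Local Notation C := (CC R).
Variables (c : 'I_m -> C) (k l : 'I_m -> nat).
Hypothesis kl : forall b, c b != 0 -> [/\ (0 < k b)%N, (0 < l b)%N & (k b + l b)%N = d].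

(** If the pullback of the power sum by (1 + t)^e w is subharmonic in t, its mixed
    second derivative at w is nonnegative. *)
Lemma power_levi_ge0 (w : C) (u : C -> R) e : (0 < e)%N -> w != 0 -> subharmonic u ->
  (forall t, (u t)%:C = power_sum c k l ((1 + t) ^+ e * w)) ->
  0 <= complex.Re (power_levi c k l w).
Proof.
move=> e0 w0 su uE.
pose c' b := c b * w ^+ k b * conjc w ^+ l b.
pose k' b := (e * k b)%N; pose l' b := (e * l b)%N.
pose N := (\sum_b (k' b + l' b))%N.
have kN b : (k' b <= N)%N.
  by rewrite /N (bigD1 b) //=; exact: leq_trans (leq_addr _ _) (leq_addr _ _).
have lN b : (l' b <= N)%N.
  by rewrite /N (bigD1 b) //=; exact: leq_trans (leq_addl _ _) (leq_addr _ _).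
have uD t : (u (0 + t))%:C = dsum N (power_coef c' k' l' 1) t (conjc t).
  rewrite add0r uE -(power_sum_dsum _ _ _ kN lN); apply: eq_bigr => b _.
  rewrite (rmorphM (@conjc R)) rmorphXn !exprMn -!exprM /c' /k' /l'; ring.
have := subharmonic_dsum_ge0 su uD.
pose X : R := e%:R * e%:R * nrm w ^+ 2.
have X0 : 0 < X.
  have nw : 0 < nrm w.
    rewrite lt_neqAle nrm_ge0 andbT eq_sym.
    by apply: contraNneq w0 => /nrm_eq0 ->.
  by rewrite /X !mulr_gt0 ?ltr0n // exprn_gt0.
have wE : w * conjc w = (nrm w ^+ 2)%:C.
  have nE : nrm w ^+ 2 = complex.Re w ^+ 2 + complex.Im w ^+ 2.
    by rewrite /nrm normc_def /= sqr_sqrtr // addr_ge0 // sqr_ge0.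
  by rewrite nE; case: (w) => a b; apply: complex_ext; rewrite !cReImE /=; ring.
suff -> : power_coef c' k' l' 1 1 1 = X%:C * power_levi c k l w.
  by rewrite cReM /= mul0r subr0 pmulr_rge0.
rewrite /X rmorphM /= -wE rmorphM /= (rmorph_nat (real_complex R)) mulr_sumr.
apply: eq_bigr => b _; have [cb|cb] := eqVneq (c b) 0; first by rewrite /c' cb !mul0r mulr0.
have [k0 l0 _] := kl cb; rewrite !bin1 conjc1 !expr1n /c' /k' /l'.
rewrite -{1}(prednK k0) -{1}(prednK l0) !exprS !natrM; ring.
Qed.

(** By homogeneity the value at 0 is 0, or the value at 1 when d = 2. *)
Lemma power_levi_ge0_at0 : 0 <= complex.Re (power_levi c k l 1) ->
  0 <= complex.Re (power_levi c k l 0).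
Proof.
move=> h; have [d2|d2] := eqVneq d 2%N.
  suff -> : power_levi c k l 0 = power_levi c k l 1 by [].
  apply: eq_bigr => b _; have [->|cb] := eqVneq (c b) 0; first by rewrite !mul0r.
  have [k0 l0 E] := kl cb; rewrite d2 in E.
  have [-> ->] : k b = 1%N /\ l b = 1%N.
    by move: k0 l0 E; case: (k b) (l b) => [|[|?]] [|[|?]] //; rewrite ?addSn ?addnS.
  by rewrite /= !expr0.
suff -> : power_levi c k l 0 = 0 by [].
apply: big1 => b _; have [->|cb] := eqVneq (c b) 0; first by rewrite !mul0r.
have [k0 l0 E] := kl cb; rewrite conjc0.
move: k0 l0 E; case: (k b) (l b) => [|[|i]] [|[|j]] //= _ _ E.
- by rewrite -E in d2.
- by rewrite [0 ^+ _.+1]exprS mul0r mulr0.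
- by rewrite [0 ^+ _.+1]exprS mul0r mulr0 mul0r.
by rewrite [0 ^+ _.+1]exprS mul0r mulr0 mul0r.
Qed.

End LeviOfPowerSum.

Lemma lipschitz_neq0 (R : realType) (V : normedModType (CC R)) (D : V -> CC R) z0
    (r K : R) : 0 < r -> 0 <= K ->
  (forall z, nrm (z - z0) < r -> nrm (D z - D z0) <= K * nrm (z - z0)) -> D z0 != 0 ->
  exists rho : R, [/\ 0 < rho, rho <= r & forall z, nrm (z - z0) < rho -> D z != 0].
Proof.
move=> r0 K0 HD D0; have K1 : 0 < K + 1 by rewrite ltr_wpDl.
have n0 : 0 < nrm (D z0).
  by rewrite lt_neqAle nrm_ge0 andbT eq_sym; apply: contraNneq D0 => /nrm_eq0 ->.
exists (Num.min r (nrm (D z0) / (K + 1))); split=> [||z].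
- by rewrite lt_min r0 divr_gt0.
- by rewrite ge_min lexx.
rewrite lt_min (ltr_pdivlMr _ _ K1) => /andP[/HD h1 h2]; apply/eqP => Dz.
move: h1; rewrite Dz sub0r nrmN; have := nrm_ge0 (z - z0); move: h2; lra.
Qed.

Theorem theorem2p3 (R : realType) (n : nat) (P : 'rV[CC R]_n -> R) :
  (2 <= n)%N ->
  (exists z w, P z != P w) ->
  homogeneous_poly_without_pluriharmonic_terms P ->
  plurisubharmonic P ->
  (exists (G : 'rV[CC R]_n -> CC R) (U : set 'rV[CC R]_n),
     [/\ forall z, differentiable G z,
         open U /\ U !=set0,
         nonsingular_on U G &
         pluriharmonic_along_level_sets U G P]) ->
  exists (s : CC R -> R) (h : mpoly.mpoly n (CC R)),
    [/\ homogeneous_poly_without_pluriharmonic_terms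
          (fun w : 'rV[CC R]_1 => s (w 0 0)),
        subharmonic s,
        exists k : nat, h \is homog_deg k &
        forall z, P z = s (mpoly.meval (z 0) h)].
Proof.
move=> _ [za [zb Pne]] [d [q [qP qh qn]]] psh [G [U [dG [oU U0] ns ph]]].
have [z0 [r [M [r0 ballU hG]]]] := differentiable_lipschitz_ball dG oU U0.
have z0U : U z0 by apply: ballU; rewrite subrr nrm0.
have [v Gv] := ns z0 z0U; have [p Gp] := gradient_neq0 Gv.
have [K K0 HK] := holo_D_lip (delta_mx 0 p) r0 hG.
have r2 : 0 < r / 2 by rewrite divr_gt0.
have n0 : nrm (z0 - z0) < r / 2 by rewrite subrr nrm0.
have r4 : 0 < r / 4 by rewrite divr_gt0.
have r42 : r / 4 <= r / 2 by rewrite ler_pM2l // lef_pV2 ?posrE ?ler_nat.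
have [rho [rho0 rho4 Gp0]] := lipschitz_neq0 r4 K0
  (fun z zr => HK z z0 (lt_le_trans zr r42) n0) Gp.
have rel j l : gradient_relation p G z0 rho j
    (mpoly.mderiv (rshift n l) (mpoly.mderiv (lshift n j) q))
    (mpoly.mderiv (rshift n l) (mpoly.mderiv (lshift n p) q)).
  move=> z zr; apply: (levi_rank qP psh dG hG ballU ph _ (Gp0 z zr)).
  by move: zr rho4 r0; lra.
have par := parallel_left_gradients r0 hG rho4 qn rel rho0 Gp0.
have qE z : bieval z (map_mx (@conjc R) z) q = (P z)%:C by rewrite qP.
have herm : forall z w : 'rV[CC R]_n, bieval z (map_mx (@conjc R) w) q =
    conjc (bieval w (map_mx (@conjc R) z) q).
  apply: bieval_hermitian => z; rewrite [bieval _ _ _]qE.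
  by apply: complex_ext; rewrite /= ?oppr0.
have q0 : q != 0.
  apply: contraNneq Pne => q0; apply/eqP.
  have PC z : (P z)%:C = 0 by rewrite qP q0 mpoly.meval0.
  by have := congr1 (@complex.Re R) (etrans (PC za) (esym (PC zb))).
have [h [e [c [k [l [e0 hh h0 cb E]]]]]] := 
  @hermitian_structure n (CC R) (@conjc R) q d qh qn herm par q0.
have PS z : (P z)%:C = power_sum c k l (mpoly.meval (z 0) h) by rewrite -qE E.
have [z1 hz1] : exists z1 : 'rV[CC R]_n, mpoly.meval (z1 0) h != 0.
  apply: contrapT => H; move/negP: h0; apply; apply/eqP; apply: mpoly_eval_eq0 => x.
  apply/eqP/negPn/negP => hx; apply: H; exists (\row_i x i).
  by rewrite (mpoly.meval_eq (v2 := x)) // => i; rewrite mxE.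
(* A nonconstant homogeneous polynomial is onto, by extraction of roots. *)
have surj w : exists z : 'rV[CC R]_n, mpoly.meval (z 0) h = w.
  have [t tE] := complex_root (w / mpoly.meval (z1 0) h) e0.
  by exists (t *: z1); rewrite (homog_meval _ _ hh) tE divfK.
pose s w := complex.Re (power_sum c k l w).
have sE w : (s w)%:C = power_sum c k l w.
  by have [z <-] := surj w; rewrite /s -PS.
have kl b : c b != 0 -> [/\ (0 < k b)%N, (0 < l b)%N & (k b + l b)%N = (d %/ e)%N].
  by move=> /cb[kb lb <-]; rewrite mulnK.
have levi_pos w : w != 0 -> 0 <= complex.Re (power_levi c k l w).
  move=> w0; have [z zw] := surj w.
  apply: (power_levi_ge0 kl (u := fun t => P (z + t *: z)) e0 w0); first exact: psh.2.
  move=> t; rewrite PS -{1}[z]scale1r -scalerDl (homog_meval _ _ hh) zw.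
  by [].
exists s, h; split.
- exact: power_sum_poly kl s sE.
- apply: subharmonic_power_sum sE _ => w.
  have [->|] := eqVneq w 0; last exact: levi_pos.
  by apply: (power_levi_ge0_at0 kl); apply: levi_pos; exact: oner_neq0.
- by exists e.
by move=> z; rewrite /s -PS.
Qed.
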